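(* Let $\mathbb{X}$ be a Polish space and let $c:\mathbb{X}\times\mathbb{X}\to\mathbb{R}\cup\{+\infty\}$ be a debiasable ground cost. Then, for a given $\varepsilon\in[0,+\infty]$, $\mathrm{OT}^\varepsilon_c$ is debiasable provided that one of the following sufficient conditions holds: (a) $\varepsilon=0$ (classical optimal transport); (b) $\varepsilon\in(0,+\infty)$ and one of the following holds: (b1) ($c$ behaves like a squared Euclidean distance) there exist a Polish space $\mathcal{Z}$ and a measurable function $\psi:\mathbb{X}\times\mathcal{Z}\to\mathbb{R}\cup\{+\infty\}$ with $c(x,y)=\inf_{z\in\mathcal{Z}}\psi(x,z)+\psi(y,z)$ for all $x,y\in\mathbb{X}$, a probability measure $\lambda\in\mathcal{P}(\mathcal{Z})$ with $\int_{\mathcal{Z}}e^{-2\psi(x,z)/\varepsilon}\,d\lambda(z)<+\infty$ for all $x\in\mathbb{X}$, and a function $f:\mathbb{X}\to(0,+\infty]$ such that for all $x,y\in\mathbb{X}$ $$e^{-c(x,y)/\varepsilon}=\frac{1}{f(x)f(y)}\int_{\mathcal{Z}}e^{-\frac{\psi(x,z)+\psi(y,z)}{\varepsilon}}\,d\lambda(z);$$ (b2) $c$ is real-valued, continuous and negative definite; (b3) $c$ is real-valued, $k=e^{-c/\varepsilon}$ is a bounded continuous positive semidefinite kernel, and the set of measures is restricted to a bounded set with respect to $c$, namely the pairs $(\mu,\nu)$ are restricted to the set $\mathcal{D}^M$ for some $M>0$, where $\mathcal{D}^M$ is the set of $(\mu,\nu)\in\mathcal{P}(\mathbb{X})\times\mathcal{P}(\mathbb{X})$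 with $\int_{\mathbb{X}\times\mathbb{X}} e^{c/\varepsilon}\,d(\mu\otimes\nu)\le M$ and $\int_{\mathbb{X}}\sqrt{k(x,x)}\,d\mu(x)<+\infty$, $\int_{\mathbb{X}}\sqrt{k(x,x)}\,d\nu(x)<+\infty$; (c) $\varepsilon=+\infty$ and $c$ is real-valued and negative definite (for pairs $\mu,\nu$ such that $\int_{\mathbb{X}\times\mathbb{X}}|c(x,y)|\,d\xi(x)\,d\xi(y)$ exists and is finite for $\xi\in\{\mu,\nu,\mu-\nu\}$). In all these cases, one can write $$\mathrm{OT}^\varepsilon_c(\mu,\nu)=\inf_{\eta\in\mathcal{Y}}\Psi(\mu,\eta)+\Psi(\nu,\eta)$$ for some set $\mathcal{Y}$ and some function $\Psi:\mathcal{P}(\mathbb{X})\times\mathcal{Y}\to\mathbb{R}\cup\{+\infty\}$ (for the pairs $(\mu,\nu)$ under consideration). In addition, the unbalanced versions $\mathrm{UOT}^\varepsilon_{c,F}$ of $\mathrm{OT}^\varepsilon_c$ are also debiasable. Finally, for any $\varepsilon\in[0,+\infty]$, if $\mathrm{OT}^\varepsilon_c$ is debiasable (respectively strictly debiasable), then so is $c$, by considering Dirac masses.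
   Context: A cost on a set $\mathcal{X}$ is a symmetric function $c:\mathcal{X}\times\mathcal{X}\to\mathbb{R}\cup\{+\infty\}$. Its debiased version is $c_0(x,y)=c(x,y)-\tfrac12c(x,x)-\tfrac12c(y,y)$, with the rule $\infty-\infty=+\infty$. The cost $c$ is debiasable if $c_0(x,y)\ge0$ for all $x,y\in\mathcal{X}$, and strictly debiasable if $c_0(x,y)>0$ for all $x\ne y$. When pairs are restricted to a given set, debiasable means that this inequality holds for the pairs in that set. $\mathcal{P}(\mathbb{X})$ is the set of Borel probability measures on $\mathbb{X}$, $\mathcal{M}_+(\mathbb{X})$ the finite nonnegative Borel measures, $\Pi(\mu,\nu)$ the set of couplings of $\mu$ and $\nu$, $p_i$ the projection on the $i$-th component, $T_\#$ the pushforward. $\mathrm{KL}(\mu|\nu)=\int\log\frac{d\mu}{d\nu}\,d\mu$ if $\mu\ll\nu$ and $+\infty$ otherwise. For $\varepsilon\in[0,+\infty)$ and $\mu,\nu\in\mathcal{P}(\mathbb{X})$, $$\mathrm{OT}^\varepsilon_c(\mu,\nu)=\inf_{\pi\in\Pi(\mu,\nu)}\int c\,d\pi+\varepsilon\,\mathrm{KL}(\pi|\mu\otimes\nu)$$ (for $\varepsilon=0$ this is $\inf_{\pi\in\Pi(\mu,\nu)}\int c\,d\pi$), and $\mathrm{OT}^\infty_c(\mu,\nu)=\int_{\mathbb{X}\times\mathbb{X}}c(x,y)\,d\mu(x)\,d\nu(y)$. An entropy function is a convex lower semicontinuous $h:[0,+\infty)\to\mathbb{R}\cup\{+\infty\}$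 with $h(1)=0$; $h_\infty=\lim_{r\to+\infty}h(r)/r$; the associated Csiszár divergence is $F(\mu,\nu)=\int h\big(\frac{d\mu}{d\nu}\big)d\nu+h_\infty\int d\mu^\perp$, where $\mu^\perp$ is the singular part of $\mu$ with respect to $\nu$ and $\frac{d\mu}{d\nu}$ is the density of the absolutely continuous part. For $F$ a Csiszár divergence and $\mu,\nu\in\mathcal{M}_+(\mathbb{X})$, the unbalanced version is $$\mathrm{UOT}^\varepsilon_{c,F}(\mu,\nu)=\inf_{\pi\in\mathcal{P}(\mathbb{X}\times\mathbb{X})}\int c\,d\pi+F((p_1)_\#\pi,\mu)+F((p_2)_\#\pi,\nu)+\varepsilon\,\mathrm{KL}(\pi|\mu\otimes\nu).$$ A real symmetric function $k$ on $\mathbb{X}\times\mathbb{X}$ is a positive semidefinite kernel if $\sum_{i,j}a_ia_jk(x_i,x_j)\ge0$ for all finite families of points $x_i\in\mathbb{X}$ and reals $a_i$. A real symmetric function $c$ is negative definite if $\sum_{i,j}a_ia_jc(x_i,x_j)\le0$ for all finite families $x_i\in\mathbb{X}$, $a_i\in\mathbb{R}$ with $\sum_ia_i=0$.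
   Formalization: The cost c is assumed measurable; the representation as inf Ψ(μ,η)+Ψ(ν,η) is claimed only for pairs with OT(μ,μ) and OT(ν,ν) ≠ −∞ (it fails for c(x,y)=x+y and heavy tails); undefined ∞−∞ in the objectives counts as −∞; UOT is treated for finite ε. *)

(* Defs.v *)
From HB Require Import structures.
From mathcomp Require Import all_boot all_order all_algebra.
From mathcomp Require Import all_classical all_reals all_analysis.
From mathcomp Require Import measurable_realfun giry.
Import Order.TTheory GRing.Theory Num.Theory.
Import numFieldNormedType.Exports.

Set Implicit Arguments.
Unset Strict Implicit.
Unset Printing Implicit Defensive.

Local Open Scope classical_set_scope.
Local Open Scope ring_scope.
Local Open Scope ereal_scope.

Definition is_metric (R : realType) (T : Type) (d : T -> T -> R) : Prop :=
  [/\ forall x y, (0 <= d x y)%R,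
      forall x y, d x y = 0%R <-> x = y,
      forall x y, d x y = d y x
    & forall x y z, (d x z <= d x y + d y z)%R].

Definition complete_metric (R : realType) (T : Type) (d : T -> T -> R) : Prop :=
  forall u : nat -> T,
    (forall e : R, (0 < e)%R -> exists N : nat,
       forall m n : nat, (N <= m)%N -> (N <= n)%N -> (d (u m) (u n) < e)%R) ->
    exists l : T, forall e : R, (0 < e)%R -> exists N : nat,
       forall n : nat, (N <= n)%N -> (d (u n) l < e)%R.

Definition polish (R : realType) (X : topologicalType) : Prop :=
  (exists d : X -> X -> R,
    [/\ is_metric d, complete_metric d
      & forall (x : X) (A : set X), nbhs x A <->
          exists2 e : R, (0 < e)%R & [set y | (d x y < e)%R] `<=` A]) /\
  (exists2 D : set X, countable D & dense D).

(* The sigma-algebra on a product is the product sigma-algebra, which for Polish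
   (second countable) factors is the Borel sigma-algebra of the product. *)
Notation borel X := (g_sigma_algebraType (@open X)).

HB.instance Definition _ (d1 d2 : measure_display) (T1 : measurableType d1)
    (T2 : measurableType d2) :=
  isMeasurableFun.Build _ _ (T1 * T2)%type T1 fst measurable_fst.
HB.instance Definition _ (d1 d2 : measure_display) (T1 : measurableType d1)
    (T2 : measurableType d2) :=
  isMeasurableFun.Build _ _ (T1 * T2)%type T2 snd measurable_snd.

Definition marginal1 (d1 d2 : measure_display) (T1 : measurableType d1)
    (T2 : measurableType d2) (R : realType) (pi : probability (T1 * T2)%type R)
    : probability T1 R :=
  distribution pi (fst : {mfun (T1 * T2)%type >-> T1}).

Definition marginal2 (d1 d2 : measure_display) (T1 : measurableType d1)
    (T2 : measurableType d2) (R : realType) (pi : probability (T1 * T2)%type R)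
    : probability T2 R :=
  distribution pi (snd : {mfun (T1 * T2)%type >-> T2}).

(* mu \x nu as a finite measure: the library infers this structure for the
   product of two probability measures, but not of two finite measures. *)
Section finite_product.
Context (d1 d2 : measure_display) (T1 : measurableType d1)
  (T2 : measurableType d2) (R : realType).
Variables (mu : {finite_measure set T1 -> \bar R})
  (nu : {finite_measure set T2 -> \bar R}).

Definition finite_product : set (T1 * T2) -> \bar R := mu \x nu.

HB.instance Definition _ := Measure.on finite_product.

Let finite_product_fin : fin_num_fun finite_product.
Proof.
apply: lty_fin_num_fun.
suff : (mu \x nu) (setT `*` setT) < +oo by rewrite setXTT.
rewrite product_measure1E// lte_mul_pinfty//; first exact: fin_num_measure.
by rewrite -ge0_fin_numE// fin_num_measure.
Qed.

HB.instance Definition _ :=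
  Measure_isFinite.Build _ _ _ finite_product finite_product_fin.
End finite_product.

(* Measures are functions on all sets, with unspecified values on the
   non-measurable ones: equality of measures is [measure_eq], not [=]. *)
Definition coupling (d1 d2 : measure_display) (T1 : measurableType d1)
    (T2 : measurableType d2) (R : realType)
    (mu : probability T1 R) (nu : probability T2 R)
    : set (probability (T1 * T2)%type R) :=
  [set pi | measure_eq (marginal1 pi) mu /\ measure_eq (marginal2 pi) nu].

Definition cost (R : realType) (T : Type) (c : T -> T -> \bar R) : Prop :=
  (forall x y, c x y = c y x) /\ (forall x y, c x y != -oo).

(* The dual addition of \bar R is the one for which oo - oo = +oo. *)
Definition debiased (R : realType) (T : Type) (c : T -> T -> \bar R) (x y : T)
    : \bar R :=
  (c x y - (2^-1)%:E * c x x - (2^-1)%:E * c y y)%dE.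

Definition debiasable_on (R : realType) (T : Type) (D : set (T * T))
    (c : T -> T -> \bar R) : Prop :=
  forall x y, D (x, y) -> 0 <= debiased c x y.

Definition debiasable (R : realType) (T : Type) (c : T -> T -> \bar R) : Prop :=
  debiasable_on setT c.

(* [eqT] is the equality of T: [eq] for points, [measure_eq] for measures. *)
Definition strictly_debiasable (R : realType) (T : Type)
    (eqT : T -> T -> Prop) (c : T -> T -> \bar R) : Prop :=
  forall x y, ~ eqT x y -> 0 < debiased c x y.

Definition inf_representable_on (R : realType) (T : Type) (D : set (T * T))
    (c : T -> T -> \bar R) : Prop :=
  exists (Y : Type) (Psi : T -> Y -> \bar R),
    (forall x eta, Psi x eta != -oo) /\
    (forall x y, D (x, y) ->
       c x y = ereal_inf [set Psi x eta + Psi y eta | eta in setT]).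

Definition KL (d : measure_display) (T : measurableType d) (R : realType)
    (mu nu : {finite_measure set T -> \bar R}) : \bar R :=
  if `[< mu `<< nu >] then
    \int[mu]_x lne (Radon_Nikodym (charge_of_finite_measure mu) nu x)
  else +oo.

(* Only the restriction of h to [0, +oo[ matters. *)
Definition entropy_function (R : realType) (h : R -> \bar R) : Prop :=
  [/\ forall r : R, (0 <= r)%R -> h r != -oo,
      forall r s t : R, (0 <= r)%R -> (0 <= s)%R -> (0 <= t <= 1)%R ->
        h (t * r + (1 - t) * s)%R <= t%:E * h r + (1 - t)%:E * h s,
      lower_semicontinuous (h : subspace `[0%R, +oo[%classic -> \bar R)
    & h 1%R = 0].

Definition recession (R : realType) (h : R -> \bar R) : \bar R :=
  lim ((h r * (r^-1)%:E) @[r --> +oo%R]).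

(* mu = f nu + mu^perp, where mu^perp is the restriction of mu to N *)
Definition lebesgue_decomposition (d : measure_display) (T : measurableType d)
    (R : realType) (mu nu : {finite_measure set T -> \bar R})
    (fN : (T -> R) * set T) : Prop :=
  [/\ measurable_fun setT fN.1, forall x, (0 <= fN.1 x)%R,
      measurable fN.2, nu fN.2 = 0
    & forall A, measurable A ->
        mu A = \int[nu]_(x in A) (fN.1 x)%:E + mu (A `&` fN.2)].

Definition csiszar (d : measure_display) (T : measurableType d)
    (R : realType) (h : R -> \bar R)
    (mu nu : {finite_measure set T -> \bar R}) : \bar R :=
  let fN := get (lebesgue_decomposition mu nu) in
  \int[nu]_x h (fN.1 x) + recession h * mu fN.2.

(* The integral and the sum are those of the library, for which the undefined
   form oo - oo is -oo.  It never arises if c is bounded below and, for c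
   debiasable and pi in Pi(mu, nu), only if the negative part of x |-> c x x is
   not integrable for mu or for nu.  For e = 0, 0 * KL = 0 even if KL = +oo. *)
Definition OT (R : realType) (X : ptopologicalType) (c : X -> X -> \bar R)
    (eps : \bar R) (mu nu : probability (borel X) R) : \bar R :=
  match eps with
  | e%:E => ereal_inf
      [set \int[pi]_z c z.1 z.2 + e%:E * KL pi (finite_product mu nu)
      | pi in coupling mu nu]
  | _ => \int[mu \x nu]_z c z.1 z.2
  end.

(* KL xi mu = +oo for a marginal xi of pi implies
   KL pi (finite_product mu nu) = +oo.  Hence the plans whose marginals violate
   [penalty_finite] have an infinite penalty in the objective of [UOT]; they are
   excluded explicitly because -oo + +oo = -oo in the library, which would let
   them win when the integral of c is -oo. *)
Definition penalty_finite (d : measure_display) (T : measurableType d)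
    (R : realType) (h : R -> \bar R) (e : R)
    (xi mu : {finite_measure set T -> \bar R}) : Prop :=
  csiszar h xi mu + e%:E * KL xi mu < +oo.

Definition UOT (R : realType) (X : ptopologicalType) (c : X -> X -> \bar R)
    (h : R -> \bar R) (e : R)
    (mu nu : {finite_measure set (borel X) -> \bar R}) : \bar R :=
  ereal_inf
    [set \int[pi]_z c z.1 z.2 + csiszar h (marginal1 pi) mu
         + csiszar h (marginal2 pi) nu + e%:E * KL pi (finite_product mu nu)
    | pi in [set pi : probability (borel X * borel X)%type R |
               penalty_finite h e (marginal1 pi) mu /\
               penalty_finite h e (marginal2 pi) nu]].

Definition real_valued (R : realType) (T : Type) (c : T -> T -> \bar R) : Prop :=
  forall x y, c x y \is a fin_num.

Definition psd_kernel (R : realType) (T : Type) (k : T -> T -> R) : Prop :=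
  (forall x y, k x y = k y x) /\
  forall (n : nat) (x : 'I_n -> T) (a : 'I_n -> R),
    (0 <= \sum_(i < n) \sum_(j < n) a i * a j * k (x i) (x j))%R.

Definition negative_definite (R : realType) (T : Type) (c : T -> T -> R) : Prop :=
  (forall x y, c x y = c y x) /\
  forall (n : nat) (x : 'I_n -> T) (a : 'I_n -> R),
    (\sum_(i < n) a i = 0)%R ->
    (\sum_(i < n) \sum_(j < n) a i * a j * c (x i) (x j) <= 0)%R.

Definition euclidean_like (R : realType) (X : ptopologicalType)
    (c : X -> X -> \bar R) (e : R) : Prop :=
  exists (Z : ptopologicalType) (psi : X -> Z -> \bar R)
    (lambda : probability (borel Z) R) (f : X -> \bar R),
    [/\ polish R Z,
        (forall x z, psi x z != -oo) /\
        measurable_fun [set: borel X * borel Z] (fun p => psi p.1 p.2),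
        forall x y, c x y = ereal_inf [set psi x z + psi y z | z in setT],
        forall x, \int[lambda]_z expeR (- ((2 / e)%:E * psi x z)) < +oo
      & (forall x, 0 < f x) /\
        forall x y, expeR (- ((e^-1)%:E * c x y)) =
          (f x * f y)^-1 *
          \int[lambda]_z expeR (- ((e^-1)%:E * (psi x z + psi y z)))].

Definition continuous_negative_definite (R : realType) (X : topologicalType)
    (c : X -> X -> \bar R) : Prop :=
  [/\ real_valued c, continuous (fun z : X * X => fine (c z.1 z.2))
    & negative_definite (fun x y => fine (c x y))].

Definition gibbs_kernel (R : realType) (T : Type) (c : T -> T -> \bar R) (e : R)
    (x y : T) : R := expR (- (fine (c x y) / e)).

Definition bounded_psd_gibbs (R : realType) (X : topologicalType)
    (c : X -> X -> \bar R) (e : R) : Prop :=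
  [/\ real_valued c,
      exists B : R, forall x y, (`|gibbs_kernel c e x y| <= B)%R,
      continuous (fun z : X * X => gibbs_kernel c e z.1 z.2)
    & psd_kernel (gibbs_kernel c e)].

Definition bounded_pairs (R : realType) (X : ptopologicalType)
    (c : X -> X -> \bar R) (e M : R)
    : set (probability (borel X) R * probability (borel X) R) :=
  [set p : probability (borel X) R * probability (borel X) R |
    [/\ \int[p.1 \x p.2]_z expeR ((e^-1)%:E * c z.1 z.2) <= M%:E,
        \int[p.1]_x (Num.sqrt (gibbs_kernel c e x x))%:E < +oo
      & \int[p.2]_x (Num.sqrt (gibbs_kernel c e x x))%:E < +oo]].

(* |c| is integrable for |xi| (x) |xi|, the total variation of xi (x) xi. *)
Definition finite_abs_energy (R : realType) (X : ptopologicalType)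
    (c : X -> X -> \bar R) (xi : {charge set (borel X) -> \bar R}) : Prop :=
  forall (P N : set (borel X)) (xiPN : hahn_decomposition xi P N),
    \int[charge_variation xiPN \x charge_variation xiPN]_z `|c z.1 z.2| < +oo.

Definition finite_energy_pairs (R : realType) (X : ptopologicalType)
    (c : X -> X -> \bar R)
    : set (probability (borel X) R * probability (borel X) R) :=
  [set p : probability (borel X) R * probability (borel X) R |
    let mu := charge_of_finite_measure p.1 in
    let nu := charge_of_finite_measure p.2 in
    [/\ finite_abs_energy c mu, finite_abs_energy c nu
      & finite_abs_energy c (cadd mu (copp nu))]].

(* [sufficient c eps D]: one of the conditions holds for c and eps, and D is the
   set of pairs under consideration. *)
Inductive sufficient (R : realType) (X : ptopologicalType)
    (c : X -> X -> \bar R) :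
    \bar R -> set (probability (borel X) R * probability (borel X) R) -> Prop :=
| sufficient_unregularized : sufficient c 0 setT
| sufficient_euclidean (e : R) :
    (0 < e)%R -> euclidean_like c e -> sufficient c e%:E setT
| sufficient_negative_definite (e : R) :
    (0 < e)%R -> continuous_negative_definite c -> sufficient c e%:E setT
| sufficient_psd (e M : R) :
    (0 < e)%R -> (0 < M)%R -> bounded_psd_gibbs c e ->
    sufficient c e%:E (bounded_pairs c e M)
| sufficient_infinite :
    real_valued c -> negative_definite (fun x y => fine (c x y)) ->
    sufficient c +oo (finite_energy_pairs c).

(* A cost takes its values in R U {+oo}: these are the pairs of measures between
   which C is a cost.  All pairs qualify for C = OT c eps if c is bounded below. *)
Definition cost_pairs (R : realType) (T : Type) (C : T -> T -> \bar R)
    : set (T * T) :=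
  [set p | C p.1 p.1 != -oo /\ C p.2 p.2 != -oo].

(* Main.v *)
(* For c debiasable it is enough to find, for every plan pi with marginals alpha
   and beta, plans pi1 in Pi(alpha, alpha) and pi2 in Pi(beta, beta) whose values
   add up to at most twice that of pi; keeping the marginals, this gives the
   balanced and the unbalanced statements at once.

   For eps = 0 the diagonal plans do it, since c(x,x) + c(y,y) <= 2 c(x,y).
   For 0 < eps, each of (b1), (b2), (b3) makes k = exp(-c/eps) a positive
   semidefinite kernel. Let Q_alpha(u) be the integral of
   u(x) u(y) k(x,y) d alpha d alpha, where here, to lighten notation, the
   reference measures are the marginals. The inequality log t <= t - 1 bounds the
   value of pi from below by
     eps (1 + int phi d alpha + int chi d beta
            - int e^phi(x) e^chi(y) k(x,y) d alpha d beta)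
   for all phi, chi, and Cauchy-Schwarz for k bounds the last integral by
   (Q_alpha(e^phi) + Q_beta(e^chi)) / 2. It remains to minimize
   J_alpha(phi) = Q_alpha(e^phi) / 2 - int phi d alpha: minimizing sequences are
   Cauchy in L1 because log((e^phi + e^chi) / 2) exceeds (phi + chi) / 2 by an
   amount controlling |phi - chi|, Fatou's lemma gives a minimizer, and its
   Euler-Lagrange equation says that e^phi(x) e^phi(y) k(x,y) is the density of a
   plan in Pi(alpha, alpha), of value eps (1 - 2 min J_alpha).

   For eps = +oo the energy of the negative definite c at mu - nu is <= 0.

   If a symmetric C is debiasable, then inf_eta Psi(x, eta) + Psi(y, eta) is C
   when eta ranges over the pairs (u, v) and Psi(., (u, v)) is finite only at u
   and v, with values C(u,v)/2 +- (C(u,u) - C(v,v))/4. *)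
Require Import Defs.
From HB Require Import structures.
From mathcomp Require Import all_boot all_order all_algebra.
From mathcomp Require Import all_classical all_reals all_analysis.
From mathcomp Require Import measurable_realfun giry.
From mathcomp Require Import ring lra.
Import Order.TTheory GRing.Theory Num.Theory.
Import numFieldNormedType.Exports.

Set Implicit Arguments.
Unset Strict Implicit.
Unset Printing Implicit Defensive.

Local Open Scope classical_set_scope.
Local Open Scope ring_scope.
Local Open Scope ereal_scope.

(** In the unbalanced problem the marginals alpha and beta of a plan differ from the reference
    measures mu and nu, so four measures are carried along. If f is the density of alpha with
    respect to mu, the weight 1/f converts energies over alpha and alpha into energies over mu and
    mu. In general nothing bounds c from below or k from above. The diagonal takes over: if the
    negative part of x |-> c x x is integrable, debiasability passes this on to c for every
    coupling, and otherwise a diagonal plan has value -oo. Likewise k is controlled by k(x,x), so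
    cutting a weight u off where u^2 k(x,x) is large leaves bounded functions. For these, positivity
    goes from finite sums to integrals by averaging the sums over independent samples. The minimizer
    of J_alpha is found in L1 without compactness. Since log cosh is quadratic at 0 but only linear
    at infinity, it is bounded below by t (|x| - t) with a free slope t in [0, 1]; tuning t to the
    distance from the infimum gives summable increments. *)

(** * Densities and the Kullback-Leibler divergence *)

(** A relation rather than a chosen derivative, with real nonnegative values everywhere: explicit
    functions, such as products of densities, qualify directly. *)
Definition has_density (d : measure_display) (T : measurableType d)
    (R : realType) (pi m : {finite_measure set T -> \bar R}) (p : T -> R) : Prop :=
  [/\ measurable_fun setT p, forall x, (0 <= p x)%R
    & forall A, measurable A -> pi A = \int[m]_(x in A) (p x)%:E].

Lemma measurable_lne (R : realType) :
  measurable_fun [set: \bar R] (@lne R).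
Proof.
rewrite (_ : @lne R = fun x : \bar R => if x <= 0 then -oo
    else if x == +oo then +oo else (ln (fine x))%:E); last first.
  apply/funext => -[r| |] //=; by rewrite leNye.
apply: measurable_fun_ifT => //.
  apply: (measurable_fun_bool true).
  rewrite (_ : _ @^-1` _ = `]-oo, 0]%classic); first by rewrite setTI; exact: emeasurable_itv.
  by apply/seteqP; split => x /=; rewrite in_itv.
apply: measurable_fun_ifT => //.
  apply: (measurable_fun_bool true).
  rewrite (_ : _ @^-1` _ = [set +oo]) ?setTI//; last by apply/seteqP; split => x /eqP.
apply/measurable_EFinP; apply: measurableT_comp => //; exact: measurable_ln.
Qed.

Section density.
Context (d : measure_display) (T : measurableType d) (R : realType).
Implicit Types pi m : {finite_measure set T -> \bar R}.

Lemma has_density_dominates pi m p : has_density pi m p -> pi `<< m.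
Proof.
move=> [mp p0 pE]; apply/null_content_dominatesP => A mA mA0.
rewrite pE//; apply: null_set_integral => //.
by apply: (measurable_funS measurableT) => //; exact/measurable_EFinP.
Qed.

Lemma density_exists pi m : pi `<< m -> exists p, has_density pi m p.
Proof.
move=> pim; exists (fine \o Radon_Nikodym_SigmaFinite.f pi m); split.
- apply: measurableT_comp => //.
  exact: measurable_int (Radon_Nikodym_SigmaFinite.f_integrable pim).
- by move=> x; rewrite fine_ge0// Radon_Nikodym_SigmaFinite.f_ge0.
- move=> A mA; rewrite (Radon_Nikodym_SigmaFinite.f_integral pim)//.
  apply: eq_integral => x _; rewrite /= fineK//.
  exact: Radon_Nikodym_SigmaFinite.f_fin_num.
Qed.

Lemma density_integrable pi m p : has_density pi m p ->
  m.-integrable setT (EFin \o p).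
Proof.
move=> [mp p0 pE]; apply/integrableP; split; first exact/measurable_EFinP.
rewrite (eq_integral (EFin \o p)); last first.
  by move=> x _ /=; rewrite ger0_norm.
by rewrite -pE// -ge0_fin_numE// fin_num_measure.
Qed.

Lemma density_integral pi m p (f : T -> \bar R) : has_density pi m p ->
  measurable_fun setT f -> (forall x, 0 <= f x) ->
  \int[pi]_x f x = \int[m]_x (f x * (p x)%:E).
Proof.
move=> pd mf f0; have pim := has_density_dominates pd.
rewrite -(Radon_Nikodym_SigmaFinite.change_of_variables pim)//.
have [mp p0 pE] := pd.
have mg := measurable_int _ (Radon_Nikodym_SigmaFinite.f_integrable pim).
apply: ge0_ae_eq_integral => //.
- exact: emeasurable_funM.
- by apply: emeasurable_funM => //; exact/measurable_EFinP.
- by move=> x _; rewrite mule_ge0// Radon_Nikodym_SigmaFinite.f_ge0.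
- by move=> x _; rewrite mule_ge0// lee_fin.
- apply: ae_eqe_mul2l; apply: integral_ae_eq => //.
  + exact: Radon_Nikodym_SigmaFinite.f_integrable.
  + exact/measurable_EFinP.
  + by move=> A _ mA; rewrite -pE// -Radon_Nikodym_SigmaFinite.f_integral.
Qed.

Lemma density_gt0_ae pi m p : has_density pi m p ->
  pi [set x | (p x <= 0)%R] = 0.
Proof.
move=> [mp p0 pE].
have mA : measurable [set x | (p x <= 0)%R].
  have -> : [set x | (p x <= 0)%R] = p @^-1` `]-oo, 0%R].
    by apply/seteqP; split => x /=; rewrite in_itv.
  by rewrite -[X in measurable X]setTI; exact: mp.
rewrite pE// integral0_eq// => x /= px.
by apply/eqP; rewrite eqe eq_le px p0.
Qed.

(** Two densities agree m-almost everywhere, hence pi-almost everywhere. This frees [KL] from the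
    particular derivative in its definition. *)
Lemma KL_density pi m p : has_density pi m p ->
  KL pi m = \int[pi]_x lne (p x)%:E.
Proof.
move=> pd; have pim := has_density_dominates pd.
rewrite /KL; case: asboolP => // _; have [mp p0 pE] := pd.
have mg := measurable_int _ (@Radon_Nikodym_integrable _ _ _
  (charge_of_finite_measure pi) m pim).
apply: ae_eq_integral => //.
- by apply: measurableT_comp => //; exact: measurable_lne.
- apply: measurableT_comp; first exact: measurable_lne.
  exact/measurable_EFinP.
have [N [mN N0 sN]] : ae_eq m setT
    (Radon_Nikodym (charge_of_finite_measure pi) m) (EFin \o p).
  apply: integral_ae_eq => //.
  - exact: Radon_Nikodym_integrable.
  - exact/measurable_EFinP.
  - by move=> A _ mA; rewrite -pE// -Radon_Nikodym_integral.
exists N; split => //.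
  by move/null_content_dominatesP : pim => /(_ _ mN); exact.
by move=> x /= h; apply: sN => /= h'; apply: h => _; rewrite h'.
Qed.

End density.

Local Close Scope ereal_scope.

(** * Bounded measurable functions and Fubini's theorem *)

(** Such functions are integrable for every probability measure and are stable under sections and
    partial integrals, so Fubini computations with them raise no integrability condition. *)
Definition bounded_measurable (d : measure_display) (T : measurableType d)
    (R : realType) (f : T -> R) : Prop :=
  measurable_fun setT f /\ exists B : R, forall x, `|f x| <= B.

Section bounded_measurable_closure.
Context (d : measure_display) (T : measurableType d) (R : realType).
Implicit Types f g : T -> R.

Lemma bounded_measurable_cst (r : R) : bounded_measurable (fun _ : T => r).
Proof. by split => //; exists `|r|. Qed.

Lemma bounded_measurableD f g : bounded_measurable f -> bounded_measurable g ->
  bounded_measurable (fun x => f x + g x).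
Proof.
move=> [mf [B fB]] [mg [C gC]]; split; first exact: measurable_funD.
by exists (B + C) => x; rewrite (le_trans (ler_normD _ _))// lerD.
Qed.

Lemma bounded_measurableM f g : bounded_measurable f -> bounded_measurable g ->
  bounded_measurable (fun x => f x * g x).
Proof.
move=> [mf [B fB]] [mg [C gC]]; split; first exact: measurable_funM.
by exists (B * C) => x; rewrite normrM ler_pM.
Qed.

Lemma bounded_measurableZ (r : R) f : bounded_measurable f ->
  bounded_measurable (fun x => r * f x).
Proof. exact/bounded_measurableM/bounded_measurable_cst. Qed.

Lemma bounded_measurable_sum (I : Type) (s : seq I) (F : I -> T -> R) :
  (forall i, bounded_measurable (F i)) ->
  bounded_measurable (fun x => \sum_(i <- s) F i x).
Proof.
move=> bF; elim: s => [|i s IH].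
  rewrite (_ : (fun _ => _) = fun=> 0); first exact: bounded_measurable_cst.
  by apply/funext => x; rewrite big_nil.
rewrite (_ : (fun _ => _) = fun x => F i x + \sum_(j <- s) F j x).
  exact: bounded_measurableD.
by apply/funext => x; rewrite big_cons.
Qed.

Lemma bounded_measurable_comp (d' : measure_display) (T' : measurableType d')
    (h : T' -> T) f : measurable_fun setT h -> bounded_measurable f ->
  bounded_measurable (f \o h).
Proof.
move=> mh [mf [B fB]]; split; first exact: measurableT_comp.
by exists B => x /=.
Qed.

End bounded_measurable_closure.

Section expectation.
Context (d : measure_display) (T : measurableType d) (R : realType).
Variable P : probability T R.
Implicit Types f g : T -> R.

Lemma bounded_measurable_integrable f : bounded_measurable f ->
  P.-integrable setT (EFin \o f).
Proof.
move=> [mf [B fB]]; apply: measurable_bounded_integrable => //.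
  by rewrite -ge0_fin_numE// fin_num_measure.
exists B; split; first exact: num_real.
by move=> M BM x _ /=; rewrite (le_trans (fB x)) ?ltW.
Qed.

Lemma expectationD f g : bounded_measurable f -> bounded_measurable g ->
  \int[P]_x (f x + g x) = \int[P]_x f x + \int[P]_x g x.
Proof.
by move=> bf bg; rewrite RintegralD//; exact: bounded_measurable_integrable.
Qed.

Lemma expectationZ (r : R) f : bounded_measurable f ->
  \int[P]_x (r * f x) = r * \int[P]_x f x.
Proof.
by move=> bf; rewrite RintegralZl//; exact: bounded_measurable_integrable.
Qed.

Lemma expectation_cst (r : R) : \int[P]_x r = r.
Proof. by rewrite Rintegral_cst//= probability_setT/= mulr1. Qed.

Lemma expectation_sum (I : Type) (s : seq I) (F : I -> T -> R) :
  (forall i, bounded_measurable (F i)) ->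
  \int[P]_x (\sum_(i <- s) F i x) = \sum_(i <- s) \int[P]_x F i x.
Proof.
move=> bF; elim: s => [|i s IH].
  by under eq_Rintegral do rewrite big_nil; rewrite expectation_cst big_nil.
under eq_Rintegral do rewrite big_cons.
by rewrite expectationD ?IH ?big_cons//; exact: bounded_measurable_sum.
Qed.

End expectation.

Section bounded_fubini.
Context (d1 d2 : measure_display) (T1 : measurableType d1)
  (T2 : measurableType d2) (R : realType).
Variables (P1 : probability T1 R) (P2 : probability T2 R) (f : T1 * T2 -> R).
Hypothesis bf : bounded_measurable f.

Let intf : (P1 \x P2)%E.-integrable setT (EFin \o f).
Proof. exact: bounded_measurable_integrable. Qed.

Lemma bounded_measurable_xsection x : bounded_measurable (fun y => f (x, y)).
Proof. by apply: (bounded_measurable_comp _ bf); exact: pair1_measurable. Qed.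

Lemma bounded_measurable_ysection y : bounded_measurable (fun x => f (x, y)).
Proof. by apply: (bounded_measurable_comp _ bf); exact: pair2_measurable. Qed.

Lemma bounded_measurable_fubini : bounded_measurable (fun x => \int[P2]_y f (x, y)).
Proof.
split.
  apply: (@measurableT_comp _ _ _ _ _ _ (@fine R)) => //.
  exact: (measurable_fubini_F intf).
have [_ [B fB]] := bf; exists B => x.
have bx := bounded_measurable_xsection x.
have ix := bounded_measurable_integrable P2 bx.
rewrite (le_trans (le_normr_Rintegral _ ix))//.
rewrite -[leRHS](expectation_cst P2); apply: le_Rintegral => //.
- exact: integrable_norm.
- exact/bounded_measurable_integrable/bounded_measurable_cst.
Qed.

Lemma bounded_fubini1 :
  Rintegral (P1 \x P2)%E setT f = \int[P1]_x \int[P2]_y f (x, y).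
Proof.
rewrite /Rintegral -(integral12_prod_meas1 intf); congr fine.
apply: eq_integral => x _; rewrite /fubini_F fineK//.
apply: integrable_fin_num => //.
exact/bounded_measurable_integrable/bounded_measurable_xsection.
Qed.

Lemma bounded_fubini2 :
  Rintegral (P1 \x P2)%E setT f = \int[P2]_y \int[P1]_x f (x, y).
Proof.
rewrite /Rintegral -(integral21_prod_meas1 intf); congr fine.
apply: eq_integral => y _; rewrite /fubini_G fineK//.
apply: integrable_fin_num => //.
exact/bounded_measurable_integrable/bounded_measurable_ysection.
Qed.

End bounded_fubini.

(** * Positive semidefinite kernels and integration *)

Section sampling.
Context (d : measure_display) (Z : measurableType d) (R : realType).
Variables (P : probability Z R) (K : Z -> Z -> R).
Hypothesis bK : bounded_measurable (fun z : Z * Z => K z.1 z.2).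
Hypothesis symK : forall x y, K x y = K y x.
Hypothesis psdK : forall s : seq Z, 0 <= \sum_(x <- s) \sum_(y <- s) K x y.

Let U x := \int[P]_y K x y.
Let I := \int[P]_x U x.
Let D := \int[P]_x K x x.

Let bx x : bounded_measurable (K x).
Proof. exact: (bounded_measurable_xsection bK). Qed.

Let bU : bounded_measurable U.
Proof. exact: (bounded_measurable_fubini P P bK). Qed.

Let bD : bounded_measurable (fun x => K x x).
Proof.
apply: (bounded_measurable_comp (h := fun x => (x, x)) _ bK).
exact: measurable_fun_pair.
Qed.

(* The expectation of the sum of K over s extended by k independent samples. *)
Lemma sampling (k : nat) (s : seq Z) :
  0 <= \sum_(x <- s) \sum_(y <- s) K x y + (2 * k%:R) * \sum_(x <- s) U x
       + (k%:R * (k%:R - 1) * I + k%:R * D).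
Proof.
elim: k s => [s|k IH s].
  by rewrite mulr0 !mul0r !addr0.
pose A := \sum_(x <- s) \sum_(y <- s) K x y.
pose V := \sum_(x <- s) U x.
pose C := k%:R * (k%:R - 1) * I + k%:R * D.
(* The induction hypothesis for [x :: s], averaged over the new sample x. *)
have : 0 <= \int[P]_x (A + (2 * k%:R) * V + C +
    (K x x + (2 * \sum_(y <- s) K y x + (2 * k%:R) * U x))).
  apply: Rintegral_ge0 => x _; have := IH (x :: s).
  rewrite !big_cons; under [X in _ + X + _ + _]eq_bigr do rewrite big_cons.
  rewrite big_split/= -/A -/V -/C.
  rewrite (eq_bigr (fun y => K y x)) => [|y _]; last exact: symK.
  move=> /le_trans; apply; rewrite le_eqVlt; apply/orP; left; apply/eqP.
  by ring.
have bS : bounded_measurable (fun x => \sum_(y <- s) K y x).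
  exact: bounded_measurable_sum.
rewrite expectationD; last 2 first.
- exact: bounded_measurable_cst.
- apply: bounded_measurableD => //; apply: bounded_measurableD.
    exact: bounded_measurableZ.
  exact: bounded_measurableZ.
rewrite expectation_cst expectationD//; last first.
  by apply: bounded_measurableD; exact: bounded_measurableZ.
rewrite expectationD; [|exact: bounded_measurableZ..].
rewrite !expectationZ// expectation_sum// -/D -/I -/V -/A.
move=> /le_trans; apply; rewrite le_eqVlt; apply/orP; left; apply/eqP.
by rewrite /C -natr1; ring.
Qed.

(* If I < 0, the sampling inequality fails for a large number of samples, its
   left-hand side being quadratic in it with leading coefficient I. *)
Lemma psd_integral_ge0 : 0 <= \int[P]_x \int[P]_y K x y.
Proof.
rewrite -/I leNgt; apply/negP => I0.
have [n nI] : exists n : nat, `|D| < n%:R * - I.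
  exists (Num.truncn (`|D| / - I)).+1.
  by rewrite -ltr_pdivrMr ?oppr_gt0// truncnS_gt.
have := sampling n.+1 [::]; rewrite !big_nil mulr0 addr0 add0r -mulrA -mulrDr.
rewrite pmulr_rge0// -natr1 addrK; apply/negP; rewrite -ltNge.
by rewrite -(opprK (_ * I)) -mulrN addrC subr_lt0 (le_lt_trans (ler_norm _)).
Qed.

End sampling.

Section psd_kernel_theory.
Context (R : realType) (T : Type) (k : T -> T -> R).
Hypothesis psdk : psd_kernel k.

Lemma psd_kernel_seq (s : seq (R * T)) :
  0 <= \sum_(p <- s) \sum_(q <- s) p.1 * q.1 * k p.2 q.2.
Proof.
have := psdk.2 (size s) (fun i => (tnth (in_tuple s) i).2)
  (fun i => (tnth (in_tuple s) i).1).
congr (0 <= _); rewrite [RHS]big_tnth.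
by apply: eq_bigr => i _; rewrite [RHS]big_tnth.
Qed.

Lemma psd_kernel_diag_ge0 x : 0 <= k x x.
Proof. by have := psd_kernel_seq [:: (1, x)]; rewrite !big_seq1 !mul1r. Qed.

Lemma psd_kernel_le x y (a b : R) :
  2 * (a * b * k x y) <= a ^+ 2 * k x x + b ^+ 2 * k y y.
Proof.
have := psd_kernel_seq [:: (a, x); (- b, y)].
by rewrite !big_cons !big_nil/= (psdk.1 y x); lra.
Qed.

(** Pointwise Cauchy-Schwarz in additive form: a bound on the weighted diagonal bounds the weighted
    kernel everywhere. All truncations rely on it. *)
Lemma psd_kernel_abs_le x y (a b B : R) :
  a ^+ 2 * k x x <= B -> b ^+ 2 * k y y <= B -> `|a * b * k x y| <= B.
Proof.
move=> aB bB; have h1 := psd_kernel_le x y a b.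
have := psd_kernel_le x y a (- b); rewrite sqrrN => h2.
by rewrite ler_norml; apply/andP; split; lra.
Qed.

End psd_kernel_theory.

Section psd_two_measures.
Context (d : measure_display) (T : measurableType d) (R : realType).
Variables (k : T -> T -> R) (mu nu : probability T R).
Hypothesis psdk : psd_kernel k.
Hypothesis mk : measurable_fun [set: T * T] (fun z => k z.1 z.2).

Let weighted (u v : T -> R) (z : T * T) := u z.1 * v z.2 * k z.1 z.2.

Lemma measurable_weighted_kernel (u v : T -> R) :
  measurable_fun setT u -> measurable_fun setT v ->
  measurable_fun [set: T * T] (fun z => u z.1 * v z.2 * k z.1 z.2).
Proof.
move=> mu' mv; apply: measurable_funM => //; apply: measurable_funM.
  by apply: measurableT_comp => //; exact: measurable_fst.
by apply: measurableT_comp => //; exact: measurable_snd.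
Qed.

Lemma bounded_measurable_weighted_kernel (B : R) (u v : T -> R) :
  measurable_fun setT u -> measurable_fun setT v ->
  (forall x, u x ^+ 2 * k x x <= B) -> (forall x, v x ^+ 2 * k x x <= B) ->
  bounded_measurable (fun z : T * T => u z.1 * v z.2 * k z.1 z.2).
Proof.
move=> mu' mv uB vB; split; first exact: measurable_weighted_kernel.
by exists B => z; exact: psd_kernel_abs_le.
Qed.

(** Reduces to one measure, mu \x nu on T * T: a sample z stands for the combination of the point
    z.1 with weight u and the point z.2 with weight v, and K z z' is the pairing of two such
    combinations by k. The form in v may be signed, so -v turns this into Cauchy-Schwarz. *)
Lemma psd_integral_bounded (B : R) (u v : T -> R) :
  measurable_fun setT u -> measurable_fun setT v ->
  (forall x, u x ^+ 2 * k x x <= B) -> (forall x, v x ^+ 2 * k x x <= B) ->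
  0 <= Rintegral (mu \x mu)%E setT (fun z => u z.1 * u z.2 * k z.1 z.2) +
    2 * Rintegral (mu \x nu)%E setT (fun z => u z.1 * v z.2 * k z.1 z.2) +
    Rintegral (nu \x nu)%E setT (fun z => v z.1 * v z.2 * k z.1 z.2).
Proof.
move=> mu' mv uB vB.
have bw u1 u2 : (u1 = u \/ u1 = v) -> (u2 = u \/ u2 = v) ->
    bounded_measurable (weighted u1 u2).
  by move=> [->|->] [->|->]; exact: (@bounded_measurable_weighted_kernel B).
have buu := bw u u (or_introl erefl) (or_introl erefl).
have buv := bw u v (or_introl erefl) (or_intror erefl).
have bvu := bw v u (or_intror erefl) (or_introl erefl).
have bvv := bw v v (or_intror erefl) (or_intror erefl).
pose K (z z' : T * T) := (weighted u u (z.1, z'.1) + weighted u v (z.1, z'.2))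
  + (weighted v u (z.2, z'.1) + weighted v v (z.2, z'.2)).
have m11 : measurable_fun setT (fun w : (T * T) * (T * T) => (w.1.1, w.2.1)).
  by apply: measurable_fun_pair; apply: measurableT_comp.
have m12 : measurable_fun setT (fun w : (T * T) * (T * T) => (w.1.1, w.2.2)).
  by apply: measurable_fun_pair; apply: measurableT_comp.
have m21 : measurable_fun setT (fun w : (T * T) * (T * T) => (w.1.2, w.2.1)).
  by apply: measurable_fun_pair; apply: measurableT_comp.
have m22 : measurable_fun setT (fun w : (T * T) * (T * T) => (w.1.2, w.2.2)).
  by apply: measurable_fun_pair; apply: measurableT_comp.
have bK : bounded_measurable (fun w : (T * T) * (T * T) => K w.1 w.2).
  by apply: bounded_measurableD; apply: bounded_measurableD;
    [exact: (bounded_measurable_comp m11 buu)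
    |exact: (bounded_measurable_comp m12 buv)
    |exact: (bounded_measurable_comp m21 bvu)
    |exact: (bounded_measurable_comp m22 bvv)].
have symK z z' : K z z' = K z' z.
  rewrite /K /weighted/= (psdk.1 z'.1 z.1) (psdk.1 z'.1 z.2) (psdk.1 z'.2 z.1).
  by rewrite (psdk.1 z'.2 z.2); ring.
have psdK s : 0 <= \sum_(z <- s) \sum_(z' <- s) K z z'.
  have := psd_kernel_seq psdk ([seq (u z.1, z.1) | z <- s] ++
                               [seq (v z.2, z.2) | z <- s]).
  congr (0 <= _); rewrite big_cat !big_map/= -big_split/=; apply: eq_bigr => z _.
  by rewrite !big_cat !big_map/= -!big_split.
have fstE (f : T -> R) : bounded_measurable f ->
    \int[(mu \x nu)%E]_z f z.1 = \int[mu]_x f x.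
  move=> bf; rewrite bounded_fubini1//=.
    by apply: eq_Rintegral => x _; rewrite expectation_cst.
  by apply: (bounded_measurable_comp _ bf); exact: measurable_fst.
have sndE (f : T -> R) : bounded_measurable f ->
    \int[(mu \x nu)%E]_z f z.2 = \int[nu]_x f x.
  move=> bf; rewrite bounded_fubini2//=.
    by apply: eq_Rintegral => x _; rewrite expectation_cst.
  by apply: (bounded_measurable_comp _ bf); exact: measurable_snd.
have bfst (f : T -> R) : bounded_measurable f ->
    bounded_measurable (fun z : T * T => f z.1).
  by apply: bounded_measurable_comp; exact: measurable_fst.
have bsnd (f : T -> R) : bounded_measurable f ->
    bounded_measurable (fun z : T * T => f z.2).
  by apply: bounded_measurable_comp; exact: measurable_snd.
have xs (w : T * T -> R) (x : T) : bounded_measurable w -> bounded_measurable (fun y => w (x, y)).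
  by move=> bw'; exact: bounded_measurable_xsection bw' x.
have := psd_integral_ge0 (mu \x nu)%E bK symK psdK.
have UE z : \int[(mu \x nu)%E]_z' K z z' =
    (\int[mu]_x weighted u u (z.1, x) + \int[nu]_y weighted u v (z.1, y)) +
    (\int[mu]_x weighted v u (z.2, x) + \int[nu]_y weighted v v (z.2, y)).
  rewrite expectationD; [|apply: bounded_measurableD|apply: bounded_measurableD];
    [|exact/(bfst (fun x => weighted u u (z.1, x)))/xs
     |exact/(bsnd (fun x => weighted u v (z.1, x)))/xs
     |exact/(bfst (fun x => weighted v u (z.2, x)))/xs
     |exact/(bsnd (fun x => weighted v v (z.2, x)))/xs].
  rewrite !expectationD;
    [|exact/(bfst (fun x => weighted v u (z.2, x)))/xs
     |exact/(bsnd (fun x => weighted v v (z.2, x)))/xs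
     |exact/(bfst (fun x => weighted u u (z.1, x)))/xs
     |exact/(bsnd (fun x => weighted u v (z.1, x)))/xs].
  congr (_ + _ + (_ + _)).
  - by rewrite (fstE (fun x => weighted u u (z.1, x)))//; exact: xs.
  - by rewrite (sndE (fun x => weighted u v (z.1, x)))//; exact: xs.
  - by rewrite (fstE (fun x => weighted v u (z.2, x)))//; exact: xs.
  - by rewrite (sndE (fun x => weighted v v (z.2, x)))//; exact: xs.
under eq_Rintegral do rewrite UE.
have b1 := bounded_measurable_fubini mu mu buu.
have b2 := bounded_measurable_fubini mu nu buv.
have b3 := bounded_measurable_fubini nu mu bvu.
have b4 := bounded_measurable_fubini nu nu bvv.
rewrite expectationD; [|apply: bounded_measurableD|apply: bounded_measurableD];
    [|exact: bfst b1|exact: bfst b2|exact: bsnd b3|exact: bsnd b4].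
rewrite !expectationD; [|exact: bsnd b3|exact: bsnd b4|exact: bfst b1|exact: bfst b2].
rewrite (fstE _ b1) (fstE _ b2) (sndE _ b3) (sndE _ b4).
rewrite -(bounded_fubini1 mu mu buu) -(bounded_fubini1 mu nu buv).
rewrite -(bounded_fubini1 nu nu bvv).
have -> : \int[nu]_x \int[mu]_y weighted v u (x, y) =
    Rintegral (mu \x nu)%E setT (weighted u v).
  rewrite bounded_fubini2//; apply: eq_Rintegral => x _; apply: eq_Rintegral => y _.
  by rewrite /weighted/= psdk.1; ring.
by rewrite mulr2n mulrDl !mul1r !addrA.
Qed.

End psd_two_measures.

Local Open Scope ereal_scope.

Section psd_energy.
Context (d : measure_display) (T : measurableType d) (R : realType).
Variables (k : T -> T -> R).
Hypothesis psdk : psd_kernel k.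
Hypothesis mk : measurable_fun [set: T * T] (fun z => k z.1 z.2).
Hypothesis k0 : forall x y, (0 <= k x y)%R.

(** The bilinear form behind the quadratic form Q_alpha, for two measures; it is extended-valued
    because the weighted kernel may fail to be integrable. *)
Definition cross_energy (mu nu : probability T R) (u v : T -> R) : \bar R :=
  \int[mu \x nu]_z (u z.1 * v z.2 * k z.1 z.2)%:E.

(** Setting u to 0 where u^2 k(x,x) exceeds n bounds the weighted kernel by n, off the diagonal too.
    The truncations increase to u when u is nonnegative. *)
Let trunc (n : nat) (u : T -> R) (x : T) : R :=
  if (u x ^+ 2 * k x x <= n%:R)%R then u x else 0%R.

Let mdiag : measurable_fun setT (fun x => k x x).
Proof.
have mp : measurable_fun setT (fun x : T => (x, x)) by exact: measurable_fun_pair.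
exact: (measurableT_comp mk mp).
Qed.

Let mtrunc n (u : T -> R) : measurable_fun setT u -> measurable_fun setT (trunc n u).
Proof.
move=> mu; apply: measurable_fun_ifT => //.
by apply: measurable_fun_ler => //; apply: measurable_funM => //; exact: measurable_funX.
Qed.

Let trunc_ge0 n (u : T -> R) : (forall x, 0 <= u x)%R -> forall x, (0 <= trunc n u x)%R.
Proof. by move=> u0 x; rewrite /trunc; case: ifP. Qed.

Let trunc_le n (u : T -> R) : (forall x, 0 <= u x)%R -> forall x, (trunc n u x <= u x)%R.
Proof. by move=> u0 x; rewrite /trunc; case: ifP. Qed.

Let trunc_nd m n (u : T -> R) : (forall x, 0 <= u x)%R -> (m <= n)%N ->
  forall x, (trunc m u x <= trunc n u x)%R.
Proof.
move=> u0 mn x; rewrite /trunc; case: ifPn => [h|_]; last by case: ifP.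
by rewrite ifT// (le_trans h)// ler_nat.
Qed.

Let trunc_bnd n u x : (trunc n u x ^+ 2 * k x x <= n%:R)%R.
Proof. by rewrite /trunc; case: ifPn => // _; rewrite expr0n mul0r. Qed.

Let trunc_cvg u x : \forall n \near \oo, trunc n u x = u x.
Proof.
near=> n; rewrite /trunc ifT//.
near: n; exact: nbhs_infty_ger.
Unshelve. all: by end_near. Qed.

Let trunc_energy (mu nu : probability T R) n (u v : T -> R) :
  measurable_fun setT u -> measurable_fun setT v ->
  cross_energy mu nu (trunc n u) (trunc n v) =
  (Rintegral (mu \x nu) setT
    (fun z => trunc n u z.1 * trunc n v z.2 * k z.1 z.2)%R)%:E.
Proof.
move=> mu' mv; rewrite /Rintegral fineK//.
apply: integrable_fin_num => //; apply: bounded_measurable_integrable.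
by apply: (@bounded_measurable_weighted_kernel _ _ _ _ _ _ n%:R) => //; exact: mtrunc.
Qed.

Lemma cross_energy_ge0 (mu nu : probability T R) (u v : T -> R) :
  (forall x, 0 <= u x)%R -> (forall x, 0 <= v x)%R -> 0 <= cross_energy mu nu u v.
Proof. by move=> u0 v0; apply: integral_ge0 => z _; rewrite lee_fin !mulr_ge0. Qed.

Lemma le_cross_energy (mu nu : probability T R) (u u' v v' : T -> R) :
  measurable_fun setT u -> measurable_fun setT v ->
  measurable_fun setT u' -> measurable_fun setT v' ->
  (forall x, 0 <= u x <= u' x)%R -> (forall x, 0 <= v x <= v' x)%R ->
  cross_energy mu nu u v <= cross_energy mu nu u' v'.
Proof.
move=> m1 m2 m3 m4 uu' vv'; apply: ge0_le_integral => //.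
- move=> z _; have /andP[? _] := uu' z.1; have /andP[? _] := vv' z.2.
  by rewrite lee_fin !mulr_ge0.
- by apply/measurable_EFinP; exact: measurable_weighted_kernel.
- by apply/measurable_EFinP; exact: measurable_weighted_kernel.
- move=> z _; have /andP[? ?] := uu' z.1; have /andP[? ?] := vv' z.2.
  by rewrite lee_fin ler_wpM2r// ler_pM.
Qed.

(** Cauchy-Schwarz holds for the truncations, by the bounded case applied to u and -v. On the right,
    nonnegativity bounds their energies by the full ones; on the left, monotone convergence gives
    the limit. *)
Lemma psd_energy_le (mu nu : probability T R) (u v : T -> R) :
  measurable_fun setT u -> measurable_fun setT v ->
  (forall x, 0 <= u x)%R -> (forall x, 0 <= v x)%R ->
  2%:E * cross_energy mu nu u v <= cross_energy mu mu u u + cross_energy nu nu v v.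
Proof.
move=> mu' mv u0 v0.
have h n : 2%:E * cross_energy mu nu (trunc n u) (trunc n v) <=
    cross_energy mu mu u u + cross_energy nu nu v v.
  apply: (@le_trans _ _ (cross_energy mu mu (trunc n u) (trunc n u) +
                         cross_energy nu nu (trunc n v) (trunc n v))).
    rewrite !trunc_energy// -EFinM -EFinD lee_fin.
    have mn : measurable_fun setT (fun x => - trunc n v x)%R.
      by apply: measurableT_comp => //; exact: mtrunc.
    have bn x : ((- trunc n v x) ^+ 2 * k x x <= n%:R)%R by rewrite sqrrN.
    have := psd_integral_bounded mu nu psdk mk (mtrunc n mu') mn (@trunc_bnd n u) bn.
    under [X in (_ + _ + X)%R]eq_Rintegral do rewrite mulrNN.
    have -> : Rintegral (mu \x nu) setT
        (fun z => trunc n u z.1 * - trunc n v z.2 * k z.1 z.2)%R =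
      (- Rintegral (mu \x nu) setT
        (fun z => trunc n u z.1 * trunc n v z.2 * k z.1 z.2))%R.
      under eq_Rintegral do rewrite mulrN mulNr -mulN1r.
      rewrite expectationZ ?mulN1r//.
      by apply: (@bounded_measurable_weighted_kernel _ _ _ _ _ _ n%:R) => //;
        exact: mtrunc.
    lra.
  apply: leeD; apply: le_cross_energy => //; try exact: mtrunc; move=> x.
  - by rewrite trunc_ge0// trunc_le.
  - by rewrite trunc_ge0// trunc_le.
  - by rewrite trunc_ge0// trunc_le.
  - by rewrite trunc_ge0// trunc_le.
have cvg : cross_energy mu nu (trunc n u) (trunc n v) @[n --> \oo] -->
    cross_energy mu nu u v.
  rewrite (_ : cross_energy mu nu u v = \int[mu \x nu]_z
     (limn (fun n => (trunc n u z.1 * trunc n v z.2 * k z.1 z.2)%:E))); last first.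
    apply: eq_integral => z _; apply/esym/cvg_lim => //.
    apply: cvg_near_cst; near=> n; rewrite (near (trunc_cvg u z.1) n)//.
    by rewrite (near (trunc_cvg v z.2) n).
  apply: cvg_monotone_convergence => //.
  - by move=> n; apply/measurable_EFinP; apply: measurable_weighted_kernel => //;
      exact: mtrunc.
  - by move=> n z _; rewrite lee_fin !mulr_ge0// trunc_ge0.
  - move=> z _ m n mn; rewrite lee_fin ler_wpM2r// ler_pM ?trunc_ge0//; exact: trunc_nd.
have c2 : 2%:E * cross_energy mu nu (trunc n u) (trunc n v) @[n --> \oo] -->
    2%:E * cross_energy mu nu u v by exact: cvgeZl.
rewrite -(cvg_lim _ c2)//; apply: lime_le; first by apply/cvg_ex; eexists; exact: c2.
exact: nearW.
Unshelve. all: by end_near. Qed.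

End psd_energy.

Local Close Scope ereal_scope.

(** * Minimization of the dual functional *)

Section scalar_inequalities.
Context {R : realType}.
Implicit Types a b t x : R.

(** A lower bound of log cosh by a line of slope t, at the price t^2. The slope stays free so that
    it can be matched later with the distance to the infimum. *)
Lemma expR_le_cosh t x : 0 <= t <= 1 ->
  expR (t * (`|x| - t)) <= (expR x + expR (- x)) / 2.
Proof.
move=> /andP[t0 t1].
wlog x0 : x / 0 <= x => [h|].
  have [/h//|/ltW x0] := leP 0 x.
  by have := h (- x); rewrite oppr_ge0 normrN opprK (addrC (expR (- x))); apply.
(* With this m the two tangent bounds below add up to exactly 2. *)
rewrite ger0_norm//; set m := t * (x - t).
(* Tangent lines at the points where the two exponentials balance with weights
   (1 + t) / 2 and (1 - t) / 2. *)
have tangent (s y : R) : 0 <= 1 + s -> (1 + s) * (1 + (y - s)) <= expR y.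
  move=> s0; have [h|h] := leP 0 (1 + (y - s)).
    have -> : expR y = expR s * expR (y - s) by rewrite -expRD subrKC.
    by rewrite ler_pM// expR_ge1Dx.
  by rewrite (le_trans _ (expR_ge0 _))// mulr_ge0_le0// ltW.
have h1 : (1 + t) * (1 + (x - m - t)) <= expR (x - m) by apply: tangent; lra.
have h2 : (1 - t) * (1 + (- x - m + t)) <= expR (- x - m).
  by have := @tangent (- t) (- x - m); rewrite opprK; apply; lra.
have h : 1 <= (expR (x - m) + expR (- x - m)) / 2.
  rewrite ler_pdivlMr//; apply: le_trans (lerD h1 h2); rewrite /m; nra.
rewrite !expRD -mulrDl in h.
have em : 0 < expR m by exact: expR_gt0.
by move: h; rewrite (expRN m) mulrAC ler_pdivlMr// mul1r.
Qed.

(** Factoring out the exponential of (a + b) / 2 leaves cosh at (a - b) / 2. The gain is linear in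
    |a - b|, which is why it controls an L1 distance. *)
Lemma midpoint_ln_ge t a b : 0 <= t <= 1 ->
  (a + b) / 2 + t * (`|a - b| / 2 - t) <= ln ((expR a + expR b) / 2).
Proof.
move=> t01; rewrite -ler_expR lnK; last by rewrite posrE divr_gt0// addr_gt0// expR_gt0.
have := expR_le_cosh ((a - b) / 2) t01.
rewrite normrM (@ger0_norm _ (2^-1))// => h.
rewrite expRD (le_trans (ler_wpM2l (expR_ge0 _) h))//.
rewrite mulrA mulrDr -!expRD.
have -> : (a + b) / 2 + (a - b) / 2 = a by lra.
by have -> : (a + b) / 2 + - ((a - b) / 2) = b by lra.
Qed.

Lemma midpoint_ln_abs_le a b : `|ln ((expR a + expR b) / 2)| <= `|a| + `|b|.
Proof.
have s0 : 0 < (expR a + expR b) / 2 by rewrite divr_gt0// addr_gt0// expR_gt0.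
have na := normr_ge0 a; have nb := normr_ge0 b.
have [la lb] := (ler_norm a, ler_norm b).
have [la' lb'] := (lerNnormlW (lexx `|a|), lerNnormlW (lexx `|b|)).
rewrite ler_norml; apply/andP; split; rewrite -ler_expR lnK ?posrE//.
- have : expR (- (`|a| + `|b|)) <= expR a by rewrite ler_expR; lra.
  have : expR (- (`|a| + `|b|)) <= expR b by rewrite ler_expR; lra.
  lra.
- have : expR a <= expR (`|a| + `|b|) by rewrite ler_expR; lra.
  have : expR b <= expR (`|a| + `|b|) by rewrite ler_expR; lra.
  lra.
Qed.

(** The first-order condition at s = 1. Bounding - ln s by 1/s - 1 turns the hypothesis into the
    sign of a product with the factor s - 1, which is tested at explicit points on either side of
    1. *)
Lemma quadratic_ln_critical (p q a : R) : 0 <= q -> 0 <= a ->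
  (forall s : R, 0 < s -> p + q / 2 <= p * s + q * s ^+ 2 / 2 - a * ln s) ->
  p + q = a.
Proof.
move=> q0 a0 h.
have h' (s : R) : 0 < s -> 0 <= (s - 1) * (p + q * (s + 1) / 2 - a / s).
  move=> s0; have := h s s0.
  have : - ln s <= s^-1 - 1.
    rewrite -lnV ?posrE//; have := @le_ln1Dx R (s^-1 - 1).
    by rewrite subrKC; apply; rewrite ltrBrDl subrr invr_gt0.
  move=> /(ler_wpM2l a0) h1 h2.
  have -> : (s - 1) * (p + q * (s + 1) / 2 - a / s) =
     p * s + q * s ^+ 2 / 2 + a * (s^-1 - 1) - (p + q / 2).
    by field; rewrite gt_eqF.
  lra.
apply/eqP; rewrite eq_le; apply/andP; split; rewrite leNgt; apply/negP => ha.
(* The bound e <= 1/2 gives a / (1 - e) <= a + 2 a e; the second bound makes the total error q e / 2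
   + 2 a e smaller than p + q - a. *)
- pose e := Num.min (2^-1) ((p + q - a) / (q + 2 * a + 1)).
  have C0 : 0 < q + 2 * a + 1 by lra.
  have e0 : 0 < e by rewrite lt_min invr_gt0 ltr0n/= divr_gt0// subr_gt0.
  have e2 : e <= 2^-1 by rewrite ge_min lexx.
  have eC : e * (q + 2 * a + 1) <= p + q - a.
    by rewrite -ler_pdivlMr// ge_min lexx orbT.
  have s0 : 0 < 1 - e by lra.
  have := h' _ s0; rewrite addrAC subrr add0r mulNr oppr_ge0 pmulr_rle0//.
  have : a / (1 - e) <= a + 2 * a * e.
    rewrite ler_pdivrMr//.
    have ae : 0 <= a * e by rewrite mulr_ge0// ltW.
    nra.
  have qe : 0 <= q * e by rewrite mulr_ge0// ltW.
  nra.
- pose e := (a - (p + q)) / (q + a + 1).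
  have C0 : 0 < q + a + 1 by lra.
  have e0 : 0 < e by rewrite divr_gt0// subr_gt0.
  have eC : e * (q + a + 1) = a - (p + q) by rewrite divfK// gt_eqF.
  have s0 : 0 < 1 + e by lra.
  have := h' _ s0; rewrite addrAC subrr add0r pmulr_rge0//.
  have : a - a * e <= a / (1 + e).
    rewrite ler_pdivlMr//.
    have ae : 0 <= a * e by rewrite mulr_ge0// ltW.
    nra.
  have qe : 0 <= q * e by rewrite mulr_ge0// ltW.
  nra.
Qed.

End scalar_inequalities.

Section fast_cauchy.
Context (d : measure_display) (T : measurableType d) (R : realType).
Variables (P : {measure set T -> \bar R}) (psi : nat -> T -> R) (C : R).
Hypothesis ipsi : forall n, P.-integrable setT (EFin \o psi n).
Hypothesis fast : forall n,
  (\int[P]_x `|psi n.+1 x - psi n x|%:E <= (C / (2 ^ n.+1)%:R)%:E)%E.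

(** The Riesz-Fischer argument: the sum G of the absolute increments is integrable, hence finite off
    a null set N, where the telescoping series converges absolutely. The function |psi 0| + G
    dominates the sequence. *)
Lemma fast_cauchy_limit : exists (N : set T) (phi : T -> R),
  [/\ measurable N, P N = 0%E, P.-integrable setT (EFin \o phi),
      forall x, ~ N x -> psi n x @[n --> \oo] --> phi x
    & \int[P]_x psi n x @[n --> \oo] --> \int[P]_x phi x].
Proof.
have mpsi n : measurable_fun setT (psi n).
  by apply/measurable_EFinP; exact: measurable_int (ipsi n).
have mdiff n : measurable_fun setT (fun x => `|psi n.+1 x - psi n x|%:E).
  by apply/measurable_EFinP; apply: measurableT_comp => //; exact: measurable_funB.
pose G x := (\sum_(0 <= n <oo) `|psi n.+1 x - psi n x|%:E)%E.
have G0 x : (0 <= G x)%E by apply: nneseries_ge0 => n _ _; rewrite lee_fin.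
have mG : measurable_fun setT G by apply: ge0_emeasurable_sum => // n x _ _; rewrite lee_fin.
have iG : P.-integrable setT G.
  apply/integrableP; split=> //.
  under eq_integral do rewrite gee0_abs//.
  rewrite integral_nneseries//.
  apply: (@le_lt_trans _ _ (\sum_(0 <= n <oo) (C / (2 ^ (n + 1))%:R)%:E)%E).
    apply: lee_nneseries => [n _ _|n _]; last by rewrite addn1.
    by apply: integral_ge0 => x _; rewrite lee_fin.
  have := @cvg_geometric_eseries_half R C 0.
  by move=> /cvg_lim ->//; rewrite ltry.
have [N [mN N0 sN]] := integrable_ae measurableT iG.
have finG x : ~ N x -> G x \is a fin_num.
  by move=> Nx; apply: contrapT => h; apply: Nx; apply: sN => /= /(_ Logic.I).
(* Zero on N, so that the sequence converges everywhere and its limit is measurable. *)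
pose psi' n x := if x \in N then 0 else psi n x.
have partial x n : (\sum_(0 <= i < n) `|psi i.+1 x - psi i x|%:E <= G x)%E.
  by apply: nneseries_lim_ge => i _; rewrite lee_fin.
have cvgpsi x : ~ N x -> cvgn (psi^~ x).
  move=> /finG fG.
  have : cvgn [normed (series (fun i => psi i.+1 x - psi i x))].
    apply: nondecreasing_is_cvgn.
      by apply/nondecreasing_seqP => n; rewrite /= [leRHS]big_nat_recr//= lerDl.
    exists (fine (G x)) => _ [n _ <-].
    rewrite -lee_fin fineK// (le_trans _ (partial x n))//.
    by rewrite sumEFin.
  move=> /normed_cvg/cvg_ex[l cl]; apply/cvg_ex; exists (psi 0%N x + l).
  rewrite (_ : psi^~ x = (fun n => psi 0%N x +
      series (fun i => psi i.+1 x - psi i x) n)).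
    by apply: cvgD => //; exact: cvg_cst.
  by apply/funext => n; rewrite /series/= (telescope_sumr (psi^~ x))// subrKC.
pose phi x := if x \in N then 0 else limn (psi^~ x).
have cvg' x : psi' n x @[n --> \oo] --> phi x.
  rewrite /psi' /phi; case: ifPn => [_|xN]; first exact: cvg_cst.
  by apply: cvgpsi => Nx; move: xN; rewrite mem_set.
have cvgphi x : ~ N x -> psi n x @[n --> \oo] --> phi x.
  by move=> Nx; rewrite /phi memNset//; exact: cvgpsi.
have mpsi' n : measurable_fun setT (psi' n).
  apply: measurable_fun_ifT => //; apply: (measurable_fun_bool true).
  by rewrite setTI preimage_mem_true.
have mphi : measurable_fun setT phi by apply: (measurable_fun_cvg mpsi') => x _.
pose H x := (`|psi 0%N x|%:E + G x)%E.
have iH : P.-integrable setT H.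
  by apply: integrableD => //; exact: (integrable_norm (ipsi 0%N)).
have [i1 _ c1] : [/\ P.-integrable setT (EFin \o phi),
  [sequence \int[P]_x `|(EFin \o psi n) x - (EFin \o phi) x|]_n @ \oo --> 0 &
  [sequence \int[P]_x ((EFin \o psi n) x)]_n @ \oo --> \int[P]_x (EFin \o phi) x]%E.
  apply: (@dominated_convergence _ _ _ P setT measurableT _ (EFin \o phi) H).
  - by move=> n; exact/measurable_EFinP.
  - exact/measurable_EFinP.
  - exists N; split => // x /= h; apply: contrapT => Nx; apply: h => _.
    apply: cvg_EFin; first exact: nearW.
    exact: cvgphi.
  - exact: iH.
  - apply: aeW => x n _ /=; rewrite /H.
    apply: (@le_trans _ _ (`|psi 0%N x|%:E +
       \sum_(0 <= i < n) `|psi i.+1 x - psi i x|%:E)%E); last exact: leeD.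
    rewrite sumEFin -EFinD lee_fin.
    rewrite -{1}[psi n x](subrK (psi 0%N x)) addrC (le_trans (ler_normD _ _))//.
    rewrite lerD2l; case: n => [|n]; first by rewrite subrr normr0 big_geq.
    by rewrite -(@telescope_sumr _ 0 n.+1 (psi^~ x))//; exact: ler_norm_sum.
exists N, phi; split => //.
by apply: fine_cvg; rewrite fineK//; exact: integrable_fin_num.
Qed.

End fast_cauchy.

Local Open Scope ereal_scope.

Section cross_energy_algebra.
Context (d : measure_display) (T : measurableType d) (R : realType).
Variable k : T -> T -> R.
Hypothesis symk : forall x y, k x y = k y x.
Hypothesis mk : measurable_fun [set: T * T] (fun z => k z.1 z.2).
Hypothesis k0 : forall x y, (0 <= k x y)%R.
Implicit Types (mu nu : probability T R) (u v : T -> R).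

Let mw u v : measurable_fun setT u -> measurable_fun setT v ->
  measurable_fun setT (fun z : T * T => (u z.1 * v z.2 * k z.1 z.2)%:E).
Proof. by move=> mu mv; apply/measurable_EFinP; exact: measurable_weighted_kernel. Qed.

Lemma cross_energy_sym mu nu u v :
  measurable_fun setT u -> measurable_fun setT v ->
  (forall x, 0 <= u x)%R -> (forall x, 0 <= v x)%R ->
  cross_energy k mu nu u v = cross_energy k nu mu v u.
Proof.
move=> m1 m2 u0 v0; rewrite /cross_energy.
rewrite fubini_tonelli1; [|exact: mw|by move=> z; rewrite lee_fin !mulr_ge0].
rewrite fubini_tonelli2; [|exact: mw|by move=> z; rewrite lee_fin !mulr_ge0].
apply: eq_integral => x _; apply: eq_integral => y _.
by rewrite /= symk [(u x * _)%R]mulrC.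
Qed.

Lemma cross_energyDl mu nu u u' v :
  measurable_fun setT u -> measurable_fun setT u' -> measurable_fun setT v ->
  (forall x, 0 <= u x)%R -> (forall x, 0 <= u' x)%R -> (forall x, 0 <= v x)%R ->
  cross_energy k mu nu (fun x => u x + u' x)%R v =
  cross_energy k mu nu u v + cross_energy k mu nu u' v.
Proof.
move=> m1 m2 m3 u0 u'0 v0.
rewrite /cross_energy -ge0_integralD//; last 4 first.
- by move=> z _; rewrite lee_fin !mulr_ge0.
- exact: mw.
- by move=> z _; rewrite lee_fin !mulr_ge0.
- exact: mw.
by apply: eq_integral => z _; rewrite -EFinD -!mulrDl.
Qed.

Lemma cross_energyZl mu nu (r : R) u v :
  measurable_fun setT u -> measurable_fun setT v -> (0 <= r)%R ->
  (forall x, 0 <= u x)%R -> (forall x, 0 <= v x)%R ->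
  cross_energy k mu nu (fun x => r * u x)%R v = r%:E * cross_energy k mu nu u v.
Proof.
move=> m1 m2 r0 u0 v0; rewrite /cross_energy -ge0_integralZl_EFin//; last 2 first.
- by move=> z _; rewrite lee_fin !mulr_ge0.
- exact: mw.
by apply: eq_integral => z _; rewrite -EFinM !mulrA.
Qed.

Lemma cross_energyDr mu nu u v v' :
  measurable_fun setT u -> measurable_fun setT v -> measurable_fun setT v' ->
  (forall x, 0 <= u x)%R -> (forall x, 0 <= v x)%R -> (forall x, 0 <= v' x)%R ->
  cross_energy k mu nu u (fun x => v x + v' x)%R =
  cross_energy k mu nu u v + cross_energy k mu nu u v'.
Proof.
move=> m1 m2 m3 u0 v0 v'0.
rewrite cross_energy_sym//; [|exact: measurable_funD|by move=> x; rewrite addr_ge0].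
rewrite cross_energyDl//.
by congr (_ + _); rewrite cross_energy_sym.
Qed.

Lemma cross_energyZr mu nu (r : R) u v :
  measurable_fun setT u -> measurable_fun setT v -> (0 <= r)%R ->
  (forall x, 0 <= u x)%R -> (forall x, 0 <= v x)%R ->
  cross_energy k mu nu u (fun x => r * v x)%R = r%:E * cross_energy k mu nu u v.
Proof.
move=> m1 m2 r0 u0 v0.
rewrite cross_energy_sym//; [|exact: measurable_funM|by move=> x; rewrite mulr_ge0].
by rewrite cross_energyZl//; congr (_ * _); rewrite cross_energy_sym.
Qed.

Lemma cross_energy_aeql mu nu u u' v (N : set T) :
  measurable_fun setT u -> measurable_fun setT u' -> measurable_fun setT v ->
  (forall x, 0 <= u x)%R -> (forall x, 0 <= u' x)%R -> (forall x, 0 <= v x)%R ->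
  measurable N -> mu N = 0 -> (forall x, ~ N x -> u x = u' x) ->
  cross_energy k mu nu u v = cross_energy k mu nu u' v.
Proof.
move=> m1 m2 m3 u0 u'0 v0 mN N0 uu'.
apply: ge0_ae_eq_integral => //; [exact: mw|exact: mw| | |].
- by move=> z _; rewrite lee_fin !mulr_ge0.
- by move=> z _; rewrite lee_fin !mulr_ge0.
exists (N `*` setT); split; first exact: measurableX.
  by transitivity (mu N * nu setT); [exact: product_measure1E|rewrite N0 mul0e].
move=> z /= h; split=> //; apply: contrapT => Nz; apply: h => _.
by rewrite uu'.
Qed.

Lemma cross_energy_aeq mu u u' (N : set T) :
  measurable_fun setT u -> measurable_fun setT u' ->
  (forall x, 0 <= u x)%R -> (forall x, 0 <= u' x)%R ->
  measurable N -> mu N = 0 -> (forall x, ~ N x -> u x = u' x) ->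
  cross_energy k mu mu u u = cross_energy k mu mu u' u'.
Proof.
move=> m1 m2 u0 u'0 mN N0 uu'.
rewrite (cross_energy_aeql mu m1 m2 m1 u0 u'0 u0 mN N0 uu').
rewrite cross_energy_sym//.
by rewrite (cross_energy_aeql mu m1 m2 m2 u0 u'0 u'0 mN N0 uu').
Qed.

End cross_energy_algebra.

(** With p, q the squared norms of two vectors and a, b their two cross terms, this bounds the
    squared norm of the sum by twice the sum of the squared norms. *)
Lemma add4_le_double (R : realType) (p q a b : \bar R) :
  0 <= p -> 0 <= q -> 0 <= a -> 0 <= b ->
  2%:E * a <= p + q -> 2%:E * b <= q + p -> p + a + (b + q) <= 2%:E * (p + q).
Proof.
move=> p0 q0 a0 b0 ha hb.
have dbl (x : \bar R) : 0 <= x -> 2%:E * x = x + x.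
  by move=> x0; rewrite (_ : 2%:E = 1 + 1)// ge0_muleDl// mul1e.
have hab : a + b <= p + q.
  rewrite -(@lee_pmul2l _ 2%:E)// ge0_muleDr// [leRHS]dbl ?adde_ge0//.
  by apply: leeD => //; rewrite (addeC p).
by rewrite dbl ?adde_ge0// (addeC b) addeACA leeD2l.
Qed.

Section minimizer.
Context (d : measure_display) (T : measurableType d) (R : realType).
Variables (k : T -> T -> R) (P : probability T R).
Hypothesis psdk : psd_kernel k.
Hypothesis mk : measurable_fun [set: T * T] (fun z => k z.1 z.2).
Hypothesis k0 : forall x y, (0 <= k x y)%R.
Implicit Types phi chi : T -> R.

Definition potential_energy phi : \bar R :=
  cross_energy k P P (expR \o phi) (expR \o phi).

Definition admissible phi : Prop :=
  P.-integrable setT (EFin \o phi) /\ potential_energy phi < +oo.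

(** The functional J of the overview. As [fine] sends +oo to 0, its value is meaningful for
    admissible phi, to which the statements about it are restricted. *)
Definition dual_functional phi : R :=
  (fine (potential_energy phi) / 2 - \int[P]_x phi x)%R.

Lemma admissible_measurable phi : admissible phi -> measurable_fun setT phi.
Proof. by move=> [ip _]; apply/measurable_EFinP; exact: measurable_int ip. Qed.

Let mexp phi : measurable_fun setT phi -> measurable_fun setT (expR \o phi).
Proof. by move=> mp; exact: measurableT_comp. Qed.

Let exp0 phi x : (0 <= (expR \o phi) x)%R. Proof. exact: expR_ge0. Qed.

Lemma potential_energy_ge0 phi : 0 <= potential_energy phi.
Proof. exact: cross_energy_ge0. Qed.

Lemma potential_energyE phi : potential_energy phi < +oo ->
  potential_energy phi = (fine (potential_energy phi))%:E.
Proof. by move=> h; rewrite fineK// ge0_fin_numE// potential_energy_ge0. Qed.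

(** The exponentials are averaged, not the potentials: the energy is a convex quadratic form in the
    exponential, and the linear term gains from the concavity of the logarithm. *)
Let midpoint phi chi x : R := ln ((expR (phi x) + expR (chi x)) / 2).

Let measurable_midpoint phi chi :
  measurable_fun setT phi -> measurable_fun setT chi ->
  measurable_fun setT (midpoint phi chi).
Proof.
move=> mp mc; apply: measurableT_comp; first exact: measurable_ln.
by apply: measurable_funM => //; apply: measurable_funD; exact: mexp.
Qed.

Let midpoint_energy phi chi :
  measurable_fun setT phi -> measurable_fun setT chi ->
  4%:E * potential_energy (midpoint phi chi) <=
  2%:E * (potential_energy phi + potential_energy chi).
Proof.
move=> mp mc.
have -> : potential_energy (midpoint phi chi) =
    cross_energy k P P (fun x => 2^-1 * ((expR \o phi) x + (expR \o chi) x))%R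
      (fun x => 2^-1 * ((expR \o phi) x + (expR \o chi) x))%R.
  rewrite /potential_energy; have -> // : expR \o midpoint phi chi =
      (fun x => 2^-1 * ((expR \o phi) x + (expR \o chi) x))%R.
  apply/funext => x; rewrite /= /midpoint lnK; first by rewrite mulrC.
  by rewrite posrE divr_gt0// addr_gt0// expR_gt0.
have symk := psdk.1.
have [me1 me2] := (mexp mp, mexp mc).
have mD : measurable_fun setT (fun x => (expR \o phi) x + (expR \o chi) x)%R.
  exact: measurable_funD.
have D0 x : (0 <= (expR \o phi) x + (expR \o chi) x)%R by rewrite addr_ge0// exp0.
rewrite cross_energyZl//; [|exact: measurable_funM|by move=> x; rewrite mulr_ge0].
rewrite cross_energyZr// muleA -EFinM muleA -EFinM.
rewrite (_ : (4 / 2 / 2 = 1)%R) ?mul1e; last by lra.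
rewrite cross_energyDl// !cross_energyDr//.
rewrite -/(potential_energy phi) -/(potential_energy chi).
have h1 := psd_energy_le psdk mk k0 P P me1 me2 (exp0 phi) (exp0 chi).
have h2 := psd_energy_le psdk mk k0 P P me2 me1 (exp0 chi) (exp0 phi).
rewrite -/(potential_energy phi) -/(potential_energy chi) in h1 h2.
have c12 := cross_energy_ge0 k0 P P (exp0 phi) (exp0 chi).
have c21 := cross_energy_ge0 k0 P P (exp0 chi) (exp0 phi).
have p1 := potential_energy_ge0 phi; have p2 := potential_energy_ge0 chi.
exact (add4_le_double p1 p2 c12 c21 h1 h2).
Qed.

(** The value of J at the midpoint is at least m, while convexity of the energy and [midpoint_ln_ge]
    put it below the mean of the two values by t / 2 times the L1 distance, up to t^2. *)
Lemma midpoint_step (m t : R) phi chi : (0 < t <= 1)%R ->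
  (forall xi, admissible xi -> m <= dual_functional xi)%R ->
  admissible phi -> admissible chi ->
  (t / 2 * \int[P]_x `|phi x - chi x| <=
   (dual_functional phi + dual_functional chi) / 2 - m + t ^+ 2)%R.
Proof.
move=> /andP[t0 t1] hm ap ac; have [ip fp] := ap; have [ic fc] := ac.
have mp := admissible_measurable ap; have mc := admissible_measurable ac.
have mx := measurable_midpoint mp mc.
have ix : P.-integrable setT (EFin \o midpoint phi chi).
  apply: (@le_integrable _ _ _ P _ _ _ ((EFin \o (Num.norm \o phi)) \+ (EFin \o (Num.norm \o chi)))) => //.
  - exact/measurable_EFinP.
  - move=> x _.
    change (`|midpoint phi chi x|%:E <= `|(`|phi x| + `|chi x|)%R|%:E).
    rewrite lee_fin [leRHS]ger0_norm ?addr_ge0//.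
    exact: midpoint_ln_abs_le.
  - by apply: integrableD => //; exact: integrable_norm.
have he := midpoint_energy mp mc.
have fx : potential_energy (midpoint phi chi) < +oo.
  move: he; rewrite (potential_energyE fp) (potential_energyE fc).
  rewrite -EFinD -EFinM; have := potential_energy_ge0 (midpoint phi chi).
  case: (potential_energy (midpoint phi chi)) => [r| |]//= _; first by rewrite ltry.
  by rewrite mulry gtr0_sg// mul1e.
have := hm _ (conj ix fx); rewrite /dual_functional.
move: he; rewrite (potential_energyE fp) (potential_energyE fc) (potential_energyE fx).
rewrite -EFinD -!EFinM lee_fin.
have iabs : P.-integrable setT (EFin \o (fun x => `|phi x - chi x|)%R).
  apply: (@integrable_norm _ _ _ P setT (fun x => phi x - chi x)%R).
  exact: (integrableB measurableT ip ic).
have iD : P.-integrable setT (EFin \o (fun x => (phi x + chi x))%R).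
  exact: (integrableD measurableT ip ic).
have iD2 : P.-integrable setT (EFin \o (fun x => 2^-1 * (phi x + chi x))%R).
  exact: (integrableZl measurableT _ iD).
have iA2 : P.-integrable setT (EFin \o (fun x => t / 2 * `|phi x - chi x|)%R).
  exact: (integrableZl measurableT _ iabs).
have ic2 : P.-integrable setT (EFin \o (fun=> - t ^+ 2)%R).
  exact: finite_measure_integrable_cst.
have iS : P.-integrable setT
    (EFin \o (fun x => t / 2 * `|phi x - chi x| + - t ^+ 2)%R).
  exact: (integrableD measurableT iA2 ic2).
have : (\int[P]_x (2^-1 * (phi x + chi x) + (t / 2 * `|phi x - chi x| + - t ^+ 2))
   <= \int[P]_x midpoint phi chi x)%R.
  apply: le_Rintegral => //.
    exact: (integrableD measurableT iD2 iS).
  move=> x _; apply: le_trans (@midpoint_ln_ge _ t (phi x) (chi x) _).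
    by rewrite le_eqVlt; apply/orP; left; apply/eqP; ring.
  by rewrite (ltW t0).
rewrite RintegralD// RintegralD// RintegralZl// RintegralZl// RintegralD//.
rewrite expectation_cst /=.
have arith (qx qp qc ix' ip' ic' D : R) :
    (2^-1 * (ip' + ic') + (t / 2 * D - t ^+ 2) <= ix')%R ->
    (4 * qx <= 2 * (qp + qc))%R -> (m <= qx / 2 - ix')%R ->
    (t / 2 * D <= (qp / 2 - ip' + (qc / 2 - ic')) / 2 - m + t ^+ 2)%R.
  by lra.
exact: arith.
Qed.

(** Along a well-chosen minimizing sequence the linear term converges by L1 convergence and the
    energy is lower semicontinuous by Fatou's lemma. *)
Lemma minimizer_exists (phi0 : T -> R) (B : R) : admissible phi0 ->
  (forall phi, admissible phi -> (B <= dual_functional phi)%R) ->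
  exists2 phi, admissible phi &
    forall chi, admissible chi -> (dual_functional phi <= dual_functional chi)%R.
Proof.
move=> a0 hB.
pose S := [set dual_functional phi | phi in admissible].
have hS : has_inf S.
  by split; [exists (dual_functional phi0), phi0|exists B => _ [phi ap <-]; exact: hB].
pose m := inf S.
have hm phi : admissible phi -> (m <= dual_functional phi)%R.
  by move=> ap; apply: ge_inf; [exact: hS.2|exists phi].
pose t n : R := (2^-1 ^+ n)%R.
have t0 n : (0 < t n)%R by rewrite exprn_gt0// invr_gt0.
have t1 n : (t n <= 1)%R by rewrite exprn_ile1// ?invr_ge0// invf_le1 ?ler1n.
have tS n : (t n.+1 <= t n)%R.
  by rewrite /t exprS ler_piMl// ?ltW// ?t0// invf_lt1 ?ltr1n.
have /choice[psi hpsi] n : exists phi, admissible phi /\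
    (dual_functional phi <= m + t n ^+ 2)%R.
  have [_ [phi ap <-] hphi] := inf_adherent (exprn_gt0 2 (t0 n)) hS.
  by exists phi; split => //; exact: ltW.
have apsi n : admissible (psi n) := (hpsi n).1.
have Jpsi n : (dual_functional (psi n) <= m + t n ^+ 2)%R := (hpsi n).2.
have ipsi n : P.-integrable setT (EFin \o psi n) := (apsi n).1.
have mpsi n := admissible_measurable (apsi n).
have fast n : \int[P]_x `|psi n.+1 x - psi n x|%:E <= (8 / (2 ^ n.+1)%:R)%:E.
  have iabs : P.-integrable setT (EFin \o (fun x => `|psi n.+1 x - psi n x|)%R).
    apply: (@integrable_norm _ _ _ P setT (fun x => psi n.+1 x - psi n x)%R).
    exact: (integrableB measurableT (ipsi _) (ipsi _)).
  rewrite -[leLHS]fineK; last exact: (integrable_fin_num measurableT iabs).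
  have tn : (0 < t n <= 1)%R by rewrite t0 t1.
  have := midpoint_step tn hm (apsi n.+1) (apsi n).
  rewrite -/(Rintegral P setT (fun x => `|psi n.+1 x - psi n x|)%R) => h.
  rewrite lee_fin natrX exprS invfM mulrA -exprVn -/(t n).
  have := Jpsi n; have := Jpsi n.+1.
  have : (t n.+1 ^+ 2 <= t n ^+ 2)%R by rewrite ler_sqr ?nnegrE ?tS//; exact/ltW/t0.
  move: h => /[swap] h1 /[swap] h2 /[swap] h3 h.
  rewrite -(@ler_pM2l _ (t n / 2)%R) ?divr_gt0//; apply: (le_trans h).
  move: (dual_functional (psi n)) (dual_functional (psi n.+1)) h1 h2 h3 => a b.
  by lra.
have [N [phi [mN N0 iphi cphi cint]]] := fast_cauchy_limit ipsi fast.
have mphi : measurable_fun setT phi.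
  by apply/measurable_EFinP; exact: measurable_int iphi.
(* Equal to phi on the null set N: the energies are those of psi, and the convergence to phi holds
   everywhere. *)
pose psi' n x := if x \in N then phi x else psi n x.
have mpsi' n : measurable_fun setT (psi' n).
  apply: measurable_fun_ifT => //; apply: (measurable_fun_bool true).
  by rewrite setTI preimage_mem_true.
have Qpsi n : potential_energy (psi' n) = potential_energy (psi n).
  apply: (@cross_energy_aeq _ _ _ k psdk.1 mk k0 P _ _ N) => //.
  - exact: mexp.
  - exact: mexp.
  - by move=> x Nx; rewrite /= /psi' memNset.
have cpsi' x : psi' n x @[n --> \oo] --> phi x.
  have [xN|xN] := boolP (x \in N).
    by rewrite /psi' xN; exact: cvg_cst.
  by rewrite /psi' (negbTE xN); apply: cphi => Nx; move/negP: xN; apply; exact: mem_set.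
have cJ : dual_functional (psi n) @[n --> \oo] --> m.
  apply: (@squeeze_cvgr _ _ _ _ (fun=> m) (fun n => m + t n)%R).
  - apply: nearW => n; rewrite hm//= (le_trans (Jpsi n))// lerD2l expr2.
    by rewrite ler_piMl// ltW.
  - exact: cvg_cst.
  - rewrite -[X in _ --> X]addr0; apply: cvgD; first exact: cvg_cst.
    by apply: cvg_expr; rewrite ger0_norm ?invr_ge0// invf_lt1 ?ltr1n.
have QE n : potential_energy (psi n) =
    (2 * (dual_functional (psi n) + \int[P]_x psi n x))%:E.
  by rewrite (potential_energyE (apsi n).2); congr EFin; rewrite /dual_functional subrK mulrC divfK.
(* The energy is a combination of J and of the linear term, which both converge. *)
have cQ : potential_energy (psi n) @[n --> \oo] --> (2 * (m + \int[P]_x phi x))%:E.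
  under eq_fun do rewrite QE.
  apply: cvg_EFin; first exact: nearW.
  by apply: cvgM; [exact: cvg_cst|exact: cvgD].
have fatouQ : potential_energy phi <= (2 * (m + \int[P]_x phi x))%:E.
  pose w n (z : T * T) := ((expR \o psi' n) z.1 * (expR \o psi' n) z.2 * k z.1 z.2)%:E.
  have mw n : measurable_fun setT (w n).
    by apply/measurable_EFinP; apply: measurable_weighted_kernel => //; exact: mexp.
  have w0 n z : setT z -> 0 <= w n z by rewrite lee_fin !mulr_ge0.
  have := fatou (P \x P) measurableT mw w0.
  have cw z : w n z @[n --> \oo] -->
      ((expR \o phi) z.1 * (expR \o phi) z.2 * k z.1 z.2)%:E.
    apply: cvg_EFin; first exact: nearW.
    apply: cvgM; last exact: cvg_cst.
    by apply: cvgM; apply: continuous_cvg => //; exact: continuous_expR.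
  rewrite (eq_integral (fun z => ((expR \o phi) z.1 * (expR \o phi) z.2 * k z.1 z.2)%:E));
    last by move=> z _; rewrite (cvg_limn_einf_sup (cw z)).1.
  have -> : (fun n => \int[P \x P]_z w n z) = (fun n => potential_energy (psi n)).
    by apply/funext => n; rewrite -Qpsi.
  by rewrite (cvg_limn_einf_sup cQ).1.
have aphi : admissible phi by split => //; rewrite (le_lt_trans fatouQ)// ltry.
exists phi => // chi achi; apply: le_trans (hm _ achi).
move: fatouQ; rewrite (potential_energyE aphi.2) lee_fin /dual_functional.
by rewrite -ler_pdivrMl// mulrC lerBlDr.
Qed.

End minimizer.

Section euler_lagrange.
Context (d : measure_display) (T : measurableType d) (R : realType).
Variables (k : T -> T -> R) (P : probability T R).
Hypothesis symk : forall x y, k x y = k y x.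
Hypothesis mk : measurable_fun [set: T * T] (fun z => k z.1 z.2).
Hypothesis k0 : forall x y, (0 <= k x y)%R.

(** Adding ln s on A multiplies the exponential by s there, so J becomes p s + q s^2 / 2 - P(A) ln s
    up to a constant, with p the cross energy of A and its complement and q the self-energy of A.
    Minimality at s = 1 gives p + q = P(A). Such perturbations suffice because a measure is
    determined by its values on sets. *)
Lemma minimizer_marginal (phi : T -> R) (A : set T) :
  admissible k P phi ->
  (forall chi, admissible k P chi ->
     (dual_functional k P phi <= dual_functional k P chi)%R) ->
  measurable A ->
  cross_energy k P P (fun x => \1_A x * expR (phi x))%R (expR \o phi) = P A.
Proof.
move=> ap hmin mA; have [iphi fphi] := ap.
have mphi := admissible_measurable ap.
have mexp : measurable_fun setT (expR \o phi) by exact: measurableT_comp.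
pose w1 x : R := (\1_(~` A) x * expR (phi x))%R.
pose w2 x : R := (\1_A x * expR (phi x))%R.
have mw1 : measurable_fun setT w1.
  by apply: measurable_funM => //; apply: measurable_indic; exact: measurableC.
have mw2 : measurable_fun setT w2.
  by apply: measurable_funM => //; exact: measurable_indic.
have w10 x : (0 <= w1 x)%R by rewrite mulr_ge0// expR_ge0.
have w20 x : (0 <= w2 x)%R by rewrite mulr_ge0// expR_ge0.
have e0 x : (0 <= (expR \o phi) x)%R by exact: expR_ge0.
have w1e x : (0 <= w1 x <= (expR \o phi) x)%R.
  by rewrite w10/= ler_piMl ?expR_ge0// indicE; case: (_ \in _).
have w2e x : (0 <= w2 x <= (expR \o phi) x)%R.
  by rewrite w20/= ler_piMl ?expR_ge0// indicE; case: (_ \in _).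
have fin (u v : T -> R) : measurable_fun setT u -> measurable_fun setT v ->
    (forall x, (0 <= u x <= (expR \o phi) x)%R) ->
    (forall x, (0 <= v x <= (expR \o phi) x)%R) ->
    exists2 a : R, (0 <= a)%R & cross_energy k P P u v = a%:E.
  move=> mu mv ue ve.
  have : 0 <= cross_energy k P P u v.
    by apply: cross_energy_ge0 => // x; [case/andP: (ue x)|case/andP: (ve x)].
  have : cross_energy k P P u v < +oo.
    apply: le_lt_trans fphi; exact: (le_cross_energy mk k0).
  by case: cross_energy => // a _ a0; exists a.
have [a11 a110 q11] := fin _ _ mw1 mw1 w1e w1e.
have [a12 a120 q12] := fin _ _ mw1 mw2 w1e w2e.
have [a22 a220 q22] := fin _ _ mw2 mw2 w2e w2e.
have q21 : cross_energy k P P w2 w1 = a12%:E by rewrite cross_energy_sym.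
have expE : expR \o phi = (fun x => w1 x + w2 x)%R.
  apply/funext => x; rewrite /w1 /w2 -mulrDl !indicE in_setC.
  by case: (x \in A); rewrite /= ?add0r ?addr0 mul1r.
rewrite -/w2 expE cross_energyDr// q21 q22 -EFinD.
have PA : P A = (fine (P A))%:E by rewrite fineK// fin_num_measure.
rewrite PA; congr EFin; apply: quadratic_ln_critical => //.
  by rewrite fine_ge0.
move=> s s0.
pose chi x : R := (phi x + ln s * \1_A x)%R.
have ind : P.-integrable setT (EFin \o (\1_A : T -> R)).
  by apply: integrable_indic => //; rewrite -ge0_fin_numE// fin_num_measure.
have indZ : P.-integrable setT (EFin \o (fun x => ln s * \1_A x)%R).
  exact: (integrableZl measurableT _ ind).
have ichi : P.-integrable setT (EFin \o chi).
  exact: (integrableD measurableT iphi indZ).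
have intchi : (\int[P]_x chi x = \int[P]_x phi x + ln s * fine (P A))%R.
  rewrite RintegralD// RintegralZl//; congr (_ + _ * _)%R.
  by rewrite /Rintegral integral_indic// setIT.
have chiE : expR \o chi = (fun x => w1 x + s * w2 x)%R.
  apply/funext => x; rewrite /= /chi /w1 /w2 expRD !indicE in_setC.
  case: (x \in A); rewrite /= ?mulr1 ?mulr0 ?mul0r ?mul1r ?add0r ?addr0.
    by rewrite lnK ?posrE// mulrC.
  by rewrite expR0 !mulr1 mulr0 addr0.
have Qchi : potential_energy k P chi = (a11 + 2 * s * a12 + s ^+ 2 * a22)%:E.
  have ms : measurable_fun setT (fun x => s * w2 x)%R by exact: measurable_funM.
  have sw0 x : (0 <= s * w2 x)%R by rewrite mulr_ge0// ltW.
  have s0' := ltW s0.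
  rewrite /potential_energy chiE cross_energyDl//; [|exact: measurable_funD|
    by move=> x; rewrite addr_ge0].
  rewrite !cross_energyDr// !cross_energyZl// !cross_energyZr//.
  rewrite q11 q12 q21 q22 -!EFinM -!EFinD; congr EFin; ring.
have Qphi : potential_energy k P phi = (a11 + 2 * a12 + a22)%:E.
  rewrite /potential_energy expE cross_energyDl//; [|exact: measurable_funD|
    by move=> x; rewrite addr_ge0].
  by rewrite !cross_energyDr// q11 q12 q21 q22 -!EFinD; congr EFin; ring.
have := hmin chi; rewrite /dual_functional intchi Qchi Qphi/=.
have achi : admissible k P chi by split => //; rewrite Qchi ltry.
move=> /(_ achi); move: (Rintegral P setT phi) (ln s) (fine (P A)) => a b c.
lra.
Qed.

End euler_lagrange.

(** * Pushforwards, couplings and plans with a given density *)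

(** Positive and negative parts are transported separately, so the identity also covers integrals
    with value +oo or -oo. *)
Lemma integral_pushforward_measurable (d1 d2 : measure_display)
    (T1 : measurableType d1) (T2 : measurableType d2) (R : realType)
    (mu : {measure set T1 -> \bar R}) (g : T1 -> T2) (f : T2 -> \bar R) :
  measurable_fun setT g -> measurable_fun setT f ->
  \int[pushforward mu g]_y f y = \int[mu]_x f (g x).
Proof.
move=> mg mf.
pose G : {mfun T1 >-> T2} := HB.pack g (isMeasurableFun.Build _ _ _ _ g mg).
rewrite -[pushforward mu g]/(pushforward mu G) [LHS]integralE.
transitivity (\int[mu]_x (f \o g)^\+ x - \int[mu]_x (f \o g)^\- x); last first.
  by rewrite -integralE.
congr (_ - _).
- transitivity (\int[mu]_(x in G @^-1` setT) (f^\+ \o G) x); last first.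
    by rewrite preimage_setT; apply: eq_integral => x _; rewrite /= !funeposE.
  by apply: ge0_integral_pushforward => //; exact: measurable_funepos.
- transitivity (\int[mu]_(x in G @^-1` setT) (f^\- \o G) x); last first.
    by rewrite preimage_setT; apply: eq_integral => x _; rewrite /= !funenegE.
  by apply: ge0_integral_pushforward => //; exact: measurable_funeneg.
Qed.

Definition diag_pair (T : Type) (x : T) : T * T := (x, x).

Lemma measurable_diag_pair (d : measure_display) (T : measurableType d) :
  measurable_fun [set: T] (@diag_pair T).
Proof. exact: measurable_fun_pair. Qed.

HB.instance Definition _ (d : measure_display) (T : measurableType d) :=
  isMeasurableFun.Build _ _ T (T * T)%type (@diag_pair T) (@measurable_diag_pair d T).

Definition swap_pair (T1 T2 : Type) (z : T1 * T2) : T2 * T1 := (z.2, z.1).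

Lemma measurable_swap_pair (d1 d2 : measure_display) (T1 : measurableType d1)
    (T2 : measurableType d2) : measurable_fun [set: T1 * T2] (@swap_pair T1 T2).
Proof. exact: measurable_fun_pair. Qed.

HB.instance Definition _ (d1 d2 : measure_display) (T1 : measurableType d1)
    (T2 : measurableType d2) :=
  isMeasurableFun.Build _ _ (T1 * T2)%type (T2 * T1)%type (@swap_pair T1 T2)
    (@measurable_swap_pair d1 d2 T1 T2).

Definition diag_plan (d : measure_display) (T : measurableType d) (R : realType)
    (P : probability T R) : probability (T * T)%type R :=
  distribution P (@diag_pair T : {mfun T >-> (T * T)%type}).

Definition swap_plan (d1 d2 : measure_display) (T1 : measurableType d1)
    (T2 : measurableType d2) (R : realType) (pi : probability (T1 * T2)%type R) :
    probability (T2 * T1)%type R :=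
  distribution pi (@swap_pair T1 T2 : {mfun (T1 * T2)%type >-> (T2 * T1)%type}).

Section plans.
Context (d1 d2 : measure_display) (T1 : measurableType d1)
  (T2 : measurableType d2) (R : realType).
Implicit Types (mu : probability T1 R) (nu : probability T2 R).
Implicit Types (pi : probability (T1 * T2)%type R).

Lemma coupling_diag_plan mu : coupling mu mu (diag_plan mu).
Proof. by split. Qed.

Lemma coupling_swap_plan mu nu pi :
  coupling mu nu pi -> coupling nu mu (swap_plan pi).
Proof. by move=> [h1 h2]; split=> A mA; [exact: h2|exact: h1]. Qed.

Lemma coupling_product mu nu : coupling mu nu (mu \x nu).
Proof.
split=> A mA; rewrite /marginal1 /marginal2 /distribution /pushforward/=.
- rewrite (_ : fst @^-1` A = A `*` setT); last first.
    by apply/seteqP; split=> z //= [].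
  by transitivity (mu A * nu setT); [exact: product_measure1E|
    rewrite probability_setT mule1].
- rewrite (_ : snd @^-1` A = setT `*` A); last first.
    by apply/seteqP; split=> z //= [].
  by transitivity (mu setT * nu A); [exact: product_measure1E|
    rewrite probability_setT mul1e].
Qed.

Lemma integral_diag_plan mu (f : T1 * T1 -> \bar R) : measurable_fun setT f ->
  \int[diag_plan mu]_z f z = \int[mu]_x f (x, x).
Proof.
by move=> mf; rewrite (@integral_pushforward_measurable _ _ _ _ _ mu (@diag_pair T1)).
Qed.

Lemma integral_swap_plan pi (f : T2 * T1 -> \bar R) : measurable_fun setT f ->
  \int[swap_plan pi]_z f z = \int[pi]_z f (z.2, z.1).
Proof.
by move=> mf; rewrite (@integral_pushforward_measurable _ _ _ _ _ pi (@swap_pair T1 T2)).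
Qed.

Lemma integral_marginal1 pi mu nu (f : T1 -> \bar R) : coupling mu nu pi ->
  measurable_fun setT f -> \int[pi]_z f z.1 = \int[mu]_x f x.
Proof.
move=> [h _] mf; rewrite -(@integral_pushforward_measurable _ _ _ _ _ pi fst)//.
by apply: eq_measure_integral => A mA _; exact: h.
Qed.

Lemma integral_marginal2 pi mu nu (f : T2 -> \bar R) : coupling mu nu pi ->
  measurable_fun setT f -> \int[pi]_z f z.2 = \int[nu]_x f x.
Proof.
move=> [_ h] mf; rewrite -(@integral_pushforward_measurable _ _ _ _ _ pi snd)//.
by apply: eq_measure_integral => A mA _; exact: h.
Qed.

Lemma integrable_marginal1 pi mu nu (f : T1 -> \bar R) : coupling mu nu pi ->
  mu.-integrable setT f -> pi.-integrable setT (fun z => f z.1).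
Proof.
move=> cpi /integrableP[mf fi]; apply/integrableP; split.
  exact: measurableT_comp.
rewrite (integral_marginal1 (f := fun x => `|f x|) cpi)//.
exact: measurableT_comp.
Qed.

Lemma integrable_marginal2 pi mu nu (f : T2 -> \bar R) : coupling mu nu pi ->
  nu.-integrable setT f -> pi.-integrable setT (fun z => f z.2).
Proof.
move=> cpi /integrableP[mf fi]; apply/integrableP; split.
  exact: measurableT_comp.
rewrite (integral_marginal2 (f := fun x => `|f x|) cpi)//.
exact: measurableT_comp.
Qed.

End plans.

Section with_density.
Context (d : measure_display) (T : measurableType d) (R : realType).
Variables (m : {measure set T -> \bar R}) (w : T -> R).

(** The hypotheses are arguments of the definition so that the measure and probability structures
    can be attached to it. *)
Definition with_density of measurable_fun setT w & (forall x, 0 <= w x)%R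
    & \int[m]_x (w x)%:E = 1 := fun A : set T => \int[m]_(x in A) (w x)%:E.

Variables (mw : measurable_fun setT w) (w0 : forall x, (0 <= w x)%R)
  (w1 : \int[m]_x (w x)%:E = 1).

Local Notation D := (with_density mw w0 w1).

Let D0 : D set0 = 0. Proof. exact: integral_set0. Qed.

Let D_ge0 A : 0 <= D A. Proof. by apply: integral_ge0 => x _; rewrite lee_fin. Qed.

Let D_sigma_additive : semi_sigma_additive D.
Proof.
apply: semi_sigma_additive_nng_induced; first exact/measurable_EFinP.
by move=> x; rewrite lee_fin.
Qed.

HB.instance Definition _ := isMeasure.Build _ _ _ D D0 D_ge0 D_sigma_additive.
HB.instance Definition _ := Measure_isProbability.Build _ _ _ D w1.

End with_density.

Lemma density_probability_exists (d : measure_display) (T : measurableType d)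
    (R : realType) (m : {finite_measure set T -> \bar R}) (w : T -> R) :
  measurable_fun setT w -> (forall x, 0 <= w x)%R -> \int[m]_x (w x)%:E = 1 ->
  exists pi : probability T R, has_density pi m w.
Proof. by move=> mw w0 w1; exists (with_density mw w0 w1). Qed.

Section density_composition.
Context (d1 d2 : measure_display) (T1 : measurableType d1)
  (T2 : measurableType d2) (R : realType).

Lemma density_trans (pi m m0 : {finite_measure set T1 -> \bar R}) (w v : T1 -> R) :
  has_density pi m w -> has_density m m0 v ->
  has_density pi m0 (fun x => w x * v x)%R.
Proof.
move=> [mw w0 wE] hv; have [mv v0 vE] := hv; split.
- exact: measurable_funM.
- by move=> x; rewrite mulr_ge0.
move=> A mA; rewrite wE// integral_mkcond (density_integral hv).
- rewrite [RHS]integral_mkcond; apply: eq_integral => x _.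
  by rewrite !patchE; case: ifP => _; rewrite ?mul0e// EFinM.
- apply/measurable_restrict => //; rewrite setTI.
  by apply/measurable_EFinP; exact: measurable_funS mw.
- by move=> x; rewrite patchE; case: ifP => // _; rewrite lee_fin.
Qed.

Lemma has_density_finite_product (alpha : {finite_measure set T1 -> \bar R})
    (beta : {finite_measure set T2 -> \bar R}) (mu : {finite_measure set T1 -> \bar R})
    (nu : {finite_measure set T2 -> \bar R}) (f : T1 -> R) (g : T2 -> R) :
  has_density alpha mu f -> has_density beta nu g ->
  has_density (finite_product alpha beta) (finite_product mu nu)
    (fun z => f z.1 * g z.2)%R.
Proof.
move=> hf hg; have [mf f0 fE] := hf; have [mg g0 gE] := hg.
have mfg : measurable_fun [set: T1 * T2] (fun z => f z.1 * g z.2)%R.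
  by apply: measurable_funM; exact: measurableT_comp.
split => //; first by move=> z; rewrite mulr_ge0.
move=> A mA.
pose F z := (\1_A z)%:E * (f z.1 * g z.2)%:E : \bar R.
have mF : measurable_fun setT F.
  by apply: emeasurable_funM; apply/measurable_EFinP.
have F0 z : 0 <= F z by rewrite mule_ge0// lee_fin// mulr_ge0.
have m1 : measurable_fun [set: T1 * T2] (fun z => (\1_A z)%:E : \bar R).
  by apply/measurable_EFinP; exact: measurable_indic.
transitivity (\int[mu \x nu]_z F z); last first.
  rewrite [RHS]integral_mkcond; apply: eq_integral => z _.
  by rewrite /F patchE indicE; case: ifP => _; rewrite ?mul1e ?mul0e.
rewrite fubini_tonelli1//.
transitivity (\int[alpha \x beta]_z (\1_A z)%:E).
  by rewrite integral_indic// setIT.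
rewrite fubini_tonelli1//.
rewrite (density_integral hf); last 2 first.
- exact: (measurable_fun_fubini_tonelli_F (fun z => (\1_A z)%:E)).
- by move=> x; apply: integral_ge0 => y _; rewrite lee_fin.
apply: eq_integral => x _; rewrite /fubini_F.
rewrite (density_integral hg); last 2 first.
- by apply: (measurableT_comp m1); exact: pair1_measurable.
- by move=> y; rewrite lee_fin.
rewrite muleC -ge0_integralZl_EFin//; last 2 first.
- by move=> y _; rewrite mule_ge0// lee_fin.
- apply: emeasurable_funM; last exact/measurable_EFinP.
  by apply: (measurableT_comp m1); exact: pair1_measurable.
by apply: eq_integral => y _; rewrite /F/= muleCA EFinM.
Qed.

Lemma has_density_product (alpha : probability T1 R) (beta : probability T2 R)
    (mu : {finite_measure set T1 -> \bar R})
    (nu : {finite_measure set T2 -> \bar R}) (f : T1 -> R) (g : T2 -> R) :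
  has_density alpha mu f -> has_density beta nu g ->
  has_density (alpha \x beta : probability (T1 * T2)%type R) (finite_product mu nu)
    (fun z => f z.1 * g z.2)%R.
Proof. exact: has_density_finite_product. Qed.

End density_composition.

Section negative_parts.
Context (d : measure_display) (T : measurableType d) (R : realType).

Lemma integrable_of_neg (mu : {measure set T -> \bar R}) (f : T -> \bar R) :
  measurable_fun setT f -> \int[mu]_x f^\- x < +oo -> \int[mu]_x f x < +oo ->
  mu.-integrable setT f.
Proof.
move=> mf fn fl.
have n0 : 0 <= \int[mu]_x f^\- x by exact: integral_ge0.
have p0 : 0 <= \int[mu]_x f^\+ x by exact: integral_ge0.
have fp : \int[mu]_x f^\+ x < +oo.
  move: fl; rewrite integralE.
  case: (\int[mu]_x f^\- x) fn n0 => // r _ _.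
  by case: (\int[mu]_x f^\+ x) p0 => //= s _ _; rewrite ltry.
apply/integrableP; split => //.
rewrite (eq_integral (fun x => f^\+ x + f^\- x)); last first.
  by move=> x _; exact: (congr1 (fun h => h x) (fune_abse f)).
rewrite ge0_integralD//; [exact: lte_add_pinfty|exact: measurable_funepos|
  exact: measurable_funeneg].
Qed.

Lemma integral_of_neg_gtNy (mu : {measure set T -> \bar R}) (f : T -> \bar R) :
  \int[mu]_x f^\- x < +oo -> \int[mu]_x f x != -oo.
Proof.
move=> fn; rewrite integralE.
have n0 : 0 <= \int[mu]_x f^\- x by exact: integral_ge0.
have p0 : 0 <= \int[mu]_x f^\+ x by exact: integral_ge0.
case: (\int[mu]_x f^\- x) fn n0 => // r _ _.
by case: (\int[mu]_x f^\+ x) p0.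
Qed.

Lemma integral_neg_pinfty (mu : {measure set T -> \bar R}) (f : T -> \bar R) :
  \int[mu]_x f^\- x = +oo -> \int[mu]_x f x = -oo.
Proof. by move=> fn; rewrite integralE fn addeNy. Qed.

(** Against m the integrand is the negative part of p ln p, at most 1 since - ln p <= 1/p - 1, and m
    is finite. Hence [KL] is never -oo. *)
Lemma KL_negative_part (pi m : {finite_measure set T -> \bar R}) (p : T -> R) :
  has_density pi m p -> \int[pi]_x (fun x => lne (p x)%:E)^\- x < +oo.
Proof.
move=> hp; have [mp p0 pE] := hp.
have ml : measurable_fun setT (fun x => lne (p x)%:E).
  by apply: measurableT_comp; [exact: measurable_lne|exact/measurable_EFinP].
rewrite (density_integral hp); [|exact: measurable_funeneg|by move=> x; exact: funeneg_ge0].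
apply: (@le_lt_trans _ _ (\int[m]_x (cst 1) x)); last first.
  by rewrite integral_cst// mul1e -ge0_fin_numE// fin_num_measure.
apply: ge0_le_integral => //.
- by move=> x _; rewrite mule_ge0 ?lee_fin// funeneg_ge0.
- by apply: emeasurable_funM; [exact: measurable_funeneg|exact/measurable_EFinP].
move=> x _; rewrite funenegE.
have [px|px] := leP (p x) 0%R.
  have -> : p x = 0%R by apply/eqP; rewrite eq_le px p0.
  by rewrite mule0.
rewrite lne_EFin// -EFinN -EFin_max -EFinM lee_fin.
have [h|h] := leP (- ln (p x))%R 0%R; first by rewrite mul0r.
have : (- ln (p x) <= (p x)^-1 - 1)%R.
  rewrite -lnV ?posrE//; have := @le_ln1Dx R ((p x)^-1 - 1)%R.
  by rewrite subrKC; apply; rewrite ltrBrDl subrr invr_gt0.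
move=> /(ler_wpM2r (ltW px)) h'; apply: (le_trans h').
by rewrite mulrBl mulVf ?gt_eqF// mul1r gerBl ltW.
Qed.

End negative_parts.

(** * Debiasing a plan *)

(** The reference measures are independent of the marginals of pi: this is the objective of the
    balanced problem and the part without penalties of the unbalanced one. *)
Definition transport_value (d : measure_display) (T : measurableType d)
    (R : realType) (c : T -> T -> \bar R) (e : R)
    (mu nu : {finite_measure set T -> \bar R})
    (pi : probability (T * T)%type R) : \bar R :=
  \int[pi]_z c z.1 z.2 + e%:E * KL pi (finite_product mu nu).

Lemma ae_le_Rintegral (d : measure_display) (T : measurableType d) (R : realType)
    (mu : {measure set T -> \bar R}) (F G : T -> R) (N : set T) :
  mu.-integrable setT (EFin \o F) -> mu.-integrable setT (EFin \o G) ->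
  measurable N -> mu N = 0 -> (forall x, ~ N x -> F x <= G x)%R ->
  (\int[mu]_x F x <= \int[mu]_x G x)%R.
Proof.
move=> iF iG mN N0 FG.
have mF : measurable_fun setT F by apply/measurable_EFinP; exact: measurable_int iF.
have mG : measurable_fun setT G by apply/measurable_EFinP; exact: measurable_int iG.
(* The minimum equals F off N and is at most G everywhere. *)
pose H x := Num.min (F x) (G x).
have mH : measurable_fun setT H by exact: measurable_minr.
have HF : ae_eq mu setT (EFin \o F) (EFin \o H).
  exists N; split => // x /= h; apply: contrapT => Nx; apply: h => _.
  by rewrite /H min_l// FG.
have iH : mu.-integrable setT (EFin \o H).
  apply: (@le_integrable _ _ _ mu _ measurableT _
    ((EFin \o (Num.norm \o F)) \+ (EFin \o (Num.norm \o G)))) => //.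
  - exact/measurable_EFinP.
  - move=> x _.
    change (`|H x|%:E <= `|(`|F x| + `|G x|)%R|%:E).
    rewrite lee_fin [leRHS]ger0_norm ?addr_ge0// /H.
    by case: (leP (F x) (G x)) => _; rewrite ?lerDl ?lerDr.
  - by apply: integrableD => //; exact: integrable_norm.
have -> : (\int[mu]_x F x = \int[mu]_x H x)%R.
  by congr fine; apply: ae_eq_integral => //; exact/measurable_EFinP.
by apply: le_Rintegral => // x _; rewrite /H ge_min lexx orbT.
Qed.

Lemma le_double_pos_neg (R : realType) (a b r : \bar R) :
  a != -oo -> b != -oo -> r != -oo -> a + b <= 2%:E * r ->
  a <= 2%:E * maxe r 0 + maxe (- b) 0.
Proof.
case: r => [r| |]//; last first.
  move=> _ _ _ _; rewrite (max_idPl _) ?leey// mulry gtr0_sg// mul1e addye ?leey//.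
  by rewrite gt_eqF// (@lt_le_trans _ _ 0)// le_max lexx orbT.
case: a => [s| |]//; case: b => [t| |]// _ _ _; rewrite ?mulry//.
rewrite -EFinM -!EFinN -!EFin_max -!EFinM -!EFinD !lee_fin => h.
have : (- t <= Num.max (- t) 0)%R by rewrite le_max lexx.
have : (r <= Num.max r 0)%R by rewrite le_max lexx.
lra.
Qed.

Section debiased_cost.
Context (d : measure_display) (T : measurableType d) (R : realType).
Variable c : T -> T -> \bar R.
Hypothesis mc : measurable_fun [set: T * T] (fun z => c z.1 z.2).
Hypothesis cNy : forall x y, c x y != -oo.
Hypothesis debc : forall x y, c x x + c y y <= 2%:E * c x y.
Implicit Types (alpha beta : probability T R).

Lemma measurable_cost_diag : measurable_fun setT (fun x => c x x).
Proof. exact: (measurableT_comp mc (@measurable_diag_pair d T)). Qed.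

(** Governs a dichotomy: if finite for both marginals of a coupling, the negative part of c is
    integrable for that coupling; if infinite, the diagonal plan has value -oo. *)
Definition diag_negative_part alpha : \bar R := \int[alpha]_x (fun x => c x x)^\- x.

(** Debiasability acts as a lower bound for c: - c(x,y) is at most half the sum of - c(x,x) and -
    c(y,y). *)
Lemma cost_negative_part_le x y :
  (fun z : T * T => c z.1 z.2)^\- (x, y) <=
  (fun x => c x x)^\- x + (fun x => c x x)^\- y.
Proof.
rewrite !funenegE/=; have := debc x y.
have := cNy x y; have := cNy x x; have := cNy y y.
have m0 (r : \bar R) : 0 <= maxe r 0 by rewrite le_max lexx orbT.
case: (c x y) => [r| |]//; last by move=> _ _ _ _; rewrite (max_idPr _) ?leNye// adde_ge0.
case: (c x x) => [s| |]//; case: (c y y) => [t| |]// _ _ _; rewrite ?mulry//.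
rewrite -EFinM -!EFinN -!EFin_max -!EFinD !lee_fin => h.
have [? ?] : (- s <= Num.max (- s) 0 /\ 0 <= Num.max (- s) 0)%R.
  by rewrite !le_max !lexx orbT.
have [? ?] : (- t <= Num.max (- t) 0 /\ 0 <= Num.max (- t) 0)%R.
  by rewrite !le_max !lexx orbT.
by rewrite ge_max; apply/andP; split; lra.
Qed.

Lemma coupling_negative_part alpha beta (pi : probability (T * T)%type R) :
  coupling alpha beta pi ->
  diag_negative_part alpha < +oo -> diag_negative_part beta < +oo ->
  \int[pi]_z (fun z : T * T => c z.1 z.2)^\- z < +oo.
Proof.
move=> cpi fa fb.
have mg : measurable_fun setT ((fun x => c x x)^\-).
  exact: measurable_funeneg measurable_cost_diag.
have mg1 : measurable_fun setT (fun z : T * T => (fun x => c x x)^\- z.1).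
  exact: measurableT_comp.
have mg2 : measurable_fun setT (fun z : T * T => (fun x => c x x)^\- z.2).
  exact: measurableT_comp.
apply: (@le_lt_trans _ _ (\int[pi]_z ((fun x => c x x)^\- z.1 + (fun x => c x x)^\- z.2))).
  apply: ge0_le_integral => //.
  - exact: measurable_funeneg.
  - exact: emeasurable_funD.
  - by move=> [x y] _; exact: cost_negative_part_le.
rewrite ge0_integralD//.
rewrite (integral_marginal1 cpi mg) (integral_marginal2 cpi mg).
exact: lte_add_pinfty.
Qed.

Lemma diag_plan_value alpha e (mu nu : {finite_measure set T -> \bar R}) :
  diag_negative_part alpha = +oo ->
  transport_value c e mu nu (diag_plan alpha) = -oo.
Proof.
move=> h; rewrite /transport_value (integral_diag_plan _ mc).
by rewrite (integral_neg_pinfty h) addNye.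
Qed.

(* Without entropy the diagonal couplings already realize the debiasing. *)
Lemma unregularized_debiasing alpha beta (pi : probability (T * T)%type R) :
  coupling alpha beta pi ->
  diag_negative_part alpha < +oo -> diag_negative_part beta < +oo ->
  \int[alpha]_x c x x + \int[beta]_x c x x <= 2%:E * \int[pi]_z c z.1 z.2.
Proof.
move=> cpi fa fb; have fpi := coupling_negative_part cpi fa fb.
have cpiNy := integral_of_neg_gtNy fpi.
have [cpiy|cpiy] := eqVneq (\int[pi]_z c z.1 z.2) +oo.
  by rewrite cpiy mulry gtr0_sg// mul1e leey.
have ic : pi.-integrable setT (fun z => c z.1 z.2).
  by apply: integrable_of_neg => //; rewrite lt_neqAle cpiy leey.
have mg := measurable_cost_diag.
have mg1 : measurable_fun setT (fun z : T * T => c z.1 z.1) by exact: (measurableT_comp mg).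
have mg2 : measurable_fun setT (fun z : T * T => c z.2 z.2) by exact: (measurableT_comp mg).
(* Each diagonal value is bounded above by means of the other coordinate. This makes both diagonals
   integrable for pi before the inequality is integrated. *)
have bound x y : c x x <= 2%:E * (fun z : T * T => c z.1 z.2)^\+ (x, y) +
    (fun x => c x x)^\- y.
  by rewrite funeposE funenegE/=; exact: le_double_pos_neg.
have mcp := measurable_funepos mc.
have mgn := measurable_funeneg mg.
have m2 : measurable_fun setT
    (fun z : T * T => 2%:E * (fun z : T * T => c z.1 z.2)^\+ z).
  exact: measurable_funeM.
have int_lty (F : T * T -> \bar R) (G : T * T -> \bar R) : measurable_fun setT F ->
    measurable_fun setT G -> (forall z, 0 <= G z) -> \int[pi]_z G z < +oo ->
    (forall z, F z <= 2%:E * (fun z : T * T => c z.1 z.2)^\+ z + G z) ->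
    \int[pi]_z F^\+ z < +oo.
  move=> mF mG G0 Gf FG.
  apply: (@le_lt_trans _ _ (\int[pi]_z (2%:E * (fun z : T * T => c z.1 z.2)^\+ z + G z))).
    apply: ge0_le_integral => //.
    - exact: measurable_funepos.
    - exact: emeasurable_funD.
    - move=> z _; rewrite funeposE ge_max FG/= adde_ge0// mule_ge0//.
  rewrite ge0_integralD//; last by move=> z _; rewrite mule_ge0.
  apply: lte_add_pinfty => //; rewrite ge0_integralZl_EFin//.
  by apply: lte_mul_pinfty => //; exact: integral_funepos_lt_pinfty ic.
have posint (F : T * T -> \bar R) : measurable_fun setT F ->
   \int[pi]_z F^\+ z < +oo -> \int[pi]_z F^\- z < +oo -> pi.-integrable setT F.
  move=> mF Fp Fn; apply: integrable_of_neg => //; rewrite integralE.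
  apply: (le_lt_trans _ Fp); rewrite -[leRHS]adde0; apply: leeD2l.
  by rewrite oppe_le0; exact: integral_ge0.
have funegE (i : T * T -> T) : (fun z => c (i z) (i z))^\- =
    (fun z => (fun x => c x x)^\- (i z)).
  by apply/funext => z; rewrite !funenegE.
have n1 : \int[pi]_z (fun x => c x x)^\- z.1 < +oo by rewrite (integral_marginal1 cpi mgn).
have n2 : \int[pi]_z (fun x => c x x)^\- z.2 < +oo by rewrite (integral_marginal2 cpi mgn).
have mn1 : measurable_fun setT (fun z : T * T => (fun x => c x x)^\- z.1).
  exact: (measurableT_comp mgn).
have mn2 : measurable_fun setT (fun z : T * T => (fun x => c x x)^\- z.2).
  exact: (measurableT_comp mgn).
have i1 : pi.-integrable setT (fun z : T * T => c z.1 z.1).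
  apply: posint => //; last by rewrite (funegE fst).
  by apply: (int_lty _ (fun z => (fun x => c x x)^\- z.2)) => // -[x y]; exact: bound.
have bound' x y : c x x <= 2%:E * (fun z : T * T => c z.1 z.2)^\+ (y, x) +
    (fun x => c x x)^\- y.
  by rewrite funeposE funenegE/=; apply: le_double_pos_neg => //; rewrite addeC.
have i2 : pi.-integrable setT (fun z : T * T => c z.2 z.2).
  apply: posint => //; last by rewrite (funegE snd).
  by apply: (int_lty _ (fun z => (fun x => c x x)^\- z.1)) => // -[x y]; exact: bound'.
rewrite -(integral_marginal1 cpi mg) -(integral_marginal2 cpi mg).
rewrite -integralD// -integralZl//; apply: le_integral => //.
- exact: integrableD.
- exact: integrableZl.
Qed.

End debiased_cost.

Lemma ae_eq_integrable (d : measure_display) (T : measurableType d) (R : realType)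
    (mu : {measure set T -> \bar R}) (f g : T -> \bar R) :
  measurable_fun setT g -> ae_eq mu setT f g ->
  mu.-integrable setT f -> mu.-integrable setT g.
Proof.
move=> mg [N [mN N0 sN]] /integrableP[mf fi]; apply/integrableP; split => //.
rewrite (_ : \int[mu]_x `|g x| = \int[mu]_x `|f x|)//.
apply: ge0_ae_eq_integral => //; [exact: measurableT_comp|exact: measurableT_comp|].
by exists N; split => // x /= h; apply: sN => /= h'; apply: h => _; rewrite h'.
Qed.

Lemma measurable_funV_ge0 (d : measure_display) (T : measurableType d)
    (R : realType) (f : T -> R) : measurable_fun setT f ->
  (forall x, (0 <= f x)%R) -> measurable_fun setT (fun x => (f x)^-1%R).
Proof.
move=> mf f0; rewrite (_ : (fun x => _) = (fun x => f x `^ (-1))%R).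
  exact: (measurableT_comp (measurable_powR _)).
by apply/funext => x; rewrite powR_inv1.
Qed.

(** * Gibbs kernels and entropic plans *)

Section entropic.
Context (d : measure_display) (T : measurableType d) (R : realType).
Variables (c : T -> T -> \bar R) (e : R) (k : T -> T -> R).
Hypothesis e0 : (0 < e)%R.
Hypothesis mc : measurable_fun [set: T * T] (fun z => c z.1 z.2).
Hypothesis cNy : forall x y, c x y != -oo.
Hypothesis symc : forall x y, c x y = c y x.
Hypothesis debc : forall x y, c x x + c y y <= 2%:E * c x y.
Hypothesis kE : forall x y, (k x y)%:E = expeR (- ((e^-1)%:E * c x y)).
Implicit Types (alpha beta : probability T R).
Implicit Types (mu nu : {finite_measure set T -> \bar R}).

Lemma gibbs_ge0 x y : (0 <= k x y)%R.
Proof. by rewrite -lee_fin kE expeR_ge0. Qed.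

Lemma gibbs_sym x y : k x y = k y x.
Proof. by apply: EFin_inj; rewrite !kE symc. Qed.

Lemma gibbs_cost x y : (0 < k x y)%R -> c x y = (- e * ln (k x y))%:E.
Proof.
have := kE x y; have := cNy x y; case: (c x y) => [r| |]// _.
  by move=> [->] _; rewrite expRK mulrNN mulrA divff ?mul1r// gt_eqF.
by rewrite mulry gtr0_sg ?invr_gt0// mul1e => -[->]; rewrite ltxx.
Qed.

Lemma gibbs_gt0 x y : c x y \is a fin_num -> (0 < k x y)%R.
Proof.
have := kE x y; case: (c x y) => [r| |]// [->] _; exact: expR_gt0.
Qed.

Lemma measurable_gibbs : measurable_fun [set: T * T] (fun z => k z.1 z.2).
Proof.
rewrite (_ : (fun z => _) = (fun z : T * T =>
    if c z.1 z.2 \is a fin_num then expR (- (e^-1 * fine (c z.1 z.2))) else 0)%R).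
  apply: measurable_fun_ifT => //.
    apply: (measurable_fun_bool true).
    exact: (emeasurable_fin_num measurableT mc).
  apply: measurableT_comp => //; apply: measurableT_comp => //.
  by apply: measurable_funM => //; exact: measurableT_comp.
apply/funext => z; have := kE z.1 z.2; have := cNy z.1 z.2.
case: (c z.1 z.2) => [r| |]//= _; first by case.
by rewrite mulry gtr0_sg ?invr_gt0// mul1e => -[].
Qed.

(** The integral of ln h <= h - 1 against pi, where h is e^phi e^chi k / p off a null set. The
    weights 1/f and 1/g cancel the density of alpha \x beta with respect to [finite_product mu nu],
    the measure to which p refers. *)
Lemma entropic_lower_bound alpha beta mu nu (pi : probability (T * T)%type R)
    (p : T * T -> R) (f g phi chi : T -> R) (E : R) :
  coupling alpha beta pi -> has_density pi (finite_product mu nu) p ->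
  has_density alpha mu f -> has_density beta nu g ->
  pi.-integrable setT (fun z => c z.1 z.2) ->
  pi.-integrable setT (fun z => lne (p z)%:E) ->
  alpha.-integrable setT (EFin \o phi) -> beta.-integrable setT (EFin \o chi) ->
  cross_energy k alpha beta (fun x => (f x)^-1 * expR (phi x))%R
    (fun y => (g y)^-1 * expR (chi y))%R = E%:E ->
  (\int[alpha]_x phi x + \int[beta]_y chi y
   - (e^-1 * fine (\int[pi]_z c z.1 z.2)%E + fine (\int[pi]_z lne (p z)%:E)%E)
   <= E - 1)%R.
Proof.
move=> cpi hp hf hg ic ip iphi ichi EE.
have [mp p0 pE] := hp; have [mf f0 fE] := hf; have [mg g0 gE] := hg.
have mphi : measurable_fun setT phi by apply/measurable_EFinP; exact: measurable_int iphi.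
have mchi : measurable_fun setT chi by apply/measurable_EFinP; exact: measurable_int ichi.
have mk := measurable_gibbs.
have k0 := gibbs_ge0.
pose u x : R := ((f x)^-1 * expR (phi x))%R.
pose v y : R := ((g y)^-1 * expR (chi y))%R.
have mu' : measurable_fun setT u.
  by apply: measurable_funM; [exact: measurable_funV_ge0|exact: measurableT_comp].
have mv : measurable_fun setT v.
  by apply: measurable_funM; [exact: measurable_funV_ge0|exact: measurableT_comp].
have u0 x : (0 <= u x)%R by rewrite mulr_ge0 ?invr_ge0 ?expR_ge0.
have v0 x : (0 <= v x)%R by rewrite mulr_ge0 ?invr_ge0 ?expR_ge0.
pose w z : R := (u z.1 * v z.2 * k z.1 z.2)%R.
have mw : measurable_fun setT w by exact: measurable_weighted_kernel.
have w0 z : (0 <= w z)%R by apply: mulr_ge0 => //; exact: mulr_ge0.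
pose fg z : R := (f z.1 * g z.2)%R.
have mfg : measurable_fun setT fg.
  by apply: measurable_funM; exact: measurableT_comp.
have fg0 z : (0 <= fg z)%R by rewrite mulr_ge0.
pose h z : R := (w z * fg z / p z)%R.
have mh : measurable_fun setT h.
  apply: measurable_funM; first exact: measurable_funM.
  exact: measurable_funV_ge0.
have h0 z : (0 <= h z)%R by apply: mulr_ge0; [exact: mulr_ge0|rewrite invr_ge0].
(* Only an inequality, since h p vanishes where p does while w fg need not. *)
have hE : \int[pi]_z (h z)%:E <= E%:E.
  rewrite (density_integral hp); [|exact/measurable_EFinP|by move=> z; rewrite lee_fin].
  rewrite -EE /cross_energy.
  rewrite (density_integral (has_density_product hf hg));
    [|exact/measurable_EFinP|by move=> z; rewrite lee_fin; exact: w0].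
  apply: ge0_le_integral => //.
  - by move=> z _; rewrite -EFinM lee_fin; exact: mulr_ge0.
  - by apply: emeasurable_funM; exact/measurable_EFinP.
  - by apply: emeasurable_funM; exact/measurable_EFinP.
  - move=> z _; rewrite -!EFinM lee_fin /h.
    have [->|pz] := eqVneq (p z) 0%R; first by rewrite mulr0; exact: (mulr_ge0 (w0 z) (fg0 z)).
    by rewrite divfK.
have ih : pi.-integrable setT (EFin \o h).
  apply/integrableP; split; first exact/measurable_EFinP.
  rewrite (eq_integral (EFin \o h)); last by move=> z _ /=; rewrite ger0_norm.
  by rewrite (le_lt_trans hE)// ltry.
have [N1 [mN1 N10 sN1]] := integrable_ae measurableT ic.
have mle (q : T -> R) : measurable_fun setT q -> measurable [set x | (q x <= 0)%R].
  move=> mq; have -> : [set x | (q x <= 0)%R] = q @^-1` `]-oo, 0%R].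
    by apply/seteqP; split => x /=; rewrite in_itv.
  by rewrite -[X in measurable X]setTI; exact: mq.
have mlep : measurable [set z | (p z <= 0)%R].
  have -> : [set z | (p z <= 0)%R] = p @^-1` `]-oo, 0%R].
    by apply/seteqP; split => x /=; rewrite in_itv.
  by rewrite -[X in measurable X]setTI; exact: mp.
pose N2 : set (T * T) := [set z | (p z <= 0)%R].
pose N3 : set (T * T) := fst @^-1` [set x | (f x <= 0)%R].
pose N4 : set (T * T) := snd @^-1` [set x | (g x <= 0)%R].
have mN3 : measurable N3.
  by rewrite -[X in measurable X]setTI; apply: measurable_fst => //; exact: mle.
have mN4 : measurable N4.
  by rewrite -[X in measurable X]setTI; apply: measurable_snd => //; exact: mle.
have N20 : pi N2 = 0 by exact: density_gt0_ae hp.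
have N30 : pi N3 = 0 by rewrite -(density_gt0_ae hf); apply: cpi.1; exact: mle.
have N40 : pi N4 = 0 by rewrite -(density_gt0_ae hg); apply: cpi.2; exact: mle.
(* Off N the cost is finite and p, f, g are positive, so ln h splits into its terms. *)
pose N := N1 `|` (N2 `|` (N3 `|` N4)).
have mN34 : measurable (N3 `|` N4) by exact: measurableU.
have mN234 : measurable (N2 `|` (N3 `|` N4)) by exact: measurableU.
have mN : measurable N by exact: measurableU.
have N0 : pi N = 0 by rewrite !null_set_setU.
pose C z : R := fine (c z.1 z.2).
pose L z : R := ln (p z).
have mC : measurable_fun setT C by exact: measurableT_comp.
have mL : measurable_fun setT L by apply: measurableT_comp => //; exact: measurable_ln.
have Cae : ae_eq pi setT (fun z => c z.1 z.2) (EFin \o C).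
  exists N1; split => // z /= hz; apply: sN1 => /= hz'; apply: hz => _.
  by rewrite /C fineK// hz'.
have Lae : ae_eq pi setT (fun z => lne (p z)%:E) (EFin \o L).
  exists N2; split => // z /= hz; rewrite /N2 /= leNgt; apply/negP => pz; apply: hz => _.
  by rewrite leNgt pz.
have iC : pi.-integrable setT (EFin \o C).
  by apply: ae_eq_integrable Cae ic; exact/measurable_EFinP.
have iL : pi.-integrable setT (EFin \o L).
  by apply: ae_eq_integrable Lae ip; exact/measurable_EFinP.
have intC : fine (\int[pi]_z c z.1 z.2) = (\int[pi]_z C z)%R.
  by congr fine; apply: ae_eq_integral => //; exact/measurable_EFinP.
have intL : fine (\int[pi]_z lne (p z)%:E) = (\int[pi]_z L z)%R.
  congr fine; apply: ae_eq_integral => //; last exact/measurable_EFinP.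
  by move/integrableP : ip => [].
rewrite intC intL.
have i1 : pi.-integrable setT (EFin \o (phi \o fst)) := integrable_marginal1 cpi iphi.
have i2 : pi.-integrable setT (EFin \o (chi \o snd)) := integrable_marginal2 cpi ichi.
have i12 : pi.-integrable setT (EFin \o (fun z => phi z.1 + chi z.2)%R).
  exact: (integrableD measurableT i1 i2).
have iCL : pi.-integrable setT (EFin \o (fun z => e^-1 * C z + L z)%R).
  exact: (integrableD measurableT (integrableZl measurableT e^-1 iC) iL).
have iB : pi.-integrable setT
    (EFin \o (fun z => (phi z.1 + chi z.2) - (e^-1 * C z + L z))%R).
  exact: (integrableB measurableT i12 iCL).
have i1cst : pi.-integrable setT (EFin \o (fun=> 1%R : R)).
  exact: finite_measure_integrable_cst.
have ih1 : pi.-integrable setT (EFin \o (fun z => h z - 1)%R).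
  exact: (integrableB measurableT ih i1cst).
have main := ae_le_Rintegral iB ih1 mN N0.
have eint1 : (\int[pi]_z phi z.1 = \int[alpha]_x phi x)%R.
  congr fine; apply: (integral_marginal1 (f := EFin \o phi) cpi).
  exact/measurable_EFinP.
have eint2 : (\int[pi]_z chi z.2 = \int[beta]_x chi x)%R.
  congr fine; apply: (integral_marginal2 (f := EFin \o chi) cpi).
  exact/measurable_EFinP.
move: main; rewrite RintegralB// RintegralB// RintegralD// RintegralD//; last first.
  exact: (integrableZl measurableT e^-1 iC).
rewrite RintegralZl// expectation_cst eint1 eint2 => main.
apply: le_trans (main _) _; last first.
  rewrite lerD2r -lee_fin fineK//; exact: integrable_fin_num.
move=> z Nz.
have [Nz1 [Nz2 [Nz3 Nz4]]] : ~ N1 z /\ ~ N2 z /\ ~ N3 z /\ ~ N4 z.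
  by split; [|split; [|split]] => hz; apply: Nz; [left|right; left|right; right; left|
    right; right; right].
have cfin : c z.1 z.2 \is a fin_num.
  by apply: contrapT => hz; apply: Nz1; apply: sN1 => /= /(_ Logic.I).
have pz : (0 < p z)%R by rewrite ltNge; apply/negP.
have fz : (0 < f z.1)%R by rewrite ltNge; apply/negP.
have gz : (0 < g z.2)%R by rewrite ltNge; apply/negP.
have kz := gibbs_gt0 cfin.
have hz : h z = (expR (phi z.1) * expR (chi z.2) * k z.1 z.2 / p z)%R.
  by rewrite /h /w /u /v /fg; field; rewrite !gt_eqF.
have hz0 : (0 < h z)%R by rewrite hz !mulr_gt0 ?invr_gt0 ?expR_gt0.
have lnh : ln (h z) = (phi z.1 + chi z.2 + ln (k z.1 z.2) - ln (p z))%R.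
  rewrite hz lnM ?posrE ?invr_gt0 ?mulr_gt0 ?expR_gt0//.
  by rewrite !lnM ?posrE ?mulr_gt0 ?expR_gt0// !expRK lnV.
have -> : (phi z.1 + chi z.2 - (e^-1 * C z + L z) = ln (h z))%R.
  rewrite lnh /C (gibbs_cost kz)/= /L mulNr mulrN mulrA mulVf ?gt_eqF//.
  by rewrite mul1r; ring.
by have := @le_ln1Dx R (h z - 1)%R; rewrite subrKC; apply; rewrite ltrBrDl subrr.
Qed.

(* The Euler-Lagrange equation says that u x * u y * k x y is the density of a
   coupling; its entropy is explicit because it is a product over the kernel. *)
Lemma schrodinger_plan alpha mu (f phi : T -> R) :
  has_density alpha mu f -> alpha.-integrable setT (EFin \o phi) ->
  diag_negative_part c alpha < +oo ->
  (forall A, measurable A ->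
    cross_energy k alpha alpha (fun x => \1_A x * ((f x)^-1 * expR (phi x)))%R
      (fun x => (f x)^-1 * expR (phi x))%R = alpha A) ->
  exists2 pi, coupling alpha alpha pi &
    transport_value c e mu mu pi = (2 * e * \int[alpha]_x phi x)%:E.
Proof.
move=> hf iphi gneg marg; have [mf f0 fE] := hf.
have mphi : measurable_fun setT phi by apply/measurable_EFinP; exact: measurable_int iphi.
have mk := measurable_gibbs; have k0 := gibbs_ge0.
pose u x : R := ((f x)^-1 * expR (phi x))%R.
have mu' : measurable_fun setT u.
  by apply: measurable_funM; [exact: measurable_funV_ge0|exact: measurableT_comp].
have u0 x : (0 <= u x)%R by rewrite mulr_ge0 ?invr_ge0 ?expR_ge0.
pose w z : R := (u z.1 * u z.2 * k z.1 z.2)%R.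
have mw : measurable_fun setT w by exact: measurable_weighted_kernel.
have w0 z : (0 <= w z)%R by apply: mulr_ge0 => //; exact: mulr_ge0.
have muA A : measurable A -> measurable_fun setT (fun x => \1_A x * u x)%R.
  by move=> mA; apply: measurable_funM => //; exact: measurable_indic.
have w1 : \int[alpha \x alpha]_z (w z)%:E = 1.
  rewrite -(@probability_setT _ _ _ alpha) -(marg _ measurableT); apply: eq_integral => z _.
  by rewrite /w /u indicT !mul1r.
have [pi hpi] := @density_probability_exists _ (T * T)%type R
  (alpha \x alpha : probability (T * T)%type R) w mw w0 w1.
have [_ _ piE] := hpi.
have cpi : coupling alpha alpha pi.
  split=> A mA.
  - transitivity (pi (fst @^-1` A)); first by [].
    rewrite piE; last by rewrite -[X in measurable X]setTI; exact: measurable_fst.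
    apply/esym; rewrite -[RHS]/(\int[alpha \x alpha]_(z in fst @^-1` A) (w z)%:E).
    transitivity (cross_energy k alpha alpha (fun x => \1_A x * u x)%R u).
      exact/esym/marg.
    apply/esym; rewrite integral_mkcond; apply: eq_integral => z _.
    rewrite patchE -/(u z.1) -/(u z.2) /w indicE.
    rewrite (_ : (z \in fst @^-1` A) = (z.1 \in A)); last by apply/idP/idP; rewrite !inE.
    by case: (_ \in _); rewrite ?mul1r ?mul0r// mulrA.
  - transitivity (pi (snd @^-1` A)); first by [].
    rewrite piE; last by rewrite -[X in measurable X]setTI; exact: measurable_snd.
    transitivity (cross_energy k alpha alpha u (fun x => \1_A x * u x)%R); last first.
      apply: etrans (marg _ mA); rewrite cross_energy_sym//; [exact: gibbs_sym|exact: muA|].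
      by move=> x; rewrite mulr_ge0.
    rewrite integral_mkcond; apply: eq_integral => z _.
    rewrite patchE /w indicE.
    rewrite (_ : (z \in snd @^-1` A) = (z.2 \in A)); last by apply/idP/idP; rewrite !inE.
    by case: (_ \in _); rewrite ?mul1r ?mul0r ?mulr0 ?mul0r.
exists pi => //.
pose p z : R := (w z * (f z.1 * f z.2))%R.
have hp : has_density pi (finite_product mu mu) p.
  exact: density_trans hpi (has_density_product hf hf).
have [mp p0 pE] := hp.
rewrite /transport_value (KL_density hp).
have cneg := coupling_negative_part mc cNy debc cpi gneg gneg.
have Lneg := KL_negative_part hp.
have i1 : pi.-integrable setT (EFin \o (phi \o fst)) := integrable_marginal1 cpi iphi.
have i2 : pi.-integrable setT (EFin \o (phi \o snd)) := integrable_marginal2 cpi iphi.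
pose N : set (T * T) := [set z | (p z <= 0)%R].
have mN : measurable N.
  have -> : N = p @^-1` `]-oo, 0%R] by apply/seteqP; split => x /=; rewrite in_itv.
  by rewrite -[X in measurable X]setTI; exact: mp.
have N0 : pi N = 0 by exact: density_gt0_ae hp.
pose K z : R := ln (k z.1 z.2).
pose L z : R := (phi z.1 + phi z.2 + K z)%R.
have mK : measurable_fun setT K by apply: measurableT_comp => //; exact: measurable_ln.
have mphi1 : measurable_fun [set: T * T] (fun z => phi z.1) by exact: measurableT_comp.
have mphi2 : measurable_fun [set: T * T] (fun z => phi z.2) by exact: measurableT_comp.
have mL : measurable_fun setT L.
  by apply: measurable_funD => //; exact: measurable_funD.
have good z : ~ N z -> (0 < k z.1 z.2)%R /\ lne (p z)%:E = (L z)%:E.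
  move=> /negP; rewrite -ltNge => pz.
  have ne (q : R) : (0 <= q)%R -> (q != 0)%R -> (0 < q)%R by rewrite lt0r => -> ->.
  have pz' : p z != 0%R by rewrite gt_eqF.
  have fz1 : (0 < f z.1)%R.
    by apply: ne => //; apply: contra_neq pz' => h; rewrite /p h mul0r mulr0.
  have fz2 : (0 < f z.2)%R.
    by apply: ne => //; apply: contra_neq pz' => h; rewrite /p h !mulr0.
  have kz : (0 < k z.1 z.2)%R.
    by apply: ne => //; apply: contra_neq pz' => h; rewrite /p /w h mulr0 mul0r.
  split => //; rewrite lne_EFin//; congr EFin.
  have -> : p z = (expR (phi z.1) * expR (phi z.2) * k z.1 z.2)%R.
    by rewrite /p /w /u; field; rewrite !gt_eqF.
  by rewrite !lnM ?posrE ?mulr_gt0 ?expR_gt0// !expRK.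
have Lae : ae_eq pi setT (fun z => lne (p z)%:E) (EFin \o L).
  exists N; split => // z h; apply: contrapT => /good[_ h']; apply: h => _.
  exact: h'.
have cae : ae_eq pi setT (fun z => c z.1 z.2) (EFin \o (fun z => - e * K z)%R).
  exists N; split => // z h; apply: contrapT => /good[kz _]; apply: h => _.
  exact: gibbs_cost.
(* The negative part of L is integrable by [KL_negative_part]. Its positive part is at most |phi| +
   |phi| + K^+, and K^+ = c^- / e is integrable by [coupling_negative_part]. *)
have iL : pi.-integrable setT (EFin \o L).
  apply/integrableP; split; first exact/measurable_EFinP.
  pose G1 := (fun z => lne (p z)%:E)^\-.
  pose G2 z : \bar R := (`|phi z.1| + `|phi z.2|)%:E.
  pose G3 z := (e^-1)%:E * (fun z : T * T => c z.1 z.2)^\- z.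
  have mG1 : measurable_fun setT G1.
    apply: measurable_funeneg; apply: measurableT_comp; first exact: measurable_lne.
    exact/measurable_EFinP.
  have mG2 : measurable_fun setT G2.
    by apply/measurable_EFinP; apply: measurable_funD; exact: measurableT_comp.
  have mG3 : measurable_fun setT G3.
    by apply: measurable_funeM; exact: measurable_funeneg.
  have G10 z : 0 <= G1 z by exact: funeneg_ge0.
  have G20 z : 0 <= G2 z by rewrite lee_fin addr_ge0.
  have G30 z : 0 <= G3 z.
    by rewrite mule_ge0 ?funeneg_ge0// lee_fin invr_ge0 ltW.
  have m23 : measurable_fun setT (fun z => G2 z + G3 z) by exact: emeasurable_funD.
  apply: (@le_lt_trans _ _ (\int[pi]_z (G1 z + (G2 z + G3 z)))).
    apply: ae_ge0_le_integral => //.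
    - by apply: measurableT_comp => //; exact/measurable_EFinP.
    - by move=> z _; rewrite !adde_ge0.
    - exact: emeasurable_funD.
    - exists N; split => // z h; apply: contrapT => Nz; apply: h => _.
      have [kz lE] := good _ Nz.
      rewrite /G1 /G3 funenegE funenegE lE (gibbs_cost kz) /G2 -/(K z).
      change (`|L z|%:E <= maxe (- (L z)%:E) 0 + ((`|phi z.1| + `|phi z.2|)%:E
         + (e^-1)%:E * maxe (- (- e * K z)%:E) 0)).
      rewrite -!EFinN -!EFin_max -EFinM -!EFinD lee_fin.
      have -> : (e^-1 * Num.max (- (- e * K z)) 0 = Num.max (K z) 0)%R.
        rewrite mulNr opprK maxr_pMr ?invr_ge0 ?ltW//.
        by rewrite mulr0 mulrA mulVf ?mul1r// gt_eqF.
      have : (K z <= Num.max (K z) 0)%R by rewrite le_max lexx.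
      have : (0 <= Num.max (K z) 0)%R by rewrite le_max lexx orbT.
      have : (- L z <= Num.max (- L z) 0)%R by rewrite le_max lexx.
      have : (0 <= Num.max (- L z) 0)%R by rewrite le_max lexx orbT.
      have n1 := ler_norm (phi z.1); have n2 := ler_norm (phi z.2).
      have n3 := normr_ge0 (phi z.1); have n4 := normr_ge0 (phi z.2).
      rewrite ler_norml /L; move: (Num.max (K z) 0%R) (Num.max (- _)%R 0%R) => a b.
      by move=> ? ? ? ?; apply/andP; split; lra.
  rewrite ge0_integralD//; last by move=> z _; exact: adde_ge0.
  apply: lte_add_pinfty => //.
  rewrite ge0_integralD//; apply: lte_add_pinfty.
    have iG2 : pi.-integrable setT G2.
      apply: (integrableD measurableT (f := EFin \o (Num.norm \o (phi \o fst)))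
         (g := EFin \o (Num.norm \o (phi \o snd)))); exact: integrable_norm.
    by apply: integrable_lty.
  rewrite ge0_integralZl_EFin ?invr_ge0 ?ltW//; last first.
    exact: measurable_funeneg.
  by apply: lte_mul_pinfty => //; rewrite lee_fin invr_ge0 ltW.
have i12 : pi.-integrable setT (EFin \o (fun z => phi z.1 + phi z.2)%R).
  exact: (integrableD measurableT i1 i2).
have iK : pi.-integrable setT (EFin \o K).
  apply: (eq_integrable measurableT (fun z => (L z - (phi z.1 + phi z.2))%:E)).
    by move=> z _; rewrite /L /= addrAC subrr add0r.
  exact: (integrableB measurableT iL i12).
have eint1 : (\int[pi]_z phi z.1 = \int[alpha]_x phi x)%R.
  congr fine; apply: (integral_marginal1 (f := EFin \o phi) cpi).
  exact/measurable_EFinP.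
have eint2 : (\int[pi]_z phi z.2 = \int[alpha]_x phi x)%R.
  congr fine; apply: (integral_marginal2 (f := EFin \o phi) cpi).
  exact/measurable_EFinP.
have ieK : pi.-integrable setT (EFin \o (fun z => - e * K z)%R).
  exact: (integrableZl measurableT (- e)%R iK).
have -> : \int[pi]_z c z.1 z.2 = (- e * \int[pi]_z K z)%:E.
  rewrite -RintegralZl// /Rintegral fineK ?integrable_fin_num//.
  by apply: ae_eq_integral => //; exact: measurable_int ieK.
have -> : \int[pi]_z lne (p z)%:E = (2 * \int[alpha]_x phi x + \int[pi]_z K z)%:E.
  transitivity (\int[pi]_z L z)%:E.
    rewrite /Rintegral fineK ?integrable_fin_num//.
    apply: ae_eq_integral => //; last exact: measurable_int iL.
    by apply: measurableT_comp; [exact: measurable_lne|exact/measurable_EFinP].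
  rewrite RintegralD// RintegralD// eint1 eint2; congr EFin; ring.
(* The cost contributes - e times the integral of K and the entropy + e times the same integral:
   only the potentials remain. *)
by rewrite -EFinM -EFinD; congr EFin; ring.
Qed.

End entropic.

Section entropic_debiasing.
Context (d : measure_display) (T : measurableType d) (R : realType).
Variables (c : T -> T -> \bar R) (e : R) (k : T -> T -> R).
Hypothesis e0 : (0 < e)%R.
Hypothesis mc : measurable_fun [set: T * T] (fun z => c z.1 z.2).
Hypothesis cNy : forall x y, c x y != -oo.
Hypothesis symc : forall x y, c x y = c y x.
Hypothesis debc : forall x y, c x x + c y y <= 2%:E * c x y.
Hypothesis kE : forall x y, (k x y)%:E = expeR (- ((e^-1)%:E * c x y)).
Hypothesis psdk : psd_kernel k.
Implicit Types (alpha beta : probability T R).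
Implicit Types (mu nu : {finite_measure set T -> \bar R}).

Let k0 := gibbs_ge0 kE.
Let mk := measurable_gibbs e0 mc cNy kE.

(* Rewrites an energy with reference measure mu, of which alpha has density f,
   as one with reference measure alpha. *)
Definition normalized_kernel (f : T -> R) (x y : T) : R :=
  ((f x)^-1 * (f y)^-1 * k x y)%R.

Lemma psd_normalized_kernel f : psd_kernel (normalized_kernel f).
Proof.
split=> [x y|n x a].
  by rewrite /normalized_kernel psdk.1 [(_ * (f y)^-1)%R]mulrC.
have := psdk.2 n x (fun i => a i * (f (x i))^-1)%R.
congr (0 <= _)%R; apply: eq_bigr => i _; apply: eq_bigr => j _.
by rewrite /normalized_kernel; ring.
Qed.

Lemma normalized_kernel_ge0 (f : T -> R) : (forall x, 0 <= f x)%R ->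
  forall x y, (0 <= normalized_kernel f x y)%R.
Proof. by move=> f0 x y; rewrite mulr_ge0// mulr_ge0 ?invr_ge0. Qed.

Lemma measurable_normalized_kernel (f : T -> R) :
  measurable_fun setT f -> (forall x, 0 <= f x)%R ->
  measurable_fun [set: T * T] (fun z => normalized_kernel f z.1 z.2).
Proof.
move=> mf f0; have mV := measurable_funV_ge0 mf f0.
exact: (measurable_weighted_kernel mk mV mV).
Qed.

Lemma normalized_energyE alpha (f : T -> R) (a b : T -> R) :
  cross_energy (normalized_kernel f) alpha alpha a b =
  cross_energy k alpha alpha (fun x => (f x)^-1 * a x)%R (fun x => (f x)^-1 * b x)%R.
Proof.
apply: eq_integral => z _; congr EFin.
by rewrite /normalized_kernel; ring.
Qed.

(** The potential is half the negative of (ln k(x,x))^+. It makes e^(2 phi) k(x,x) at most 1, hence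
    the weighted kernel at most 1 everywhere, so the energy is at most the mass of
    [finite_product mu mu]. It is integrable because (ln k(x,x))^+ = c(x,x)^- / e. *)
Lemma admissible_exists alpha mu (f : T -> R) :
  has_density alpha mu f -> diag_negative_part c alpha < +oo ->
  exists phi, admissible (normalized_kernel f) alpha phi.
Proof.
move=> hf gneg; have [mf f0 fE] := hf.
pose phi x : R := (- (Num.max 0 (ln (k x x)) / 2))%R.
have mkd : measurable_fun setT (fun x => k x x).
  exact: (measurableT_comp mk (@measurable_diag_pair d T)).
have mphi : measurable_fun setT phi.
  apply: measurableT_comp => //; apply: measurable_funM => //.
  apply: measurable_maxr => //; apply: measurableT_comp => //; exact: measurable_ln.
have mg := measurable_cost_diag mc.
exists phi; split.
  apply/integrableP; split; first exact/measurable_EFinP.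
  apply: (@le_lt_trans _ _ (\int[alpha]_x ((e^-1)%:E * (fun x => c x x)^\- x))).
    apply: ge0_le_integral => //.
    - by apply: measurableT_comp => //; exact/measurable_EFinP.
    - by apply: measurable_funeM; exact: measurable_funeneg.
    - move=> x _; rewrite funenegE /= /phi.
      have [kx|kx] := ltP 0%R (k x x); last first.
        rewrite ln0// maxxx mul0r oppr0 normr0 mule_ge0//.
          by rewrite lee_fin invr_ge0 ltW.
        by rewrite le_max lexx orbT.
      rewrite (gibbs_cost e0 cNy kE kx) -EFinN -EFin_max -EFinM lee_fin.
      rewrite mulNr opprK maxr_pMr ?invr_ge0 ?(ltW e0)// mulrA mulVf ?gt_eqF// mul1r mulr0.
      rewrite normrN ger0_norm; last by rewrite divr_ge0// le_max lexx.
      rewrite [X in (_ <= X)%R]maxC ler_piMr// ?le_max ?lexx//.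
      by rewrite invf_le1// ler1n.
  rewrite ge0_integralZl_EFin ?invr_ge0 ?ltW//; last exact: measurable_funeneg.
  by apply: lte_mul_pinfty => //; rewrite lee_fin invr_ge0 ltW.
have sq1 x : (expR (phi x) ^+ 2 * k x x <= 1)%R.
  have [kx|kx] := ltP 0%R (k x x); last first.
    by rewrite (@le_trans _ _ 0%R)// mulr_ge0_le0// exprn_ge0// expR_ge0.
  rewrite -expRM_natl -[X in (_ * X)%R](lnK kx) -expRD -[leRHS]expR0 ler_expR /phi.
  have : (ln (k x x) <= Num.max 0 (ln (k x x)))%R by rewrite le_max lexx orbT.
  lra.
have le1 z : (expR (phi z.1) * expR (phi z.2) * k z.1 z.2 <= 1)%R.
  by apply: (le_trans (ler_norm _)); exact: (psd_kernel_abs_le psdk).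
rewrite /potential_energy normalized_energyE /cross_energy.
have mu' : measurable_fun setT (fun x => (f x)^-1 * (expR \o phi) x)%R.
  by apply: measurable_funM; [exact: measurable_funV_ge0|exact: measurableT_comp].
have mw := measurable_weighted_kernel mk mu' mu'.
rewrite (density_integral (has_density_product hf hf)); last 2 first.
- exact/measurable_EFinP.
- by move=> z; rewrite lee_fin !mulr_ge0 ?invr_ge0 ?expR_ge0.
apply: (@le_lt_trans _ _ (\int[finite_product mu mu]_z (cst 1) z)); last first.
  by rewrite integral_cst// mul1e -ge0_fin_numE// fin_num_measure.
apply: ge0_le_integral => //.
- by move=> z _; rewrite -EFinM lee_fin !mulr_ge0 ?invr_ge0 ?expR_ge0.
- apply: emeasurable_funM; apply/measurable_EFinP => //.
  by apply: measurable_funM; exact: measurableT_comp.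
move=> z _; rewrite -EFinM lee_fin /=.
have -> : ((f z.1)^-1 * expR (phi z.1) * ((f z.2)^-1 * expR (phi z.2)) * k z.1 z.2
    * (f z.1 * f z.2) = ((f z.1)^-1 * f z.1) * ((f z.2)^-1 * f z.2) *
    (expR (phi z.1) * expR (phi z.2) * k z.1 z.2))%R by ring.
(* The product is 1, or 0 where f vanishes. *)
have inv1 x : ((f x)^-1 * f x <= 1)%R.
  by have [->|fx] := eqVneq (f x) 0%R; rewrite ?mulr0// mulVf.
have inv0 x : (0 <= (f x)^-1 * f x)%R by rewrite mulr_ge0 ?invr_ge0.
apply: mulr_ile1; [exact: mulr_ge0| |exact: mulr_ile1|exact: le1].
by rewrite !mulr_ge0 ?expR_ge0.
Qed.

(** The marginal equation on the whole space says that the energy of the minimizer is 1. Then J =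
    1/2 minus the integral of phi, and the value 2 e times this integral becomes e (1 - 2 J). *)
Lemma minimizer_plan alpha mu (f : T -> R) (B : R) :
  has_density alpha mu f -> diag_negative_part c alpha < +oo ->
  (forall phi, admissible (normalized_kernel f) alpha phi ->
     (B <= dual_functional (normalized_kernel f) alpha phi)%R) ->
  exists phi pi, [/\ admissible (normalized_kernel f) alpha phi,
    coupling alpha alpha pi &
    transport_value c e mu mu pi =
      (e * (1 - 2 * dual_functional (normalized_kernel f) alpha phi))%:E].
Proof.
move=> hf gneg hB; have [mf f0 fE] := hf.
have [phi0 a0] := admissible_exists hf gneg.
have psdn := psd_normalized_kernel f.
have mn := measurable_normalized_kernel mf f0.
have n0 := normalized_kernel_ge0 f0.
have [phi aphi hmin] := minimizer_exists psdn mn n0 a0 hB.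
have marg A : measurable A ->
    cross_energy (normalized_kernel f) alpha alpha
      (fun x => \1_A x * expR (phi x))%R (expR \o phi) = alpha A.
  by move=> mA; exact: (minimizer_marginal psdn.1 mn n0 aphi hmin mA).
have marg' A : measurable A ->
    cross_energy k alpha alpha (fun x => \1_A x * ((f x)^-1 * expR (phi x)))%R
      (fun x => (f x)^-1 * expR (phi x))%R = alpha A.
  move=> mA; apply: etrans (marg _ mA); rewrite normalized_energyE.
  by congr cross_energy; apply/funext => x; rewrite mulrCA.
have [pi cpi piE] := schrodinger_plan e0 mc cNy symc debc kE hf aphi.1 gneg marg'.
exists phi, pi; split => //; rewrite piE; congr EFin.
have Q1 : potential_energy (normalized_kernel f) alpha phi = 1.
  rewrite -(@probability_setT _ _ _ alpha) -(marg _ measurableT).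
  by congr cross_energy; apply/funext => x; rewrite indicT mul1r.
by rewrite /dual_functional Q1/=; field.
Qed.

Lemma marginals_dominated alpha beta mu nu (pi : probability (T * T)%type R) :
  coupling alpha beta pi -> pi `<< finite_product mu nu ->
  alpha `<< mu /\ beta `<< nu.
Proof.
move=> [h1 h2] /null_content_dominatesP hpi.
split; apply/null_content_dominatesP => A mA A0.
- rewrite -h1//; transitivity (pi (A `*` setT)).
    by congr (pi _); apply/seteqP; split=> z //= [].
  apply: hpi; first exact: measurableX.
  by transitivity (mu A * nu setT); [exact: product_measure1E|rewrite A0 mul0e].
- rewrite -h2//; transitivity (pi (setT `*` A)).
    by congr (pi _); apply/seteqP; split=> z //= [].
  apply: hpi; first exact: measurableX.
  by transitivity (mu setT * nu A); [exact: product_measure1E|rewrite A0 mule0].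
Qed.

(* Cauchy-Schwarz for the kernel turns the lower bound by the two potentials into
   one by the two self-energies, whose infima are attained. *)
Lemma entropic_debiasing alpha beta mu nu (pi : probability (T * T)%type R) :
  coupling alpha beta pi ->
  diag_negative_part c alpha < +oo -> diag_negative_part c beta < +oo ->
  exists pi1 pi2, [/\ coupling alpha alpha pi1, coupling beta beta pi2 &
    transport_value c e mu mu pi1 + transport_value c e nu nu pi2 <=
    2%:E * transport_value c e mu nu pi].
Proof.
move=> cpi fa fb.
have [Vy|Vy] := eqVneq (transport_value c e mu nu pi) +oo.
  exists (diag_plan alpha), (diag_plan beta); split; try exact: coupling_diag_plan.
  by rewrite Vy mulry gtr0_sg// mul1e leey.
have cneg := coupling_negative_part mc cNy debc cpi fa fb.
have cintNy := integral_of_neg_gtNy cneg.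
have pim : pi `<< finite_product mu nu.
  apply: contrapT => h; move: Vy; rewrite /transport_value /KL asboolF//.
  rewrite gt0_muley ?lte_fin//.
  by case: (\int[pi]_z c z.1 z.2) cintNy.
have [p hp] := density_exists pim.
have KLE := KL_density hp; have Lneg := KL_negative_part hp.
have KLNy := integral_of_neg_gtNy Lneg.
have [cy Ly] : \int[pi]_z c z.1 z.2 < +oo /\ \int[pi]_z lne (p z)%:E < +oo.
  move: Vy cintNy KLNy; rewrite /transport_value KLE.
  case: (\int[pi]_z c z.1 z.2) => [r| |]//; case: (\int[pi]_z lne (p z)%:E) => [s| |]//;
    by rewrite ?ltry ?gt0_muley ?lte_fin.
have ml : measurable_fun setT (fun z => lne (p z)%:E).
  have [mp _ _] := hp.
  by apply: measurableT_comp; [exact: measurable_lne|exact/measurable_EFinP].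
have ic := integrable_of_neg mc cneg cy.
have iL := integrable_of_neg ml Lneg Ly.
have [am bn] := marginals_dominated cpi pim.
have [f hf] := density_exists am; have [g hg] := density_exists bn.
have [mf f0 _] := hf; have [mg g0 _] := hg.
(* The value of pi divided by e. *)
pose C : R := (e^-1 * fine (\int[pi]_z c z.1 z.2)%E + fine (\int[pi]_z lne (p z)%:E)%E)%R.
have lower phi chi : admissible (normalized_kernel f) alpha phi ->
    admissible (normalized_kernel g) beta chi ->
    (1 - dual_functional (normalized_kernel f) alpha phi -
      dual_functional (normalized_kernel g) beta chi <= C)%R.
  move=> aphi achi.
  have mphi := admissible_measurable aphi; have mchi := admissible_measurable achi.
  pose u x : R := ((f x)^-1 * expR (phi x))%R.
  pose v x : R := ((g x)^-1 * expR (chi x))%R.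
  have mu' : measurable_fun setT u.
    by apply: measurable_funM; [exact: measurable_funV_ge0|exact: measurableT_comp].
  have mv : measurable_fun setT v.
    by apply: measurable_funM; [exact: measurable_funV_ge0|exact: measurableT_comp].
  have u0 x : (0 <= u x)%R by rewrite mulr_ge0 ?invr_ge0 ?expR_ge0.
  have v0 x : (0 <= v x)%R by rewrite mulr_ge0 ?invr_ge0 ?expR_ge0.
  have := psd_energy_le psdk mk k0 alpha beta mu' mv u0 v0.
  have -> : cross_energy k alpha alpha u u =
      potential_energy (normalized_kernel f) alpha phi.
    by rewrite /potential_energy normalized_energyE.
  have -> : cross_energy k beta beta v v =
      potential_energy (normalized_kernel g) beta chi.
    by rewrite /potential_energy normalized_energyE.
  rewrite (potential_energyE (normalized_kernel_ge0 f0) aphi.2).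
  rewrite (potential_energyE (normalized_kernel_ge0 g0) achi.2).
  have := cross_energy_ge0 k0 alpha beta u0 v0.
  have := entropic_lower_bound e0 mc cNy kE cpi hp hf hg ic iL aphi.1 achi.1.
  rewrite -/C -/u -/v; case: (cross_energy k alpha beta u v) => [E| |]//; last first.
    by move=> _ _; rewrite mulry gtr0_sg// mul1e.
  move=> /(_ E erefl) h _; rewrite -EFinM -EFinD lee_fin /dual_functional.
  move: h; move: (fine _) (fine _) => a b.
  move: (Rintegral alpha setT phi) (Rintegral beta setT chi) => i j; lra.
have [phi0 aphi0] := admissible_exists hf fa.
have [chi0 achi0] := admissible_exists hg fb.
(* Fixing one admissible potential on the other side makes [lower] a lower bound of J, which is what
   the existence of a minimizer requires. *)
have [phi [pi1 [aphi c1 E1]]] := minimizer_plan (B := (1 - C -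
    dual_functional (normalized_kernel g) beta chi0)%R) hf fa
  (fun xi axi => ltac:(have := lower xi chi0 axi achi0; lra)).
have [chi [pi2 [achi c2 E2]]] := minimizer_plan (B := (1 - C -
    dual_functional (normalized_kernel f) alpha phi0)%R) hg fb
  (fun xi axi => ltac:(have := lower phi0 xi aphi0 axi; lra)).
exists pi1, pi2; split => //.
rewrite E1 E2 /transport_value KLE.
rewrite -(fineK (integrable_fin_num measurableT ic)).
rewrite -(fineK (integrable_fin_num measurableT iL)).
rewrite -EFinD -(EFinM e) -EFinD -(EFinM 2) lee_fin.
have := lower _ _ aphi achi.
move: (dual_functional _ _ phi) (dual_functional _ _ chi) => a b h.
have -> : (2 * (fine (\int[pi]_z c z.1 z.2)%E + e * fine (\int[pi]_z lne (p z)%:E)%E)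
    = e * (2 * C))%R by rewrite /C; field; rewrite gt_eqF.
by rewrite -mulrDr ler_pM2l//; lra.
Qed.

End entropic_debiasing.

Local Close Scope ereal_scope.

(** * Negative definite functions *)

Section schur_product.
Context (R : realType).

Lemma psd_kernel_comp (T S : Type) (k : T -> T -> R) (g : S -> T) :
  psd_kernel k -> psd_kernel (fun x y => k (g x) (g y)).
Proof. by move=> [symk hk]; split => // n x a; exact: (hk n (g \o x) a). Qed.

Lemma psd_kernel_scale (T : Type) (k : T -> T -> R) (w : T -> R) :
  psd_kernel k -> psd_kernel (fun x y => w x * w y * k x y).
Proof.
move=> [symk hk]; split=> [x y|n x a]; first by rewrite symk [w x * _]mulrC.
have := hk n x (fun i => a i * w (x i)).
by congr (0 <= _); apply: eq_bigr => i _; apply: eq_bigr => j _; ring.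
Qed.

Lemma psd_kernel_diag0 (T : Type) (k : T -> T -> R) x y :
  psd_kernel k -> k x x = 0 -> k x y = 0.
Proof.
move=> psdk kx; apply/eqP/negPn/negP => kxy.
have k2 : 0 < k x y ^+ 2 by rewrite lt0r sqr_ge0 sqrf_eq0 kxy.
have ky := psd_kernel_diag_ge0 psdk y.
(* The weight (k y y + 1) / k x y makes the left-hand side 2 (k y y + 1), above the bound k y y. *)
have := psd_kernel_le psdk x y ((k y y + 1) / k x y ^+ 2 * k x y) 1.
rewrite kx mulr0 add0r expr1n mul1r mulr1.
have -> : (k y y + 1) / k x y ^+ 2 * k x y * k x y = k y y + 1.
  by rewrite -mulrA -expr2 divfK// gt_eqF.
by apply/negP; rewrite -ltNge; lra.
Qed.

(** Adjoins z with weight a0 to a finite family. The choice of a0 serves twice: it completes the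
    square in Gaussian elimination, and it makes the weights sum to 0 for negative definite
    functions. *)
Lemma quadratic_form_cons (T : Type) (k : T -> T -> R) n (x : 'I_n -> T)
    (a : 'I_n -> R) (z : T) (a0 : R) : (forall x y, k x y = k y x) ->
  exists (y : 'I_n.+1 -> T) (b : 'I_n.+1 -> R),
    \sum_i b i = a0 + \sum_i a i /\
    \sum_i \sum_j b i * b j * k (y i) (y j) =
      a0 ^+ 2 * k z z + 2 * a0 * \sum_i a i * k z (x i)
      + \sum_i \sum_j a i * a j * k (x i) (x j).
Proof.
move=> symk.
pose y i := if unlift ord0 i is Some i' then x i' else z.
pose b i := if unlift ord0 i is Some i' then a i' else a0.
have y0 : y ord0 = z by rewrite /y unlift_none.
have b0 : b ord0 = a0 by rewrite /b unlift_none.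
have yl i : y (lift ord0 i) = x i by rewrite /y liftK.
have bl i : b (lift ord0 i) = a i by rewrite /b liftK.
exists y, b; split.
  by rewrite big_ord_recl b0; congr (_ + _); apply: eq_bigr => i _.
rewrite big_ord_recl big_ord_recl y0 b0.
rewrite (eq_bigr (fun i => a0 * (a i * k z (x i)))) => [|i _]; last first.
  by rewrite yl bl mulrA.
rewrite [X in _ + X](eq_bigr (fun i => a0 * (a i * k z (x i)) +
    \sum_j a i * a j * k (x i) (x j))) => [|i _]; last first.
  rewrite big_ord_recl y0 b0 yl bl symk; congr (_ + _); first by ring.
  by apply: eq_bigr => j _; rewrite yl bl.
by rewrite big_split/= -mulr_sumr expr2; ring.
Qed.

(* Gaussian elimination on A; when the pivot vanishes its inverse is 0 and the
   pivot row is zero. *)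
Lemma psd_sum_mul_ge0 n (A B : 'I_n -> 'I_n -> R) :
  psd_kernel A -> psd_kernel B -> 0 <= \sum_i \sum_j A i j * B i j.
Proof.
elim: n A B => [|n IH] A B psdA psdB; first by rewrite big_ord0.
pose A' i j := A i j - A ord0 i * A ord0 j / A ord0 ord0.
have pivot i : A ord0 i * (A ord0 ord0 / A ord0 ord0) = A ord0 i.
  have [a0|a0] := eqVneq (A ord0 ord0) 0; last by rewrite divff// mulr1.
  by rewrite (psd_kernel_diag0 i psdA a0) mul0r.
have A'0 j : A' ord0 j = 0.
  by rewrite /A' -[X in X - _](pivot j); ring.
have symA' i j : A' i j = A' j i by rewrite /A' psdA.1 [A ord0 i * _]mulrC.
have psdA' : psd_kernel (fun i j : 'I_n => A' (lift ord0 i) (lift ord0 j)).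
  split=> [i j|m x a]; first exact: symA'.
  pose s := \sum_(i < m) a i * A ord0 (lift ord0 (x i)).
  (* The weight that minimizes the form of A in its pivot coordinate; the minimum is the form of the
     Schur complement A'. *)
  have [y [b [_]]] := quadratic_form_cons (fun i => lift ord0 (x i)) a ord0
    (- s / A ord0 ord0) psdA.1.
  have := psdA.2 m.+1 y b; rewrite -/s => /[swap] ->.
  have -> : \sum_(i < m) \sum_(j < m) a i * a j * A' (lift ord0 (x i)) (lift ord0 (x j))
     = \sum_(i < m) \sum_(j < m) a i * a j * A (lift ord0 (x i)) (lift ord0 (x j))
       - s * s / A ord0 ord0.
    rewrite [s * s]mulr_suml mulr_suml -sumrB; apply: eq_bigr => i _.
    rewrite /s mulr_sumr mulr_suml -sumrB; apply: eq_bigr => j _.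
    by rewrite /A'; ring.
  move=> h; apply: le_trans h _; rewrite le_eqVlt; apply/orP; left; apply/eqP.
  have [a0|a0] := eqVneq (A ord0 ord0) 0; first by rewrite a0 invr0; ring.
  by field.
(* A is A' plus a rank-one matrix, and the latter contributes the quadratic form of B at the pivot
   row. *)
have -> : \sum_i \sum_j A i j * B i j =
    (A ord0 ord0)^-1 * (\sum_i \sum_j A ord0 i * A ord0 j * B i j) +
    \sum_(i < n) \sum_(j < n) A' (lift ord0 i) (lift ord0 j)
      * B (lift ord0 i) (lift ord0 j).
  have -> : \sum_(i < n) \sum_(j < n) A' (lift ord0 i) (lift ord0 j)
      * B (lift ord0 i) (lift ord0 j) = \sum_i \sum_j A' i j * B i j.
    rewrite [RHS]big_ord_recl [X in _ = X + _]big1 ?add0r => [|j _]; last first.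
      by rewrite A'0 mul0r.
    apply: eq_bigr => i _; rewrite [RHS]big_ord_recl symA' A'0 mul0r add0r//.
  rewrite mulr_sumr -big_split/=; apply: eq_bigr => i _.
  rewrite mulr_sumr -big_split/=; apply: eq_bigr => j _.
  by rewrite /A'; ring.
apply: addr_ge0; last exact: IH psdA' (psd_kernel_comp _ psdB).
apply: mulr_ge0; last exact: (psdB.2 n.+1 id (A ord0)).
by rewrite invr_ge0; exact: psd_kernel_diag_ge0.
Qed.

Lemma psd_kernelM (T : Type) (k1 k2 : T -> T -> R) :
  psd_kernel k1 -> psd_kernel k2 -> psd_kernel (fun x y => k1 x y * k2 x y).
Proof.
move=> psd1 psd2; split=> [x y|n x a]; first by rewrite psd1.1 psd2.1.
have psdB : psd_kernel (fun i j : 'I_n => a i * a j * k2 (x i) (x j)).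
  exact/psd_kernel_scale/psd_kernel_comp.
have := psd_sum_mul_ge0 (psd_kernel_comp x psd1) psdB.
by congr (0 <= _); apply: eq_bigr => i _; apply: eq_bigr => j _; ring.
Qed.

Lemma psd_kernelX (T : Type) (k : T -> T -> R) m :
  psd_kernel k -> psd_kernel (fun x y => k x y ^+ m).
Proof.
move=> psdk; elim: m => [|m IH].
  split=> [//|n x a].
  have -> : \sum_(i < n) \sum_(j < n) a i * a j * k (x i) (x j) ^+ 0 =
      (\sum_(i < n) a i) ^+ 2.
    rewrite expr2 mulr_suml; apply: eq_bigr => i _; rewrite mulr_sumr.
    by apply: eq_bigr => j _; rewrite expr0 mulr1.
  exact: sqr_ge0.
have -> : (fun x y => k x y ^+ m.+1) = (fun x y => k x y * k x y ^+ m).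
  by apply/funext => x; apply/funext => y; rewrite exprS.
exact: psd_kernelM.
Qed.

(** The partial sums of the exponential series are nonnegative combinations of entrywise powers of
    k, and a quadratic form over finitely many points passes to the limit. *)
Lemma psd_kernel_expR (T : Type) (k : T -> T -> R) :
  psd_kernel k -> psd_kernel (fun x y => expR (k x y)).
Proof.
move=> psdk; split=> [x y|n x a]; first by rewrite psdk.1.
pose S N := \sum_(i < n) \sum_(j < n) a i * a j * series (exp_coeff (k (x i) (x j))) N.
have S0 N : 0 <= S N.
  have -> : S N = \sum_(0 <= m < N) m`!%:R^-1 *
      \sum_(i < n) \sum_(j < n) a i * a j * k (x i) (x j) ^+ m.
    rewrite /S; under [RHS]eq_bigr do rewrite mulr_sumr.
    rewrite [RHS]exchange_big/=; apply: eq_bigr => i _.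
    under [RHS]eq_bigr do rewrite mulr_sumr.
    rewrite [RHS]exchange_big/=; apply: eq_bigr => j _.
    rewrite /series/= mulr_sumr; apply: eq_bigr => m _.
    by rewrite /exp_coeff/=; ring.
  apply: sumr_ge0 => m _; apply: mulr_ge0; first by rewrite invr_ge0.
  exact: (psd_kernelX m psdk).2.
have cS : S N @[N --> \oo] --> \sum_(i < n) \sum_(j < n) a i * a j * expR (k (x i) (x j)).
  apply: cvg_big => [|i _]; first exact: add_continuous.
  apply: cvg_big => [|j _]; first exact: add_continuous.
  apply: cvgM; first exact: cvg_cst.
  exact: is_cvg_series_exp_coeff.
rewrite -(cvg_lim _ cS)//; apply: limr_ge; first by apply/cvg_ex; eexists; exact: cS.
exact: nearW.
Qed.

End schur_product.

Section schoenberg.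
Context (R : realType) (T : Type) (C : T -> T -> R).
Hypothesis ndC : negative_definite C.

(** Schoenberg's kernel: for C the squared Euclidean distance it is twice the inner product of x - z
    and y - z. The term C z z accounts for a nonzero diagonal. *)
Definition anchored_kernel (z x y : T) : R := C x z + C y z - C x y - C z z.

(** Giving z the opposite of the total weight makes the weights sum to 0; expanding C over the
    enlarged family yields minus the form of the anchored kernel. *)
Lemma psd_anchored_kernel z : psd_kernel (anchored_kernel z).
Proof.
split=> [x y|n x a]; first by rewrite /anchored_kernel (ndC.1 x y); ring.
pose s := \sum_(i < n) a i.
have [y [b [b0]]] := quadratic_form_cons x a z (- s) ndC.1.
rewrite addNr in b0; have := ndC.2 n.+1 y b b0 => /[swap] ->.
pose t := \sum_(i < n) a i * C z (x i); rewrite -/t.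
have -> : \sum_(i < n) \sum_(j < n) a i * a j * anchored_kernel z (x i) (x j) =
    t * s + s * t - \sum_(i < n) \sum_(j < n) a i * a j * C (x i) (x j) - s * s * C z z.
  rewrite -mulrA {1 3}/s {2}/t.
  rewrite !mulr_suml -big_split/= -!sumrB; apply: eq_bigr => i _.
  rewrite /t /s !mulr_sumr -big_split/= -!sumrB; apply: eq_bigr => j _.
  by rewrite /anchored_kernel (ndC.1 z (x i)) (ndC.1 z (x j)); ring.
by rewrite sqrrN; nra.
Qed.

(** Solving for - C(x,y) in the anchored kernel writes the Gibbs kernel as the exponential of a
    positive semidefinite kernel times a function of x and the same function of y. *)
Lemma negative_definite_psd (e : R) (z : T) : 0 < e ->
  psd_kernel (fun x y => expR (- (C x y / e))).
Proof.
move=> e0.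
have psdk : psd_kernel (fun x y => e^-1 * anchored_kernel z x y).
  have := psd_kernel_scale (fun=> Num.sqrt e^-1) (psd_anchored_kernel z).
  congr psd_kernel; apply/funext => x; apply/funext => y.
  by rewrite -expr2 sqr_sqrtr// invr_ge0 ltW.
have := psd_kernel_scale (fun x => expR (- (C x z / e) + C z z / (2 * e)))
  (psd_kernel_expR psdk).
congr psd_kernel; apply/funext => x; apply/funext => y.
rewrite -!expRD; congr expR; rewrite /anchored_kernel; field.
by rewrite gt_eqF.
Qed.

End schoenberg.

Local Open Scope ereal_scope.

(** * Integrals of signed kernels and of negative definite functions *)

Section signed_kernel.
Context (d : measure_display) (T : measurableType d) (R : realType).
Variables (K : T -> T -> R) (mu nu : probability T R).
Hypothesis psdK : psd_kernel K.
Hypothesis mK : measurable_fun [set: T * T] (fun z => K z.1 z.2).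

Let trunc (n : nat) (x : T) : R := if (K x x <= n%:R)%R then 1%R else 0%R.

Let mtrunc n : measurable_fun setT (trunc n).
Proof.
apply: measurable_fun_ifT => //; apply: measurable_fun_ler => //.
exact: (measurableT_comp mK (@measurable_diag_pair d T)).
Qed.

Let trunc_bnd n x : (trunc n x ^+ 2 * K x x <= n%:R)%R.
Proof.
rewrite /trunc; case: ifPn => [h|_]; first by rewrite expr1n mul1r.
by rewrite expr0n mul0r.
Qed.

Let trunc_cvg (P Q : probability T R) :
  (P \x Q).-integrable setT (fun z => (K z.1 z.2)%:E) ->
  Rintegral (P \x Q) setT (fun z => trunc n z.1 * trunc n z.2 * K z.1 z.2)%R
    @[n --> \oo] --> Rintegral (P \x Q) setT (fun z => K z.1 z.2).
Proof.
move=> iK.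
have [_ _ cint] : [/\ (P \x Q).-integrable setT (fun z => (K z.1 z.2)%:E),
   [sequence \int[P \x Q]_z `|(trunc n z.1 * trunc n z.2 * K z.1 z.2)%:E - (K z.1 z.2)%:E|]_n
     @ \oo --> 0 &
   [sequence \int[P \x Q]_z (trunc n z.1 * trunc n z.2 * K z.1 z.2)%:E]_n @ \oo -->
     \int[P \x Q]_z (K z.1 z.2)%:E].
  apply: (@dominated_convergence _ _ _ (P \x Q) setT measurableT _ _
    (fun z => `|(K z.1 z.2)%:E|)).
  - by move=> n; apply/measurable_EFinP; apply: measurable_weighted_kernel.
  - exact/measurable_EFinP.
  - apply: aeW => z _; apply: cvg_near_cst; near=> n.
    rewrite /trunc !ifT ?mul1r//.
      by near: n; exact: nbhs_infty_ger.
    by near: n; exact: nbhs_infty_ger.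
  - exact: integrable_abse.
  - apply: aeW => z n _; rewrite !abse_EFin lee_fin normrM ler_piMl//.
    rewrite normrM mulr_ile1// /trunc.
      by case: ifP => _; rewrite ?normr1 ?normr0.
    by case: ifP => _; rewrite ?normr1 ?normr0.
apply: fine_cvg; rewrite fineK//; exact: (integrable_fin_num measurableT iK).
Unshelve. all: by end_near. Qed.

(** K may change sign, so the passage from the truncated kernels to K is by dominated convergence,
    with |K| as the dominating function. *)
Lemma psd_integral_signed :
  (mu \x mu).-integrable setT (fun z => (K z.1 z.2)%:E) ->
  (mu \x nu).-integrable setT (fun z => (K z.1 z.2)%:E) ->
  (nu \x nu).-integrable setT (fun z => (K z.1 z.2)%:E) ->
  (2 * Rintegral (mu \x nu) setT (fun z => K z.1 z.2) <=
   Rintegral (mu \x mu) setT (fun z => K z.1 z.2) +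
   Rintegral (nu \x nu) setT (fun z => K z.1 z.2))%R.
Proof.
move=> i1 i2 i3; have c1 := trunc_cvg i1; have c2 := trunc_cvg i2; have c3 := trunc_cvg i3.
rewrite -subr_ge0.
pose S n := ((Rintegral (mu \x mu) setT (fun z => trunc n z.1 * trunc n z.2 * K z.1 z.2) +
  Rintegral (nu \x nu) setT (fun z => trunc n z.1 * trunc n z.2 * K z.1 z.2)) -
  2 * Rintegral (mu \x nu) setT (fun z => trunc n z.1 * trunc n z.2 * K z.1 z.2))%R.
have cS : S n @[n --> \oo] --> (Rintegral (mu \x mu) setT (fun z => K z.1 z.2) +
   Rintegral (nu \x nu) setT (fun z => K z.1 z.2) -
   2 * Rintegral (mu \x nu) setT (fun z => K z.1 z.2))%R.
  apply: cvgB; [exact: (cvgD c1 c3)|exact: cvgMr c2].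
rewrite -(cvg_lim _ cS)//; apply: limr_ge; first by apply/cvg_ex; eexists; exact: cS.
apply: nearW => n.
have mn : measurable_fun setT (fun x => - trunc n x)%R.
  by apply: measurableT_comp => //; exact: mtrunc.
have bn x : ((- trunc n x) ^+ 2 * K x x <= n%:R)%R by rewrite sqrrN.
have := psd_integral_bounded mu nu psdK mK (mtrunc n) mn (@trunc_bnd n) bn.
under [X in (_ + _ + X)%R]eq_Rintegral do rewrite mulrNN.
have -> : Rintegral (mu \x nu) setT
    (fun z => trunc n z.1 * - trunc n z.2 * K z.1 z.2)%R =
  (- Rintegral (mu \x nu) setT (fun z => trunc n z.1 * trunc n z.2 * K z.1 z.2))%R.
  under eq_Rintegral do rewrite mulrN mulNr -mulN1r.
  rewrite expectationZ ?mulN1r//.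
  exact: (bounded_measurable_weighted_kernel psdK mK (mtrunc n) (mtrunc n)
    (@trunc_bnd n) (@trunc_bnd n)).
rewrite /S; move: (Rintegral _ _ _) (Rintegral _ _ _) (Rintegral _ _ _) => a b g; lra.
Qed.

End signed_kernel.

Section negative_definite_energy.
Context (d : measure_display) (T : measurableType d) (R : realType).
Variables (C : T -> T -> R) (mu nu : probability T R).
Hypothesis ndC : negative_definite C.
Hypothesis mC : measurable_fun [set: T * T] (fun z => C z.1 z.2).
Hypothesis imm : (mu \x mu).-integrable setT (fun z => (C z.1 z.2)%:E).
Hypothesis imn : (mu \x nu).-integrable setT (fun z => (C z.1 z.2)%:E).
Hypothesis inn : (nu \x nu).-integrable setT (fun z => (C z.1 z.2)%:E).

(** By Fubini's theorem the sections of C at mu-almost every z are integrable for mu, and likewise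
    for nu; a common z exists because mu has mass 1. *)
Lemma integrable_anchor_exists : exists z,
  mu.-integrable setT (fun x => (C x z)%:E) /\ nu.-integrable setT (fun x => (C x z)%:E).
Proof.
have [N1 [mN1 N10 sN1]] := ae_integrable1 imm.
have [N2 [mN2 N20 sN2]] := ae_integrable1 imn.
have [z Nz] : exists z, ~ (N1 `|` N2) z.
  apply/not_existsP => h.
  have : mu setT = 0.
    rewrite (_ : setT = N1 `|` N2); first by rewrite null_set_setU.
    by apply/esym/seteqP; split => // z _; apply: contrapT; exact: h.
  by rewrite probability_setT => /eqP; rewrite onee_eq0.
exists z; split.
- apply: (eq_integrable measurableT (fun y => (C z y)%:E)).
    by move=> x _; rewrite ndC.1.
  by apply: contrapT => h; apply: Nz; left; exact: sN1.
- apply: (eq_integrable measurableT (fun y => (C z y)%:E)).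
    by move=> x _; rewrite ndC.1.
  by apply: contrapT => h; apply: Nz; right; exact: sN2.
Qed.

(** In the energy of the anchored kernel at mu - nu the terms depending on one variable and the
    constant cancel, since mu - nu has total mass 0. What remains is minus the energy of C. *)
Lemma negative_definite_energy_le :
  (Rintegral (mu \x mu) setT (fun z => C z.1 z.2) +
   Rintegral (nu \x nu) setT (fun z => C z.1 z.2) <=
   2 * Rintegral (mu \x nu) setT (fun z => C z.1 z.2))%R.
Proof.
have [z [imz inz]] := integrable_anchor_exists.
pose K := anchored_kernel C z.
have mCz : measurable_fun setT (fun x => C x z).
  by apply/measurable_EFinP; exact: measurable_int imz.
have mK : measurable_fun [set: T * T] (fun w => K w.1 w.2).
  apply: measurable_funB => //; apply: measurable_funB => //.
  apply: measurable_funD.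
    exact: (measurableT_comp mCz measurable_fst).
  exact: (measurableT_comp mCz measurable_snd).
have KE (P Q : probability T R) : (P \x Q).-integrable setT (fun z => (C z.1 z.2)%:E) ->
    P.-integrable setT (fun x => (C x z)%:E) -> Q.-integrable setT (fun x => (C x z)%:E) ->
    (P \x Q).-integrable setT (fun w => (K w.1 w.2)%:E) /\
    Rintegral (P \x Q) setT (fun w => K w.1 w.2) =
    (\int[P]_x C x z + \int[Q]_x C x z - Rintegral (P \x Q) setT (fun w => C w.1 w.2)
     - C z z)%R.
  move=> iPQ iP iQ; have cpl := coupling_product P Q.
  have j1 : (P \x Q).-integrable setT (EFin \o (fun w : T * T => C w.1 z)).
    exact: (integrable_marginal1 cpl iP).
  have j2 : (P \x Q).-integrable setT (EFin \o (fun w : T * T => C w.2 z)).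
    exact: (integrable_marginal2 cpl iQ).
  have j12 : (P \x Q).-integrable setT (EFin \o (fun w : T * T => C w.1 z + C w.2 z)%R).
    exact: (integrableD measurableT j1 j2).
  have jPQ : (P \x Q).-integrable setT (EFin \o (fun w : T * T => C w.1 w.2)) by [].
  have j3 : (P \x Q).-integrable setT
      (EFin \o (fun w : T * T => C w.1 z + C w.2 z - C w.1 w.2)%R).
    exact: (integrableB measurableT j12 jPQ).
  have jc : (P \x Q).-integrable setT (EFin \o (fun _ : T * T => C z z)).
    exact: (finite_measure_integrable_cst (P \x Q : probability (T * T)%type R)
      (C z z) measurableT).
  split; first exact: (integrableB measurableT j3 jc).
  rewrite (RintegralB measurableT j3 jc) (RintegralB measurableT j12 jPQ).
  rewrite (RintegralD measurableT j1 j2) expectation_cst.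
  congr (_ + _ - _ - _)%R; congr fine.
  - exact: (integral_marginal1 (f := fun x => (C x z)%:E) cpl (measurable_int _ iP)).
  - exact: (integral_marginal2 (f := fun x => (C x z)%:E) cpl (measurable_int _ iQ)).
have [i1 e1] := KE mu mu imm imz imz.
have [i2 e2] := KE mu nu imn imz inz.
have [i3 e3] := KE nu nu inn inz inz.
have := psd_integral_signed (psd_anchored_kernel ndC z) mK i1 i2 i3.
rewrite -/K e1 e2 e3.
move: (Rintegral (mu \x mu) _ _) (Rintegral (nu \x nu) _ _) (Rintegral (mu \x nu) _ _).
by move=> a b g; move: (Rintegral mu _ _) (Rintegral nu _ _) => p q; lra.
Qed.

End negative_definite_energy.

(** * Total variation and finiteness of energies *)

Section finite_measure_instances.
Context (d : measure_display) (T : measurableType d) (R : realType).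

Section charge_variation_finite.
Variables (xi : {charge set T -> \bar R}) (P N : set T).
Variable xiPN : hahn_decomposition xi P N.

Let charge_variation_fin : fin_num_fun (charge_variation xiPN).
Proof. by move=> A mA; rewrite /charge_variation fin_numD !fin_num_measure. Qed.

HB.instance Definition _ :=
  Measure_isFinite.Build _ _ _ (charge_variation xiPN) charge_variation_fin.

Lemma charge_variationE A : measurable A ->
  charge_variation xiPN A = xi (A `&` P) - xi (A `&` N).
Proof.
move=> mA; rewrite /charge_variation/= jordan_posE jordan_negE cjordan_posE cjordan_negE.
by rewrite /crestr0 mem_set// /crestr.
Qed.

End charge_variation_finite.

Section measure_sum.
Variables mu nu : {finite_measure set T -> \bar R}.

Definition measure_sum : set T -> \bar R := measure_add mu nu.

HB.instance Definition _ := Measure.on measure_sum.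

Lemma measure_sumE A : measure_sum A = mu A + nu A.
Proof. exact: measure_addE. Qed.

Let measure_sum_fin : fin_num_fun measure_sum.
Proof. by move=> A mA; rewrite measure_sumE fin_numD !fin_num_measure. Qed.

HB.instance Definition _ :=
  Measure_isFinite.Build _ _ _ measure_sum measure_sum_fin.

End measure_sum.

End finite_measure_instances.

Section finite_energy.
Context (d : measure_display) (T : measurableType d) (R : realType).
Variables (mu nu : probability T R) (f : T * T -> \bar R).
Hypothesis mf : measurable_fun setT f.
Hypothesis f0 : forall z, 0 <= f z.

Let tau : {finite_measure set T -> \bar R} := measure_sum mu nu.

(* With densities a and b of mu and nu, the pointwise inequality
   a a' + b b' + |a - b| |a' - b'| >= a b' bounds the mixed energy. *)
Lemma mixed_energy_lty :
  \int[mu \x mu]_z f z < +oo -> \int[nu \x nu]_z f z < +oo ->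
  (forall (P N : set T) (xiPN : hahn_decomposition
      (cadd (charge_of_finite_measure mu) (copp (charge_of_finite_measure nu))) P N),
     \int[charge_variation xiPN \x charge_variation xiPN]_z f z < +oo) ->
  \int[mu \x nu]_z f z < +oo.
Proof.
move=> fmm fnn fvar.
have mtau : mu `<< tau.
  apply/null_content_dominatesP => A mA; rewrite /tau/= measure_sumE => /eqP.
  by rewrite padde_eq0// => /andP[/eqP].
have ntau : nu `<< tau.
  apply/null_content_dominatesP => A mA; rewrite /tau/= measure_sumE => /eqP.
  by rewrite padde_eq0// => /andP[_ /eqP].
have [a ha] := density_exists mtau; have [b hb] := density_exists ntau.
have [ma a0 aE] := ha; have [mb b0 bE] := hb.
(* The sign of a - b gives an explicit Hahn decomposition of mu - nu, for which the variation has
   density |a - b|. *)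
pose P := [set x | (b x <= a x)%R]; pose N := [set x | (a x < b x)%R].
have mP : measurable P.
  by rewrite -[P]setTI; apply: measurable_fun_ler.
have mN : measurable N.
  by rewrite -[N]setTI; apply: measurable_fun_ltr.
pose xi : {charge set T -> \bar R} :=
  cadd (charge_of_finite_measure mu) (copp (charge_of_finite_measure nu)).
have ia := density_integrable ha; have ib := density_integrable hb.
have iab : tau.-integrable setT (EFin \o (fun x => a x - b x)%R).
  exact: (integrableB measurableT ia ib).
have xiE A : measurable A -> xi A = \int[tau]_(x in A) (a x - b x)%:E.
  move=> mA; transitivity (mu A - nu A); first by [].
  rewrite (aE _ mA) (bE _ mA).
  rewrite -integralB//; exact: integrableS (measurableT) mA _ _.
have xiP A : measurable A -> A `<=` P -> xi A = \int[tau]_(x in A) (`|a x - b x|)%:E.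
  move=> mA AP; rewrite xiE//; apply: eq_integral => x /set_mem /AP h.
  by rewrite ger0_norm// subr_ge0.
have xiN A : measurable A -> A `<=` N -> xi A = - \int[tau]_(x in A) (`|a x - b x|)%:E.
  move=> mA AN; rewrite xiE// -integral_ge0N//; apply: eq_integral => x /set_mem /AN h.
  by rewrite ltr0_norm ?subr_lt0// -EFinN opprK.
have xiPN : hahn_decomposition xi P N.
  split.
  - by split => [|A mA AP]; [exact: mP|rewrite xiP// integral_ge0].
  - by split => [|A mA AN]; [exact: mN|rewrite xiN// oppe_le0 integral_ge0].
  - apply/seteqP; split => // x _; rewrite /P /N/=.
    by case: (leP (b x) (a x)) => h; [left|right].
  - apply/seteqP; split => // x []; rewrite /P /N/= => h1 h2.
    by move: h1; rewrite leNgt h2.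
pose lam : {finite_measure set T -> \bar R} := charge_variation xiPN.
have hlam : has_density lam tau (fun x => `|a x - b x|)%R.
  split => //; first by apply: measurableT_comp => //; exact: measurable_funB.
  move=> A mA; rewrite /lam/= charge_variationE//.
  have mAP : measurable (A `&` P) by exact: measurableI.
  have mAN : measurable (A `&` N) by exact: measurableI.
  rewrite (xiP _ mAP)// (xiN _ mAN)// oppeK -ge0_integral_setU//.
  - by have [_ _ PNT _] := xiPN; rewrite -setIUr PNT setIT.
  - apply/measurable_EFinP/measurable_funTS.
    by apply: measurableT_comp => //; exact: measurable_funB.
  - apply/disj_setPS => x [[_ h1] [_ h2]].
    by move: h1; rewrite /P/= leNgt h2.
have hab := has_density_finite_product ha hb.
have haa := has_density_finite_product ha ha.
have hbb := has_density_finite_product hb hb.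
have hll := has_density_finite_product hlam hlam.
have fll := fvar P N xiPN.
have -> : \int[mu \x nu]_z f z = \int[finite_product tau tau]_z (f z * (a z.1 * b z.2)%:E).
  exact: (density_integral hab).
have fmm' : \int[finite_product tau tau]_z (f z * (a z.1 * a z.2)%:E) < +oo.
  by rewrite -(density_integral haa).
have fnn' : \int[finite_product tau tau]_z (f z * (b z.1 * b z.2)%:E) < +oo.
  by rewrite -(density_integral hbb).
have fll' : \int[finite_product tau tau]_z
    (f z * (`|a z.1 - b z.1| * `|a z.2 - b z.2|)%:E) < +oo.
  by rewrite -(density_integral hll).
have [mab _ _] := hab; have [maa _ _] := haa; have [mbb _ _] := hbb.
have [mll _ _] := hll.
have mfE (q : T * T -> R) : measurable_fun setT q ->
    measurable_fun setT (fun z => f z * (q z)%:E).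
  by move=> mq; apply: emeasurable_funM => //; exact/measurable_EFinP.
have pos z (r : R) : (0 <= r)%R -> 0 <= f z * r%:E by move=> r0; rewrite mule_ge0 ?lee_fin.
apply: (@le_lt_trans _ _ (\int[finite_product tau tau]_z (f z * (a z.1 * a z.2)%:E +
   (f z * (b z.1 * b z.2)%:E + f z * (`|a z.1 - b z.1| * `|a z.2 - b z.2|)%:E)))).
  apply: ge0_le_integral => //.
  - by move=> z _; apply: pos; rewrite mulr_ge0.
  - exact: mfE.
  - by apply: emeasurable_funD; [exact: mfE|apply: emeasurable_funD; exact: mfE].
  - move=> z _; rewrite -ge0_muleDr ?lee_fin ?mulr_ge0// -EFinD.
    rewrite -ge0_muleDr ?lee_fin ?addr_ge0 ?mulr_ge0// -EFinD.
    apply: lee_wpmul2l => //; rewrite lee_fin -normrM.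
    (* Expanding the product shows that the upper bound exceeds a b' by at least b a', which is
       nonnegative. *)
    have := ler_norm (- ((a z.1 - b z.1) * (a z.2 - b z.2)))%R; rewrite normrN.
    have := mulr_ge0 (b0 z.1) (a0 z.2).
    lra.
rewrite ge0_integralD//; [| |exact: mfE| |].
- apply: lte_add_pinfty => //; rewrite ge0_integralD//; [|
    by move=> z _; apply: pos; rewrite mulr_ge0|exact: mfE|
    by move=> z _; apply: pos; rewrite mulr_ge0|exact: mfE].
  exact: lte_add_pinfty.
- by move=> z _; apply: pos; rewrite mulr_ge0.
- by move=> z _; rewrite adde_ge0// pos// mulr_ge0.
- by apply: emeasurable_funD; exact: mfE.
Qed.

End finite_energy.

(** For a nonnegative measure the whole space and the empty set form a Hahn decomposition, and the
    variation is the measure itself. *)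
Lemma energy_of_charge d (T : measurableType d) (R : realType)
    (mu : {finite_measure set T -> \bar R}) (f : T * T -> \bar R) :
  measurable_fun setT f -> (forall z, 0 <= f z) ->
  (forall (P N : set T) (muPN : hahn_decomposition (charge_of_finite_measure mu) P N),
     \int[charge_variation muPN \x charge_variation muPN]_z f z < +oo) ->
  \int[mu \x mu]_z f z < +oo.
Proof.
move=> mf f0 fvar.
pose xi : {charge set T -> \bar R} := charge_of_finite_measure mu.
have muPN : hahn_decomposition xi setT set0.
  split.
  - by split => [|A mA _]; [exact: measurableT|exact: measure_ge0].
  - split => [|A mA]; first exact: measurable0.
    by rewrite subset0 => ->; rewrite charge0.
  - by rewrite setU0.
  - by rewrite setI0.
pose lam : {finite_measure set T -> \bar R} := charge_variation muPN.
have hlam : has_density lam mu (fun _ => 1%R).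
  split => // A mA; rewrite /lam/= charge_variationE// setIT setI0 charge0 sube0.
  by rewrite integral_cst// mul1e.
have hll := has_density_finite_product hlam hlam.
have : \int[finite_product lam lam]_z f z < +oo := fvar setT set0 muPN.
rewrite (density_integral hll)//.
by under eq_integral do rewrite mulr1 mule1.
Qed.

Lemma negative_definite_debiasing (R : realType) (X : ptopologicalType)
    (c : X -> X -> \bar R) (mu nu : probability (borel X) R) :
  measurable_fun [set: borel X * borel X] (fun z => c z.1 z.2) ->
  real_valued c -> negative_definite (fun x y => fine (c x y)) ->
  finite_energy_pairs c (mu, nu) ->
  \int[mu \x mu]_z c z.1 z.2 + \int[nu \x nu]_z c z.1 z.2 <=
  2%:E * \int[mu \x nu]_z c z.1 z.2.
Proof.
move=> mc rc ndc [/= fmu fnu fmunu].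
have cE z : c z.1 z.2 = (fine (c z.1 z.2))%:E by rewrite fineK.
have mC : measurable_fun [set: borel X * borel X] (fun z => fine (c z.1 z.2)).
  exact: measurableT_comp mc.
have mac : measurable_fun [set: borel X * borel X] (fun z => `|c z.1 z.2|).
  exact: measurableT_comp mc.
have ac0 z : 0 <= `|c z.1 z.2| by [].
have i1 := energy_of_charge mac ac0 fmu.
have i2 := energy_of_charge mac ac0 fnu.
have i3 := mixed_energy_lty mac ac0 i1 i2 fmunu.
have intC (P Q : probability (borel X) R) : \int[P \x Q]_z `|c z.1 z.2| < +oo ->
    (P \x Q).-integrable setT (fun z => (fine (c z.1 z.2))%:E).
  move=> h; apply/integrableP; split; first exact/measurable_EFinP.
  apply: le_lt_trans h; apply: ge0_le_integral => //.
    exact/measurableT_comp/measurable_EFinP.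
  by move=> z _; rewrite -cE.
have j1 := intC _ _ i1; have j2 := intC _ _ i2; have j3 := intC _ _ i3.
have intE (P Q : probability (borel X) R) :
    (P \x Q).-integrable setT (fun z => (fine (c z.1 z.2))%:E) ->
    \int[P \x Q]_z c z.1 z.2 = (Rintegral (P \x Q) setT (fun z => fine (c z.1 z.2)))%:E.
  move=> h; rewrite fineK; last exact: (integrable_fin_num measurableT h).
  by apply: eq_integral => z _; exact: cE.
rewrite (intE _ _ j1) (intE _ _ j2) (intE _ _ j3) -EFinD -EFinM lee_fin.
pose C (x y : borel X) := fine (c x y).
have t := @negative_definite_energy_le _ (borel X) R C mu nu ndc mC j1 j3 j2.
exact: t.
Qed.

Local Close Scope ereal_scope.

(** * Gram kernels and costs of Euclidean type *)

Section gram_kernel.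
Context (d : measure_display) (Z : measurableType d) (R : realType).
Variable lambda : {measure set Z -> \bar R}.

Lemma Rintegral_sum (I : Type) (s : seq I) (f : I -> Z -> R) :
  (forall i, lambda.-integrable setT (EFin \o f i)) ->
  \int[lambda]_z (\sum_(i <- s) f i z) = \sum_(i <- s) \int[lambda]_z f i z.
Proof.
move=> fi; apply: EFin_inj; rewrite fineK; last first.
  apply: (integrable_fin_num measurableT).
  under eq_fun do rewrite -sumEFin.
  by apply: (integrable_sum measurableT) => i _; exact: fi.
under eq_integral do rewrite -sumEFin.
rewrite (integral_sum measurableT fi) -sumEFin; apply: eq_bigr => i _.
by rewrite fineK//; exact: (integrable_fin_num measurableT (fi i)).
Qed.

Lemma psd_gram_kernel (X : Type) (U : X -> Z -> R) :
  (forall x, measurable_fun setT (U x)) ->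
  (forall x, lambda.-integrable setT (EFin \o (fun z => U x z ^+ 2))) ->
  psd_kernel (fun x y => \int[lambda]_z (U x z * U y z)).
Proof.
move=> mU iU.
have iUU x y : lambda.-integrable setT (EFin \o (fun z => U x z * U y z)).
  apply: (le_integrable measurableT _ _ (integrableD measurableT (iU x) (iU y))).
    by apply/measurable_EFinP; exact: measurable_funM.
  move=> z _ /=; rewrite lee_fin [leRHS]ger0_norm ?addr_ge0 ?sqr_ge0//.
  rewrite ler_norml; have := sqr_ge0 (U x z + U y z); have := sqr_ge0 (U x z - U y z).
  have := sqr_ge0 (U x z); have := sqr_ge0 (U y z).
  by rewrite !expr2 => *; apply/andP; split; nra.
split=> [x y|n x a]; first by apply: eq_Rintegral => z _; rewrite mulrC.
have -> : \sum_i \sum_j a i * a j * \int[lambda]_z (U (x i) z * U (x j) z) =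
    \int[lambda]_z (\sum_i a i * U (x i) z) ^+ 2.
  transitivity (\int[lambda]_z \sum_i \sum_j (a i * a j * (U (x i) z * U (x j) z))).
    rewrite Rintegral_sum => [|i].
      apply: eq_bigr => i _; rewrite Rintegral_sum => [|j].
        by apply: eq_bigr => j _; rewrite RintegralZl.
      exact: (integrableZl measurableT _ (iUU _ _)).
    rewrite (_ : _ \o _ = fun z => (\sum_j (a i * a j * (U (x i) z * U (x j) z))%:E)%E).
      apply: (integrable_sum measurableT) => j _.
      exact: (integrableZl measurableT _ (iUU _ _)).
    by apply/funext => z; rewrite /= sumEFin.
  apply: eq_Rintegral => z _; rewrite expr2 mulr_suml; apply: eq_bigr => i _.
  by rewrite mulr_sumr; apply: eq_bigr => j _; ring.
by apply: Rintegral_ge0 => z _; exact: sqr_ge0.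
Qed.

End gram_kernel.

Local Open Scope ereal_scope.

Section boltzmann_factor.
Context (R : realType) (t : R).
Hypothesis t0 : (0 < t)%R.
Implicit Types x y : \bar R.

Lemma boltzmann_factorE x : x != -oo ->
  expeR (- (t%:E * x)) = (if x \is a fin_num then expR (- (t * fine x)) else 0)%R%:E.
Proof. by case: x => [r| |]//= _; rewrite mulry gtr0_sg// mul1e. Qed.

Lemma boltzmann_factor_fin x : x != -oo -> expeR (- (t%:E * x)) \is a fin_num.
Proof. by move=> xNy; rewrite boltzmann_factorE. Qed.

Lemma boltzmann_factorD x y : x != -oo -> y != -oo ->
  expeR (- (t%:E * (x + y))) = expeR (- (t%:E * x)) * expeR (- (t%:E * y)).
Proof.
move=> xNy yNy; rewrite !boltzmann_factorE//; last by rewrite adde_eq_ninfty negb_or xNy.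
rewrite fin_numD -EFinM; case: ifPn => [/andP[fx fy]|]; last first.
  by rewrite negb_and => /orP[] /negbTE ->; rewrite ?mul0r ?mulr0.
by rewrite fx fy fineD// mulrDr opprD expRD.
Qed.

Lemma boltzmann_factor2 x : x != -oo ->
  expeR (- ((2 * t)%:E * x)) = expeR (- (t%:E * x)) * expeR (- (t%:E * x)).
Proof.
move=> xNy; rewrite -boltzmann_factorD//; congr (expeR (- _)).
case: x xNy => [r| |]// _.
- by rewrite -EFinD -!EFinM; congr EFin; ring.
- by rewrite addye// !gt0_muley ?lte_fin ?mulr_gt0.
Qed.

End boltzmann_factor.

(** The kernel is, up to the factors 1/f, the Gram kernel of the functions e^(- psi(x,.) / e), which
    the integrability condition on psi places in L2 of lambda. *)
Lemma euclidean_like_psd (R : realType) (X : ptopologicalType)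
    (c : X -> X -> \bar R) (e : R) : (0 < e)%R -> euclidean_like c e ->
  psd_kernel (fun x y => fine (expeR (- ((e^-1)%:E * c x y)))).
Proof.
move=> e0 [Z [psi [lambda [f [_ [psiNy mpsi] _ psiy [f0 cE]]]]]].
pose U x (z : borel Z) : R := fine (expeR (- ((e^-1)%:E * psi x z))).
have t0 : (0 < e^-1)%R by rewrite invr_gt0.
have UE x z : (U x z)%:E = expeR (- ((e^-1)%:E * psi x z)).
  by rewrite fineK// boltzmann_factor_fin.
have mU x : measurable_fun setT (U x).
  have mpx : measurable_fun [set: borel Z] (fun z => psi x z).
    exact: (measurableT_comp mpsi (measurable_pair1 (x : borel X))).
  rewrite (_ : U x = fun z => if psi x z \is a fin_num
      then expR (- (e^-1 * fine (psi x z))) else 0)%R; last first.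
    by apply/funext => z; apply: EFin_inj; rewrite UE boltzmann_factorE.
  apply: measurable_fun_ifT => //.
    apply: (measurable_fun_bool true).
    exact: (emeasurable_fin_num measurableT mpx).
  apply: measurableT_comp => //; apply: measurableT_comp => //.
  by apply: measurable_funM => //; exact: measurableT_comp.
have i2 x : lambda.-integrable setT (EFin \o (fun z => U x z ^+ 2)%R).
  apply/integrableP; split; first by apply/measurable_EFinP; exact: measurable_funX.
  apply: le_lt_trans (psiy x); rewrite le_eqVlt; apply/orP; left; apply/eqP.
  apply: eq_integral => z _ /=.
  by rewrite ger0_norm ?sqr_ge0// expr2 EFinM UE boltzmann_factor2.
have := psd_kernel_scale (fun x => (fine (f x))^-1)%R (psd_gram_kernel mU i2).
congr psd_kernel; apply/funext => x; apply/funext => y.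
rewrite cE.
have F0 z : (0 <= (fine (f z))^-1)%R by rewrite invr_ge0 fine_ge0// ltW.
(* At f x = +oo both sides vanish: [fine] gives 0, and the inverse of 0 is 0. *)
have fV : (f x * f y)^-1 = ((fine (f x))^-1 * (fine (f y))^-1)%:E.
  have := f0 x; have := f0 y; case: (f x) => [r| |]//; case: (f y) => [s| |]//=.
  - by rewrite !lte_fin => s0 r0; rewrite -EFinM inver mulf_eq0 !gt_eqF//= invfM.
  - by move=> _; rewrite lte_fin => r0; rewrite invr0 mulr0 mulry gtr0_sg// mul1e.
  - by rewrite lte_fin => s0 _; rewrite invr0 mul0r mulyr gtr0_sg// mul1e.
  - by move=> _ _; rewrite invr0 mul0r mulyy.
rewrite fV.
have -> : \int[lambda]_z expeR (- ((e^-1)%:E * (psi x z + psi y z))) =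
    \int[lambda]_z (U x z * U y z)%:E.
  by apply: eq_integral => z _; rewrite boltzmann_factorD// EFinM !UE.
rewrite /Rintegral; move: (\int[lambda]_z _) => I.
have [->|r0] := eqVneq ((fine (f x))^-1 * (fine (f y))^-1)%R 0%R; first by rewrite mul0e mul0r.
have {}r0 : (0 < (fine (f x))^-1 * (fine (f y))^-1)%R by rewrite lt0r r0 mulr_ge0.
by case: I => [s| |]//; rewrite ?gt0_muley ?gt0_muleNy ?lte_fin// mulr0.
Qed.

(** * Debiased functions and representation as an infimum *)

Section debiased_functions.
Context (R : realType) (T : Type).
Variable C : T -> T -> \bar R.

Lemma mule2_double (x : \bar R) : 2%:E * x = x + x.
Proof.
by case: x => [r| |]; rewrite ?gt0_muley ?gt0_muleNy ?lte_fin// -EFinM -EFinD; congr EFin; ring.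
Qed.

(** The two forms use different additions on the extended reals. A diagonal value -oo makes both
    hold: it absorbs the sum in the hypothesis, and subtracting it gives +oo in the conclusion. *)
Lemma debiased_ge0 x y : C x x + C y y <= 2%:E * C x y -> 0 <= debiased C x y.
Proof.
rewrite /debiased.
case: (C x y) => [d| |]; case: (C x x) => [a| |]; case: (C y y) => [b| |];
  rewrite ?gt0_muley ?gt0_muleNy ?lte_fin//= -?dEFinD -?EFinD ?lee_fin ?leey//; lra.
Qed.

Lemma debiased_ge0_double x y : C x x != -oo -> C y y != -oo ->
  0 <= debiased C x y -> C x x + C y y <= 2%:E * C x y.
Proof.
rewrite /debiased.
case: (C x y) => [d| |]; case: (C x x) => [a| |]; case: (C y y) => [b| |];
  rewrite ?gt0_muley ?gt0_muleNy ?lte_fin//= -?dEFinD -?EFinD ?lee_fin ?leey//; lra.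
Qed.

End debiased_functions.

Lemma ereal_inf_double (R : realType) (I1 I2 I : Type) (P1 : set I1) (P2 : set I2)
    (P : set I) (f1 : I1 -> \bar R) (f2 : I2 -> \bar R) (f : I -> \bar R) :
  (forall i, P i -> exists i1 i2, [/\ P1 i1, P2 i2 & f1 i1 + f2 i2 <= 2%:E * f i]) ->
  ereal_inf [set f1 i | i in P1] + ereal_inf [set f2 i | i in P2] <=
  2%:E * ereal_inf [set f i | i in P].
Proof.
move=> h; rewrite -lee_pdivrMl//; apply: le_ereal_inf_tmp => _ [i Pi <-].
have [i1 [i2 [P1i P2i le12]]] := h i Pi.
rewrite lee_pdivrMl//; apply: le_trans le12; apply: leeD.
  by apply: ereal_inf_lbound; exists i1.
by apply: ereal_inf_lbound; exists i2.
Qed.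

Section inf_representation.
Context (R : realType) (T : Type).
Variables (C : T -> T -> \bar R) (D : set (T * T)).
Hypothesis symC : forall x y, C x y = C y x.
Hypothesis debC : debiasable_on D C.

Let E := D `&` cost_pairs C.

(* Half of C u v, shifted so that twice the value at u is at least C u u. *)
Let half_value u v : \bar R := (fine (C u v) / 2 + fine (C u u) / 4 - fine (C v v) / 4)%:E.

(** Pairs outside E or of infinite cost are discarded. On the others the values in [half_value] are
    finite and satisfy the inequality that keeps the sums above C. *)
Let Psi (x : T) (uv : T * T) : \bar R :=
  if `[< E uv >] && (C uv.1 uv.2 \is a fin_num) then
    if `[< x = uv.1 >] then half_value uv.1 uv.2
    else if `[< x = uv.2 >] then half_value uv.2 uv.1 else +oo
  else +oo.

Lemma symmetric_inf_representable : inf_representable_on E C.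
Proof.
exists (T * T)%type, Psi; split.
  by move=> x uv; rewrite /Psi; case: ifP => // _; case: ifP => // _; case: ifP.
have fin u v : E (u, v) -> C u v \is a fin_num ->
   [/\ C u u \is a fin_num, C v v \is a fin_num &
     (fine (C u u) + fine (C v v) <= 2 * fine (C u v))%R].
  move=> [Duv [/= uNy vNy]] fuv.
  have := debiased_ge0_double uNy vNy (debC Duv).
  move: fuv uNy vNy; case: (C u v) => // r _; case: (C u u) => [a| |]//; by case: (C v v).
move=> x y Exy; apply/eqP; rewrite eq_le; apply/andP; split.
  apply: le_ereal_inf_tmp => _ [[u v] _ <-]; rewrite /Psi/=.
  case: ifPn => [/andP[/asboolP Euv fuv]|_]; last by rewrite addye ?leey.
  have [fu fv le2] := fin u v Euv fuv.
  have Cuv : C u v = (fine (C u v))%:E by rewrite fineK.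
  have Cu : C u u = (fine (C u u))%:E by rewrite fineK.
  have Cv : C v v = (fine (C v v))%:E by rewrite fineK.
  have symf : fine (C v u) = fine (C u v) by rewrite symC.
  (* The same endpoint u twice gives C u v + (C u u - C v v) / 2, at least C u u by debiasability;
     the two endpoints give C u v, and any other point gives +oo. *)
  case: asboolP => [->|xu]; [|case: asboolP => [->|xv]];
    (case: asboolP => [->|yu]; [|case: asboolP => [->|yv]]);
    rewrite ?addey ?addye ?leey//= -EFinD ?symf.
  - by rewrite Cu lee_fin; lra.
  - by rewrite Cuv lee_fin; lra.
  - by rewrite symC Cuv lee_fin; lra.
  - by rewrite Cv lee_fin; lra.
have [fxy|] := boolP (C x y \is a fin_num); last first.
  have [->|Cy] := eqVneq (C x y) +oo; first by rewrite leey.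
  rewrite fin_numE Cy andbT negbK => /eqP CNy.
  have [Dxy [/= xNy yNy]] := Exy; have := debiased_ge0_double xNy yNy (debC Dxy).
  rewrite CNy gt0_muleNy// leeNy_eq adde_eq_ninfty.
  by rewrite (negbTE xNy) (negbTE yNy).
apply: ge_ereal_inf; exists (Psi x (x, y) + Psi y (x, y)); first by exists (x, y).
rewrite /Psi/= fxy; case: asboolP => //= _; case: asboolP => //= _.
have symf : fine (C y x) = fine (C x y) by rewrite symC.
case: asboolP => [yx|_].
  subst y; rewrite -EFinD -[leRHS]fineK// lee_fin; lra.
case: asboolP => //= _; rewrite -EFinD -[leRHS]fineK// lee_fin symf; lra.
Qed.

End inf_representation.

(** * Optimal transport *)

Section measure_eq_invariance.
Context (d : measure_display) (T : measurableType d) (R : realType).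
Implicit Types pi m : {finite_measure set T -> \bar R}.

Lemma has_density_measure_eq pi pi' m p : measure_eq pi pi' ->
  has_density pi m p -> has_density pi' m p.
Proof.
move=> pipi' [mp p0 pE]; split => // A mA.
exact: (eq_trans (esym (pipi' A mA)) (pE A mA)).
Qed.

Lemma dominates_measure_eq pi pi' m : measure_eq pi pi' -> pi `<< m -> pi' `<< m.
Proof.
move=> pipi' /density_exists[p hp].
exact: has_density_dominates (has_density_measure_eq pipi' hp).
Qed.

Lemma KL_measure_eq pi pi' m : measure_eq pi pi' -> KL pi m = KL pi' m.
Proof.
move=> pipi'; have pi'pi : measure_eq pi' pi by move=> A mA; rewrite pipi'.
have [pim|npim] := pselect (pi `<< m).
  have [p hp] := density_exists pim.
  rewrite (KL_density hp) (KL_density (has_density_measure_eq pipi' hp)).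
  by apply: eq_measure_integral => A mA _; exact: pipi'.
rewrite /KL; case: asboolP => // _; case: asboolP => // pi'm.
by case: npim; exact: dominates_measure_eq pi'm.
Qed.

(** The decomposition is chosen by [get]; equal measures have the same decompositions, hence the
    same choice. The chosen set is measurable, including the default value, so both measures agree
    on it. *)
Lemma csiszar_measure_eq h pi pi' m : measure_eq pi pi' -> csiszar h pi m = csiszar h pi' m.
Proof.
move=> pipi'.
have decE : lebesgue_decomposition pi m = lebesgue_decomposition pi' m.
  apply/funext => fN; apply/propext; split => -[mf f0 mN N0 E]; split => // A mA.
    by rewrite -!pipi'//; [exact: E|exact: measurableI].
  by rewrite !pipi'//; [exact: E|exact: measurableI].
have mN : measurable (get (lebesgue_decomposition pi m)).2.
  have [dec|dec] := pselect (exists fN, lebesgue_decomposition pi m fN).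
    by have [_ _] := getPex dec.
  by rewrite getPN => [|fN hfN]; [exact: measurable0|apply: dec; exists fN].
by rewrite /csiszar -decE pipi'.
Qed.

Lemma penalty_finite_measure_eq h e pi pi' m : measure_eq pi pi' ->
  penalty_finite h e pi m -> penalty_finite h e pi' m.
Proof.
by move=> pipi'; rewrite /penalty_finite (csiszar_measure_eq h m pipi') (KL_measure_eq m pipi').
Qed.

End measure_eq_invariance.

Section swap_invariance.
Context (d1 d2 : measure_display) (T1 : measurableType d1)
  (T2 : measurableType d2) (R : realType).
Implicit Types pi : probability (T1 * T2)%type R.

Lemma integral_product_swap (mu : {finite_measure set T1 -> \bar R})
    (nu : {finite_measure set T2 -> \bar R}) (f : T2 * T1 -> \bar R) :
  measurable_fun setT f -> \int[nu \x mu]_z f z = \int[mu \x nu]_z f (z.2, z.1).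
Proof.
move=> mf; pose sw : {mfun (T1 * T2)%type >-> (T2 * T1)%type} := @swap_pair T1 T2.
rewrite -(@integral_pushforward_measurable _ _ _ _ _ (mu \x nu) sw f
  (@measurable_swap_pair _ _ T1 T2) mf).
apply: eq_measure_integral => A mA _.
apply: (product_measure_unique (m' := pushforward (mu \x nu) sw)) => // B1 B2 mB1 mB2.
rewrite muleC; transitivity ((mu \x nu) (B2 `*` B1)); last exact: product_measure1E.
by congr ((mu \x nu) _); apply/seteqP; split => z [].
Qed.

Lemma has_density_swap_plan pi (mu : {finite_measure set T1 -> \bar R})
    (nu : {finite_measure set T2 -> \bar R}) p :
  has_density pi (finite_product mu nu) p ->
  has_density (swap_plan pi) (finite_product nu mu) (fun z => p (z.2, z.1)).
Proof.
move=> [mp p0 pE].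
have mps : measurable_fun [set: T2 * T1] (fun z => p (z.2, z.1)).
  exact: (measurableT_comp mp (@measurable_swap_pair _ _ T2 T1)).
split => // A mA.
have mswA : measurable (@swap_pair T1 T2 @^-1` A).
  by rewrite -[X in measurable X]setTI; exact: measurable_swap_pair.
transitivity (pi (@swap_pair T1 T2 @^-1` A)); first by [].
rewrite pE// [LHS]integral_mkcond [RHS]integral_mkcond.
rewrite [RHS](@integral_product_swap mu nu); last first.
  by apply/(measurable_restrictT _ mA)/measurable_funTS/measurable_EFinP.
apply: eq_integral => -[x y] _; rewrite /patch/=.
by congr (if _ then _ else _); apply/idP/idP; rewrite !inE.
Qed.

Lemma swap_planK pi : measure_eq (swap_plan (swap_plan pi)) pi.
Proof. by move=> A mA; congr (pi _); apply/seteqP; split => -[]. Qed.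

End swap_invariance.

Lemma KL_swap_plan (d1 d2 : measure_display) (T1 : measurableType d1)
  (T2 : measurableType d2) (R : realType) (pi : probability (T1 * T2)%type R)
  (mu : {finite_measure set T1 -> \bar R}) (nu : {finite_measure set T2 -> \bar R}) :
  KL (swap_plan pi) (finite_product nu mu) = KL pi (finite_product mu nu).
Proof.
have [pim|npim] := pselect (pi `<< finite_product mu nu).
  have [p hp] := density_exists pim; have [mp _ _] := hp.
  rewrite (KL_density hp) (KL_density (has_density_swap_plan hp)) integral_swap_plan.
    by apply: eq_integral => -[x y] _.
  apply: measurableT_comp; first exact: measurable_lne.
  apply/measurable_EFinP.
  exact: (measurableT_comp mp (@measurable_swap_pair _ _ T2 T1)).
rewrite /KL; case: asboolP => [spim|_]; last by case: asboolP.
case: npim; have [q hq] := density_exists spim.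
apply: (dominates_measure_eq (@swap_planK _ _ _ _ _ pi)).
exact: has_density_dominates (has_density_swap_plan hq).
Qed.

Lemma transport_value_swap_plan (d : measure_display) (T : measurableType d)
    (R : realType) (c : T -> T -> \bar R) e (mu nu : {finite_measure set T -> \bar R})
    (pi : probability (T * T)%type R) :
  measurable_fun [set: T * T] (fun z => c z.1 z.2) -> (forall x y, c x y = c y x) ->
  transport_value c e nu mu (swap_plan pi) = transport_value c e mu nu pi.
Proof.
move=> mc symc; rewrite /transport_value KL_swap_plan integral_swap_plan//.
by congr (_ + _); apply: eq_integral => z _; rewrite symc.
Qed.

Section transport_debiasing.
Context (d : measure_display) (T : measurableType d) (R : realType).
Variables (c : T -> T -> \bar R) (e : R).
Hypothesis mc : measurable_fun [set: T * T] (fun z => c z.1 z.2).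
Hypothesis cost_c : cost c.
Hypothesis deb_c : debiasable c.
Hypothesis regular : e = 0%R \/
  (0 < e)%R /\ psd_kernel (fun x y => fine (expeR (- ((e^-1)%:E * c x y)))).

Lemma transport_debiasing (alpha beta : probability T R)
    (mu nu : {finite_measure set T -> \bar R}) (pi : probability (T * T)%type R) :
  coupling alpha beta pi ->
  exists pi1 pi2, [/\ coupling alpha alpha pi1, coupling beta beta pi2 &
    transport_value c e mu mu pi1 + transport_value c e nu nu pi2 <=
    2%:E * transport_value c e mu nu pi].
Proof.
move=> cpi; have [symc cNy] := cost_c.
have debc x y : c x x + c y y <= 2%:E * c x y.
  by apply: debiased_ge0_double => //; exact: deb_c.
(* In the infinite case the diagonal plan of alpha has value -oo, which absorbs the other
   summand. *)
have [fa|] := boolP (diag_negative_part c alpha < +oo); last first.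
  rewrite -leNgt leye_eq => /eqP fa.
  exists (diag_plan alpha), (diag_plan beta); split; try exact: coupling_diag_plan.
  by rewrite (diag_plan_value mc e mu mu fa) addNye leNye.
have [fb|] := boolP (diag_negative_part c beta < +oo); last first.
  rewrite -leNgt leye_eq => /eqP fb.
  exists (diag_plan alpha), (diag_plan beta); split; try exact: coupling_diag_plan.
  by rewrite (diag_plan_value mc e nu nu fb) addeNy leNye.
case: regular => [e0|[e0 psdk]].
  exists (diag_plan alpha), (diag_plan beta); split; try exact: coupling_diag_plan.
  rewrite /transport_value e0 !mul0e !adde0 !integral_diag_plan//=.
  exact: unregularized_debiasing.
apply: (entropic_debiasing e0 mc cNy symc debc _ psdk) => // x y.
by rewrite fineK// boltzmann_factor_fin// invr_gt0.
Qed.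

End transport_debiasing.

(** A plan in Pi(alpha, alpha) pays the penalty F1 of alpha twice, one in Pi(beta, beta) the penalty
    F2 of beta twice: together exactly twice the penalties of pi. *)
Lemma penalized_double (R : realType) (I1 I2 I K1 K2 K F1 F2 : \bar R) :
  (I1 + K1) + (I2 + K2) <= 2%:E * (I + K) ->
  (I1 + F1 + F1 + K1) + (I2 + F2 + F2 + K2) <= 2%:E * (I + F1 + F2 + K).
Proof.
have swp (a b g k : \bar R) : a + b + g + k = (a + k) + (b + g).
  by rewrite -!addeA; congr (_ + _); rewrite addeA addeC.
rewrite !mule2_double (swp I1) (swp I2) (swp I).
move: (I1 + K1) (I2 + K2) (I + K) => V1 V2 V le12.
by rewrite [leLHS]addeACA [leRHS]addeACA; apply: leeD => //; rewrite addeACA.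
Qed.

Section optimal_transport.
Context (R : realType) (X : ptopologicalType) (c : X -> X -> \bar R).
Hypothesis cost_c : cost c.
Hypothesis mc : measurable_fun [set: borel X * borel X] (fun z => c z.1 z.2).

Section regular_cost.
Variable e : R.
Hypothesis deb_c : debiasable c.
Hypothesis regular : e = 0%R \/
  (0 < e)%R /\ psd_kernel (fun x y => fine (expeR (- ((e^-1)%:E * c x y)))).

Lemma OT_debiasable : debiasable (OT c e%:E).
Proof.
move=> mu nu _; apply: debiased_ge0; apply: ereal_inf_double => pi cpi.
exact: (transport_debiasing mc cost_c deb_c regular mu nu cpi).
Qed.

(** The debiasing is applied with the marginals of each competitor pi as alpha and beta. The new
    plans keep these marginals, so they satisfy the same penalty constraints. *)
Lemma UOT_debiasable h : debiasable (UOT c h e).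
Proof.
move=> mu nu _; apply: debiased_ge0; apply: ereal_inf_double => pi [pen1 pen2].
have cpi : coupling (marginal1 pi) (marginal2 pi) pi by split.
have [pi1 [pi2 [cpi1 cpi2 le12]]] :=
  transport_debiasing mc cost_c deb_c regular mu nu cpi.
have eqsym (m m' : probability (borel X) R) : measure_eq m m' -> measure_eq m' m.
  by move=> mm' A mA; rewrite mm'.
exists pi1, pi2; split.
- by split; [apply: penalty_finite_measure_eq pen1; apply: eqsym; exact: cpi1.1
  |apply: penalty_finite_measure_eq pen1; apply: eqsym; exact: cpi1.2].
- by split; [apply: penalty_finite_measure_eq pen2; apply: eqsym; exact: cpi2.1
  |apply: penalty_finite_measure_eq pen2; apply: eqsym; exact: cpi2.2].
rewrite (csiszar_measure_eq h mu cpi1.1) (csiszar_measure_eq h mu cpi1.2).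
rewrite (csiszar_measure_eq h nu cpi2.1) (csiszar_measure_eq h nu cpi2.2).
exact: penalized_double.
Qed.

End regular_cost.

Lemma OT_sym eps mu nu : OT c eps mu nu = OT c eps nu mu.
Proof.
have [symc _] := cost_c; pose cb (x y : borel X) := c x y.
case: eps => [e| |]; rewrite /OT.
- have sub (a b : probability (borel X) R) :
      [set transport_value cb e a b pi | pi in coupling a b] `<=`
      [set transport_value cb e b a pi | pi in coupling b a].
    move=> _ [pi cpi <-]; exists (swap_plan pi); first exact: coupling_swap_plan.
    exact (@transport_value_swap_plan _ _ _ cb e a b pi mc symc).
  congr ereal_inf; apply/seteqP; split; [exact (sub mu nu)|exact (sub nu mu)].
- rewrite [RHS](integral_product_swap _ _ mc).
  by apply: eq_integral => z _; rewrite symc.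
- rewrite [RHS](integral_product_swap _ _ mc).
  by apply: eq_integral => z _; rewrite symc.
Qed.

Lemma sufficient_regular eps D : sufficient c eps D ->
  if eps is e%:E then e = 0%R \/
    (0 < e)%R /\ psd_kernel (fun x y => fine (expeR (- ((e^-1)%:E * c x y))))
  else eps = +oo /\ real_valued c /\ negative_definite (fun x y => fine (c x y)) /\
    D = finite_energy_pairs c.
Proof.
have gibbsE e : real_valued c ->
    (fun x y => fine (expeR (- ((e^-1)%:E * c x y)))) = gibbs_kernel c e.
  move=> rc; apply/funext => x; apply/funext => y; rewrite /gibbs_kernel.
  by rewrite -[c x y in LHS]fineK//= mulrC.
case=> [|e e0 eucl|e e0 [rc _ ndc]|e M e0 _ [rc _ _ psdk]|rc ndc].
- by left.
- by right; split => //; exact: euclidean_like_psd.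
(* Any point can serve as the anchor; [point] is the one at hand. *)
- by right; split => //; rewrite gibbsE//; exact: (negative_definite_psd ndc point e0).
- by right; split => //; rewrite gibbsE.
- by [].
Qed.

Lemma sufficient_debiasable eps D : debiasable c -> sufficient c eps D ->
  debiasable_on D (OT c eps).
Proof.
move=> deb_c /sufficient_regular; case: eps => [e reg mu nu _|[_ [rc [ndc ->]]] mu nu Dmn|[]//].
  exact: OT_debiasable.
by apply: debiased_ge0; exact: (negative_definite_debiasing mc rc ndc Dmn).
Qed.

(** * Dirac masses *)

Section dirac_masses.
Hypothesis polishX : polish R X.

Lemma polish_measurable_set1 (x : borel X) : measurable [set x].
Proof.
have [[dist [[dist_ge0 dist0 dist_sym _] _ nbhsE]] _] := polishX.
suff : measurable (~` [set x]) by move/measurableC; rewrite setCK.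
apply: sub_sigma_algebra; rewrite openE => y /= yx; apply/nbhsE.
exists (dist y x); last by move=> z /= /[swap] ->; rewrite ltxx.
rewrite lt0r dist_ge0 andbT; apply/eqP => /dist0 yx0; exact: yx.
Qed.

Local Notation dirac_at x := (dirac x : probability (borel X) R).

Lemma dirac_inj (x y : borel X) : measure_eq (dirac_at x) (dirac_at y) -> x = y.
Proof.
move=> h; have : \d_x [set x] = \d_y [set x] :> \bar R := h _ (polish_measurable_set1 x).
rewrite !diracE mem_set// => /eqP.
by case: (boolP (y \in [set x])) => [/set_mem/= ->|_]//; rewrite onee_eq0.
Qed.

(** Each marginal makes the complement of one line through (x, y) null, so the whole mass sits at
    that point. *)
Lemma coupling_dirac (x y : borel X) (pi : probability (borel X * borel X)%type R) :
  coupling (dirac_at x) (dirac_at y) pi ->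
  forall A, measurable A -> pi A = dirac (x, y) A.
Proof.
move=> [h1 h2].
have mx := polish_measurable_set1 x; have my := polish_measurable_set1 y.
pose N1 : set (borel X * borel X) := ~` [set x] `*` setT.
pose N2 : set (borel X * borel X) := setT `*` ~` [set y].
have mN1 : measurable N1 by apply: measurableX => //; exact: measurableC.
have mN2 : measurable N2 by apply: measurableX => //; exact: measurableC.
have N10 : pi N1 = 0.
  transitivity (marginal1 pi (~` [set x])).
    by congr (pi _); apply/seteqP; split => z // [].
  transitivity (\d_x (~` [set x]) : \bar R); first exact/h1/measurableC.
  by rewrite diracE memNset// => /(_ erefl).
have N20 : pi N2 = 0.
  transitivity (marginal2 pi (~` [set y])).
    by congr (pi _); apply/seteqP; split => z // [].
  transitivity (\d_y (~` [set y]) : \bar R); first exact/h2/measurableC.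
  by rewrite diracE memNset// => /(_ erefl).
have N0 : pi (N1 `|` N2) = 0 by rewrite null_set_setU.
have null A : measurable A -> ~ A (x, y) -> pi A = 0.
  move=> mA Axy; apply: (subset_measure0 _ _ _ N0) => //; first exact: measurableU.
  move=> [u v] Auv; have [ux|ux] := pselect (u = x); last by left.
  by right; split => //= vy; apply: Axy; rewrite -ux -vy.
move=> A mA; rewrite diracE; case: (boolP (_ \in A)) => [/set_mem Axy|Axy].
  have : pi (~` A) = 0 by apply: null => //; exact: measurableC.
  by have := probability_setC pi (measurableC mA); rewrite setCK => -> ->; rewrite sube0.
by apply: null => // /mem_set; apply/negP.
Qed.

(** Every coupling agrees with the product on measurable sets, hence has density 1 with respect to
    it: the entropy vanishes and the value is c x y for every eps. *)
Lemma OT_dirac eps (x y : borel X) : 0 <= eps ->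
  OT c eps (dirac_at x) (dirac_at y) = c x y.
Proof.
move=> eps0.
have cpl := coupling_product (dirac_at x) (dirac_at y).
have intE pi : coupling (dirac_at x) (dirac_at y) pi ->
    \int[pi]_z c z.1 z.2 = c x y.
  move=> cpi; transitivity (\int[dirac (x, y)]_z c z.1 z.2).
    by apply: eq_measure_integral => A mA _; exact: coupling_dirac.
  by rewrite integral_dirac// diracT mul1e.
case: eps eps0 => [e| |]// _; last exact: intE cpl.
rewrite /OT (_ : [set _ | _ in _] = [set c x y]) ?ereal_inf1//.
have valE pi : coupling (dirac_at x) (dirac_at y) pi ->
    \int[pi]_z c z.1 z.2 + e%:E * KL pi (finite_product (dirac_at x) (dirac_at y)) = c x y.
  move=> cpi; rewrite intE//.
  have hp : has_density pi (finite_product (dirac_at x) (dirac_at y)) (fun=> 1%R).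
    split => // A mA; rewrite integral_cst// mul1e.
    exact: (eq_trans (coupling_dirac cpi mA) (esym (coupling_dirac cpl mA))).
  rewrite (KL_density hp) -[X in e%:E * X](_ : 0 = _) ?mule0 ?adde0//.
  by rewrite integral0_eq// => z _; rewrite -(@lne1 R).
apply/seteqP; split => [_ [pi cpi <-]|_ ->]; first exact: valE.
exists (dirac_at x \x dirac_at y : probability (borel X * borel X)%type R); first exact: cpl.
exact (valE _ cpl).
Qed.

Lemma debiased_OT_dirac eps (x y : borel X) : 0 <= eps ->
  debiased (OT c eps) (dirac_at x) (dirac_at y) = debiased c x y.
Proof. by move=> eps0; rewrite /debiased !OT_dirac. Qed.

End dirac_masses.
End optimal_transport.

Theorem theorem1p7 (R : realType) (X : ptopologicalType) (c : X -> X -> \bar R)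
    (polishX : polish R X) (cost_c : cost c)
    (mc : measurable_fun [set: borel X * borel X] (fun z => c z.1 z.2)) :
  (debiasable c ->
   forall (eps : \bar R)
     (D : set (probability (borel X) R * probability (borel X) R)),
     sufficient c eps D ->
     [/\ debiasable_on D (OT c eps),
         inf_representable_on (D `&` cost_pairs (OT c eps)) (OT c eps)
       & forall (e : R) (h : R -> \bar R), eps = e%:E -> entropy_function h ->
           debiasable (UOT c h e)]) /\
  (forall eps : \bar R, 0 <= eps ->
     (debiasable (OT c eps) -> debiasable c) /\
     (strictly_debiasable
        (fun mu nu : probability (borel X) R => measure_eq mu nu) (OT c eps) ->
      strictly_debiasable eq c)).
Proof.
split=> [deb_c eps D suf|eps eps0].
  have deb := sufficient_debiasable cost_c mc deb_c suf.
  split => //.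
    exact: symmetric_inf_representable (OT_sym cost_c mc eps) deb.
  move=> e h epsE _; apply: UOT_debiasable => //.
  by have := sufficient_regular suf; rewrite epsE.
split=> deb x y => [_|xy].
  by rewrite -(debiased_OT_dirac mc polishX x y eps0); exact: deb.
rewrite -(debiased_OT_dirac mc polishX x y eps0); apply: deb.
by move=> /(dirac_inj polishX).
Qed.
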